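(* Let $\alpha$ be an algebraic number of degree $8$ over $\mathbb{Q}$. Some four distinct algebraic conjugates $\alpha_1,\alpha_2,\alpha_3,\alpha_4$ of $\alpha$ satisfy the relation $$\alpha_{1}=\alpha_{2}+\alpha_{3}+\alpha_{4}$$ if and only if the minimal polynomial of $\alpha$ over $\mathbb{Q}$ is an irreducible polynomial of the form $$x^{8} + ax^{6} + bx^{4} + cx^{2} + \frac{1}{64}(a^{2}-4b)^{2}\in\mathbb{Q}[x]$$ with $a,b,c\in\mathbb{Q}$. For every such $\alpha$, the Galois group over $\mathbb{Q}$ of the normal closure of $\mathbb{Q}(\alpha)$ is isomorphic to one of the groups $$C_2\times C_2\times C_2,\quad C_2\times C_4,\quad D_4,\quad C_2\times D_4,\quad S_4,\quad C_2\times A_4,\quad C_2\times S_4 .$$ Moreover, each of these seven groups appears as the Galois group for some such $\alpha$; namely, the following polynomials are minimal polynomials of such $\alpha$ with the indicated Galois groups: \begin{itemize} \item $x^8 + 6x^6 + 8x^4 + 3x^2 + 1/4$, with group $C_2\times C_2\times C_2$; \item $x^8 + 7x^4 + 8x^2 + 49/4$, with group $C_2\times C_4$; \item $x^8 + x^4 + 4x^2 + 1/4$, with group $D_4$; \item $x^8 + 3x^4 + 4x^2 + 9/4$, with group $C_2\times D_4$; \item $x^8 + 4x^6 + 4x^2 + 4$, with group $S_4$; \item $x^8 + 6x^4 + 8x^2 + 9$, with group $C_2\times A_4$; \item $x^8 + x^4 + 2x^2 + 1/4$, with group $C_2\times S_4$. \end{itemize}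
   Context: The algebraic conjugates of $\alpha$ are the complex roots of its (monic) minimal polynomial over $\mathbb{Q}$; minimal polynomials are over $\mathbb{Q}$. $C_n$ is the cyclic group of order $n$, $D_4$ is the dihedral group of order $8$, and $S_4$, $A_4$ are the symmetric and alternating groups on $4$ letters. *)

(* Defs.v *)
From HB Require Import structures.
From mathcomp Require Import all_boot all_order all_algebra.
From mathcomp Require Import all_fingroup all_solvable all_field.

Set Implicit Arguments.
Unset Strict Implicit.
Unset Printing Implicit Defensive.

Import GRing.Theory.

Local Open Scope ring_scope.

Notation pQtoC := (map_poly (ratr : rat -> algC)).

(* minCpoly alpha is the minimal polynomial over Q, coerced to {poly algC};   *)
(* size is degree + 1.                                                        *)
Definition degree8 (alpha : algC) : Prop := size (minCpoly alpha) = 9%N.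

Definition conjugate (alpha beta : algC) : bool := root (minCpoly alpha) beta.

Definition conjugate_relation (alpha : algC) : Prop :=
  exists a1 a2 a3 a4 : algC,
    [/\ uniq [:: a1; a2; a3; a4],
        all (conjugate alpha) [:: a1; a2; a3; a4]
      & a1 = a2 + a3 + a4].

Definition octic (a b c : rat) : {poly rat} :=
  'X^8 + a *: 'X^6 + b *: 'X^4 + c *: 'X^2
  + (1 / 64 * (a ^+ 2 - 4 * b) ^+ 2)%:P.

(* The smallest subfield of algC that is normal over Q and contains alpha,    *)
(* presented as an abstract number field with an embedding in algC: fields of *)
(* type splittingFieldType rat are exactly the finite normal extensions of Q, *)
(* and nc_min says that no proper subfield containing alpha is normal.        *)
Record normal_closure (alpha : algC) : Type := NormalClosure {
  nc_field :> splittingFieldType rat;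
  nc_emb : {rmorphism nc_field -> algC};
  nc_gen : nc_field;
  nc_genE : nc_emb nc_gen = alpha;
  nc_min : forall E : {subfield nc_field},
    nc_gen \in E -> normalField 1 E -> E = {:nc_field}%VS :> {vspace nc_field}
}.

(* Witnesses that the universal quantifier in has_galois_group is not vacuous *)
Lemma normal_closure_exists (alpha : algC) : normal_closure alpha.
Proof.
have [q [Dq _] q_min] := minCpolyP alpha.
have [r Dr] := closed_field_poly_normal (minCpoly alpha).
rewrite (monicP (minCpoly_monic alpha)) scale1r in Dr.
have r_alpha : alpha \in r by rewrite -root_prod_XsubC -Dr root_minCpoly.
have [L [iota [rs Drs genL]]] := num_field_exists r.
have emb_alg (p : {poly rat}) :
  map_poly iota (map_poly (in_alg L) p) = pQtoC p.
  rewrite -map_poly_comp; apply: eq_map_poly => x /=.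
  by rewrite alg_num_field fmorph_rat.
have splitL : SplittingField.axiom L.
  exists (map_poly (in_alg L) q).
    by apply/polyOverP => i; rewrite coef_map memvZ ?memv_line.
  exists rs; last exact: genL.
  suff ->: map_poly (in_alg L) q = \prod_(z <- rs) ('X - z%:P) by apply: eqpxx.
  apply: (map_poly_inj iota).
  rewrite emb_alg -Dq Dr -Drs big_map rmorph_prod /=.
  by apply: eq_bigr => z _; rewrite map_polyXsubC.
pose mL := FieldExt_isSplittingField.Build rat L splitL.
pose N : splittingFieldType rat := HB.pack (L : Type) L mL.
have [x rs_x Dx] : {x | x \in rs & iota x = alpha}.
  by move: r_alpha; rewrite -Drs => /mapP/sig2_eqW[x]; exists x.
apply: (@NormalClosure alpha N iota x Dx) => E Ex /normalFieldP/(_ x Ex)[s s_E Ds].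
apply/eqP; rewrite eqEsubv subvf /=.
have -> : {:N}%VS = <<1 & rs>>%VS by rewrite genL.
apply/Fadjoin_seqP; split=> [|y rs_y]; first exact: sub1v.
suff: root (@minPoly rat N 1%AS x) y.
  by rewrite Ds root_prod_XsubC => /(allP s_E).
have /polyOver1P[m Dm] := @minPolyOver rat N 1%AS x.
rewrite -(fmorph_root iota) Dm emb_alg.
have /dvdpP[m1 ->] : q %| m.
  by rewrite -q_min -emb_alg -Dm -Dx fmorph_root root_minPoly.
by rewrite rmorphM rootM /= -Dq Dr root_prod_XsubC -Drs map_f ?orbT.
Qed.

Definition has_galois_group (alpha : algC) (gT : finGroupType) (G : {set gT}) :
  Prop := forall N : normal_closure alpha, 'Gal({:N} / 1)%g \isog G.

Definition gC2xC2xC2 := setX (setX (Zp 2) (Zp 2)) (Zp 2).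
Definition gC2xC4 := setX (Zp 2) (Zp 4).
(* 'D_8 is the dihedral group of order 8 *)
Definition gD4 := ('D_8)%g.
Definition gC2xD4 := setX (Zp 2) gD4.
Definition gS4 := ('Sym_('I_4))%g.
Definition gC2xA4 := setX (Zp 2) ('Alt_('I_4))%g.
Definition gC2xS4 := setX (Zp 2) gS4.

Definition realizes (p : {poly rat}) (gT : finGroupType) (G : {set gT}) :
    Prop :=
  exists alpha : algC,
    [/\ degree8 alpha, conjugate_relation alpha,
        minCpoly alpha = pQtoC p & has_galois_group alpha G].

(* Main.v *)
(* Write the relation as w_0 + w_1 + w_2 + w_3 = 0 with w_0 = alpha_1 and
   w_i = - alpha_(i+1).  The crucial point is that the conjugates are closed
   under negation.  In an integer relation sum_j c_j u_j = 0 between conjugates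
   with |c_i| >= sum_(j != i) |c_j|, moving u_i to a conjugate of largest modulus
   turns the triangle inequality into an equality, so all u_j with c_j != 0 are
   equal to +- u_i.  Every conjugate is a sum of three others and the trace is 0;
   whichever triples occur, some integer combination of at most four of these
   relations and the trace is dominated in this sense.

   The conjugates are then the +- w_i, and their minimal polynomial is
   h(x) h(-x) = (x^4 + p x^2 + r)^2 - d x^2 with h = prod (x - w_i) and
   d = sigma_3(w)^2; this is the octic form.  As no proper nonempty subfamily
   of the w_i has sum 0, an automorphism permutes them up to one common sign:
   the Galois group is a subgroup of C_2 x S_4 transitive on the +- w_i, either
   C_2 x H or isomorphic to H, with H one of the transitive subgroups of S_4.

   For a given octic, irreducibility follows from the irrationality of
   sigma_3(w), w_i^2, w_i w_j and w_i + w_j.  The group is determined by the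
   roots w_i w_j + w_k w_l of the resolvent cubic, together with the rationality
   of the semi-invariants sigma_3, the Vandermonde product, cyclic4 below (when
   the resolvent cubic has a rational root) and their products.  Irrationality is
   checked modulo small primes. *)
From HB Require Import structures.
Require Import Defs.
From mathcomp Require Import all_boot all_order all_algebra.
From mathcomp Require Import all_fingroup all_solvable all_field.
From mathcomp Require Import ring lra zify.

Set Implicit Arguments.
Unset Strict Implicit.
Unset Printing Implicit Defensive.

Import Order.TTheory GRing.Theory Num.Theory.
Local Open Scope ring_scope.

(** * Galois groups over the rationals *)

(** Two models of the conjugates are used side by side. Absolute values live in [algC], so dominated
    relations are treated there, with automorphisms of [algC]; Galois groups and fixed fields live
    in an abstract [splittingFieldType]. [gal_extend_aut] and [aut_restrict_gal] carry automorphisms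
    from one model to the other.

    The obstacle to closure under negation is that conjugating the given relation does not tell
    which three conjugates add up to a given one. Assuming that no two conjugates are opposite, all
    triples are enumerated until each branch contains a dominated combination.

    The number seven comes from a count: the group acts transitively on eight points, so its order
    is a multiple of 8. Up to conjugacy S_4 has five transitive subgroups H, and only D_4 and S_4
    have such an order. Hence five products C_2 x H and two groups without the factor C_2. *)

Section RationalGalois.
Variable L : splittingFieldType rat.
Implicit Types (x y : L) (g : gal_of {:L}).

Lemma galois_rat : galois 1 {:L}.
Proof.
rewrite /galois sub1v normalFieldf; apply/and3P; split=> //.
apply/separableP => x _; apply: pcharf0_separable => p.
by rewrite pchar_lalg pchar_num.
Qed.

Lemma gal_total g : g \in 'Gal({:L} / 1)%g.
Proof.
by rewrite gal_kHom ?sub1v ?k1AHom.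
Qed.

Lemma gal_fixed_rat x : (forall g, g x = x) -> {c : rat | x = c%:A}.
Proof.
move=> fix_x; suff: x \in 1%VS by move/vlineP/sig_eqW.
have /galois_fixedField <- := galois_rat.
by apply/fixedFieldP => [|g _]; rewrite ?memvf.
Qed.

Lemma gal_rat g (c : rat) : g (c%:A) = c%:A.
Proof. by rewrite linearZ rmorph1. Qed.

Lemma root_minPoly_galP x y :
  reflect (exists g, y = g x) (root (minPoly 1 x) y).
Proof.
apply: (iffP idP) => [rt_y | [g ->]].
  have [g _ <-] := normalField_root_minPoly (sub1v _) (normalFieldf _) (memvf x) rt_y.
  by exists g.
exact: root_minPoly_gal (sub1v _) (gal_total g) (memvf x).
Qed.

End RationalGalois.

Section Embedding.
Variables (L : splittingFieldType rat) (iota : {rmorphism L -> algC}).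
Implicit Types (x : L) (z : algC) (g : gal_of {:L}).

Lemma emb_rat (c : rat) : iota c%:A = ratr c.
Proof. by rewrite alg_num_field fmorph_rat. Qed.

Lemma map_emb_in_alg (p : {poly rat}) :
  map_poly iota (map_poly (in_alg L) p) = pQtoC p.
Proof. by rewrite -map_poly_comp; apply: eq_map_poly => c /=; rewrite emb_rat. Qed.

Lemma map_emb_minPoly x : map_poly iota (minPoly 1 x) = minCpoly (iota x).
Proof.
have [q [Dq mon_q] q_min] := minCpolyP (iota x).
have /polyOver1P[m Dm] := minPolyOver 1%AS x.
apply/eqP; rewrite -eqp_monic ?minCpoly_monic ?map_monic ?monic_minPoly //.
rewrite Dq -map_emb_in_alg eqp_map /eqp; apply/andP; split.
  apply: minPoly_dvdp; first by apply/polyOverP=> i; rewrite coef_map memvZ ?memv_line.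
  by rewrite -(fmorph_root iota) map_emb_in_alg -Dq root_minCpoly.
rewrite Dm dvdp_map -q_min -map_emb_in_alg fmorph_root.
by rewrite (_ : map_poly _ m = minPoly 1 x) ?root_minPoly.
Qed.

Lemma root_minCpoly_galP x z :
  reflect (exists g, z = iota (g x)) (root (minCpoly (iota x)) z).
Proof.
rewrite -map_emb_minPoly; apply: (iffP idP) => [|[g ->]]; last first.
  by rewrite fmorph_root; apply/root_minPoly_galP; exists g.
have [rs /eqP Drs] := splitting_field_normal 1%AS x.
rewrite Drs rmorph_prod (eq_bigr (fun y => 'X - (iota y)%:P)); last first.
  by move=> y _; rewrite /= map_polyXsubC.
rewrite -(big_map iota predT (fun y => 'X - y%:P)) root_prod_XsubC => /mapP[y rs_y ->].
have /root_minPoly_galP[g ->] : root (minPoly 1 x) y by rewrite Drs root_prod_XsubC.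
by exists g.
Qed.

Lemma gal_extend_aut g :
  {nu : {rmorphism algC -> algC} | {morph iota : x / g x >-> nu x}}.
Proof. exact: (extend_algC_subfield_aut iota (g : {rmorphism L -> L})). Qed.

Lemma aut_restrict_gal (nu : {rmorphism algC -> algC}) :
  exists g, {morph iota : x / g x >-> nu x}.
Proof.
have [nu0 nu0P] := restrict_aut_to_normal_num_field iota nu.
have hom_nu0: kHom 1 {:L} (linfun nu0).
  apply/kHom_monoid_morphism; split=> [|x y]; rewrite !lfunE /= ?rmorph1 //.
  exact: rmorphM.
have [|g _ gP] := kHom_to_gal _ (normalFieldf 1) hom_nu0; first by rewrite sub1v subvv.
by exists g => x; rewrite -nu0P -gP ?memvf // lfunE.
Qed.

End Embedding.

Lemma conjugate_aut (alpha beta : algC) :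
  root (minCpoly alpha) beta ->
  exists nu : {rmorphism algC -> algC}, nu alpha = beta.
Proof.
have N := normal_closure_exists alpha.
rewrite -{1}(nc_genE N) => /root_minCpoly_galP[g ->].
have [nu nuP] := gal_extend_aut (nc_emb N) g.
by exists nu; rewrite nuP nc_genE.
Qed.

(** * Dominated integer relations between conjugates *)

Lemma max_norm_exists (s : seq algC) :
  s != [::] -> exists2 x, x \in s & {in s, forall y, `|y| <= `|x|}.
Proof.
elim: s => // x [|y s] IHs _.
  by exists x => [|z]; rewrite inE // => /eqP->.
have [//|z s_z z_max] := IHs.
have [le_xz|lt_zx] := real_leP (normr_real x) (normr_real z).
  by exists z => [|t]; rewrite inE ?s_z ?orbT // => /predU1P[->|/z_max].
exists x => [|t]; rewrite inE ?eqxx // => /predU1P[->//|/z_max/le_trans->//].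
exact: ltW.
Qed.

(* Move [us i] by an automorphism to a conjugate of largest modulus: the
   triangle inequality is then an equality. *)
Lemma dominated_relation (alpha : algC) n (us : 'I_n -> algC) (c : 'I_n -> int) i :
    (forall j, root (minCpoly alpha) (us j)) ->
    \sum_j (c j)%:~R * us j = 0 ->
    \sum_(j | j != i) `|c j| <= `|c i| ->
  forall j, j != i ->
    `|c i|%:~R * (c j)%:~R * us j = - (`|c j|%:~R * (c i)%:~R * us i).
Proof.
move=> us_rt us0 c_dom; have [r Dr] := closed_field_poly_normal (minCpoly alpha).
rewrite (monicP (minCpoly_monic _)) scale1r in Dr.
have us_r j : us j \in r by rewrite -root_prod_XsubC -Dr.
have [|b r_b b_max] := @max_norm_exists r; first by case: (r) (us_r i).
have m_us j : minCpoly (us j) = minCpoly alpha.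
  by have /conjugate_aut[nu <-] := us_rt j; rewrite minCpoly_aut.
have [nu nu_i] : exists nu : {rmorphism algC -> algC}, nu (us i) = b.
  by apply: conjugate_aut; rewrite m_us Dr root_prod_XsubC.
have nu_us j : `|nu (us j)| <= `|b|.
  by apply: b_max; rewrite -root_prod_XsubC -Dr -(m_us j) -(minCpoly_aut nu) root_minCpoly.
move=> j ne_ji; apply: (fmorph_inj nu); rewrite rmorphN !rmorphM !rmorph_int nu_i.
(* If the largest modulus is 0, every conjugate is 0; if [c i] is 0, domination kills the other
   coefficients. The conclusion is stated without division so as to cover both cases. *)
have [b0|nz_b] := eqVneq b 0.
  have := nu_us j; rewrite b0 normr0 normr_le0 => /eqP->.
  by rewrite !mulr0 oppr0.
have [ci0|nz_ci] := eqVneq (c i) 0.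
  move: c_dom; rewrite ci0 normr0 (bigD1 j) //= => c_dom.
  have: `|c j| <= 0 by apply: le_trans c_dom; rewrite lerDl sumr_ge0.
  by rewrite normr_le0 => /eqP->; rewrite normr0 !mul0r oppr0.
have nz_cC: (c i)%:~R != 0 :> algC by rewrite intr_eq0.
(* With the term of index i isolated, the [F k] sum to 1 and are bounded in modulus by the [G k],
   which also sum to 1; [normC_sum_upper] then gives [F k = G k] for each k. *)
pose F k : algC := - ((c k)%:~R * nu (us k)) / ((c i)%:~R * b).
pose G k : algC := `|c k|%:~R / `|c i|%:~R.
have leFG k : k != i -> `|F k| <= G k.
  move=> _; rewrite /F /G normrM normfV normrN !normrM -!intr_norm.
  rewrite invfM mulrACA ler_piMr // ?divr_ge0 ?ler0z //.
  by rewrite ler_pdivrMr ?normr_gt0 // mul1r.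
have sumF : \sum_(k | k != i) F k = 1.
  rewrite -mulr_suml sumrN; apply: (canLR (mulfK _)); first by rewrite mulf_neq0.
  rewrite mul1r; apply/eqP; rewrite eqr_oppLR -addr_eq0 addrC -{1}nu_i.
  rewrite -[_ + _](bigD1 i (F := fun k => (c k)%:~R * nu (us k)) isT).
  rewrite (eq_bigr (fun k => nu ((c k)%:~R * us k))) => [|k _]; last first.
    by rewrite rmorphM rmorph_int.
  by rewrite -rmorph_sum us0 rmorph0.
(* The upper bound is domination, the lower one the triangle inequality applied to [sumF]. *)
have sumG : \sum_(k | k != i) G k = 1.
  apply/eqP; rewrite eq_le; apply/andP; split.
    rewrite -mulr_suml -rmorph_sum /= ler_pdivrMr ?ltr0z ?normr_gt0 // mul1r.
    by rewrite ler_int.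
  rewrite -normr1 -sumF; apply: le_trans (ler_norm_sum _ _ _) _.
  exact: ler_sum.
have /(_ j ne_ji) := normC_sum_upper leFG (etrans sumF (esym sumG)).
rewrite /F /G => /eqP; rewrite eqr_div ?mulf_neq0 ?intr_eq0 ?normr_eq0 // => /eqP eqFG.
by rewrite -[RHS]opprK -!mulrA -eqFG; ring.
Qed.

(* Integer relations between eight numbers are coded by their coefficients.  *)
Definition relation_row (i : nat) (t : nat * nat * nat) : seq int :=
  let: (j, k, l) := t in
  mkseq (fun m => (m == i)%:Z - (m == j)%:Z - (m == k)%:Z - (m == l)%:Z) 8.

Fixpoint lincomb (co : seq int) (rows : seq (seq int)) : seq int :=
  match co, rows with
  | a :: co', row :: rows' =>
      [seq a * xy.1 + xy.2 | xy <- zip row (lincomb co' rows')]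
  | _, _ => nseq 8 0
  end.

(** [s <= 2 * absz x] says that |x| is at least the sum of the other absolute values; [0 < s]
    discards the zero combination, which carries no information. *)
Definition dominated (c : seq int) : bool :=
  let s := sumn [seq absz x | x <- c] in
  (0 < s)%N && has (fun x => (s <= 2 * absz x)%N) c.

Definition triples (i : nat) : seq (nat * nat * nat) :=
  [seq t <- [seq (jk, l) | jk <- [seq (j, k) | j <- iota 0 8, k <- iota 0 8],
                           l <- iota 0 8]
     | let: (j, k, l) := t in (j < k)%N && (k < l)%N && (i \notin [:: j; k; l])].

(* Level [n] of [certs] lists the linear combinations (coefficients in the
   order: last relation added, ..., first relation) tried once the relation
   of index [n] is known. *)
Fixpoint refuted n (certs : seq (seq (seq int))) (rows : seq (seq int)) : bool :=
  if certs isn't cos :: certs' then false else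
  all (fun t => let rows' := relation_row n t :: rows in
    if has (fun co => dominated (lincomb co rows')) cos then true
    else refuted n.+1 certs' rows')
    (triples n).

(** The last coefficient of each list belongs to the trace row. For instance [[:: 2; -1; 1]] settles
    the case u_1 = u_2 + u_3 + u_4: twice this relation, minus u_0 = u_1 + u_2 + u_3, plus the
    trace, is 4 u_1 - u_4 + u_5 + u_6 + u_7 = 0, which is dominated. *)
Definition search_certs : seq (seq (seq int)) :=
  [:: [:: [:: 1; 1; 0]; [:: 2; -1; 1]; [:: 1; 2; 1]];
      [:: [:: 1; -1; 1; 0]; [:: 1; -1; -1; 0]; [:: 1; 1; 2; 1]; [:: 1; 1; 1; 1];
          [:: 1; 0; -1; 0]; [:: 2; 1; 2; 1]];
      [:: [:: 1; 1; -1; 1; 0]; [:: 1; -1; 1; 1; 0]; [:: 1; 1; 2; 2; 1];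
          [:: 1; -1; 0; -1; 0]; [:: 1; 1; 0; 2; 1]; [:: 1; 0; -1; -1; 0];
          [:: 1; 2; 1; 2; 1]; [:: 2; 1; 1; 2; 1]; [:: 2; 1; 2; 1; 2]]].

(** The conjugates are numbered so that the given relation is u_0 = u_1 + u_2 + u_3; the search
    therefore starts at index 1, with this row and the trace row known. *)
Lemma search_refuted :
  refuted 1 search_certs [:: relation_row 0 (1, 2, 3)%N; nseq 8 1].
Proof. by vm_compute. Qed.

Definition relation (us : 'I_8 -> algC) (c : seq int) : Prop :=
  size c = 8%N /\ \sum_(i < 8) (c`_i)%:~R * us i = 0.

Lemma relation_lincomb us co rows :
  {in rows, forall c, relation us c} -> relation us (lincomb co rows).
Proof.
have rel0 : relation us (nseq 8 0).
  by split=> //; apply: big1 => i _; rewrite nth_nseq if_same mul0r.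
elim: co rows => [|a co IHco] [|row rows] // rows_rel.
have [sz_row row0] : relation us row by apply: rows_rel; rewrite mem_head.
have [|sz_c c0] := IHco rows.
  by move=> c rows_c; apply: rows_rel; rewrite inE rows_c orbT.
have sz_eq : size row = size (lincomb co rows) by rewrite sz_row sz_c.
split; first by rewrite size_map size_zip sz_row sz_c.
transitivity (a%:~R * (\sum_(i < 8) (row`_i)%:~R * us i)
              + \sum_(i < 8) ((lincomb co rows)`_i)%:~R * us i).
  rewrite mulr_sumr -big_split; apply: eq_bigr => i _ /=.
  rewrite (nth_map (0, 0)) ?size_zip ?sz_row ?sz_c ?ltn_ord //.
  by rewrite nth_zip //= rmorphD rmorphM mulrDl mulrA.
by rewrite row0 c0 mulr0 addr0.
Qed.

Lemma relation_row_sum (us : 'I_8 -> algC) (i j k l : 'I_8) :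
  us i = us j + us k + us l -> relation us (relation_row i (val j, val k, val l)).
Proof.
move=> Dui; split; first by rewrite size_mkseq.
have sum_eq (m : 'I_8) : \sum_(n < 8) ((n == m :> nat)%:Z)%:~R * us n = us m.
  rewrite (bigD1 m) //= eqxx mul1r big1 ?addr0 // => n ne_nm.
  by rewrite val_eqE (negbTE ne_nm) mul0r.
transitivity (us i - us j - us k - us l); last by rewrite Dui; ring.
rewrite -(sum_eq i) -(sum_eq j) -(sum_eq k) -(sum_eq l) -!sumrB.
apply: eq_bigr => m _; rewrite nth_mkseq ?ltn_ord //.
by rewrite !rmorphB /= !mulrBl.
Qed.

Section Search.
Variables (alpha : algC) (us : 'I_8 -> algC).
Hypothesis us_root : forall i, root (minCpoly alpha) (us i).
Hypothesis us_inj : injective us.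
Hypothesis no_antipode : forall i j, us i != - us j.

(** By [dominated_relation] every index with a nonzero coefficient carries u_i or - u_i, which
    injectivity and the absence of opposite pairs exclude. Only c_i u_i = 0 remains, and u_i = 0
    would be its own opposite. *)
Lemma dominated_not_relation c : dominated c -> ~ relation us c.
Proof.
case/andP=> c_gt0 /hasP[_ /(nthP 0)[i0 lt_i0 <-] c_dom] [sz_c c0].
rewrite sz_c in lt_i0; pose i := Ordinal lt_i0.
have {}c_dom : (sumn [seq absz x | x <- c] <= 2 * absz (c`_i)%R)%N by [].
have sum_c : sumn [seq absz x | x <- c] = (\sum_(j < 8) absz (c`_j)%R)%N.
  by rewrite sumnE big_map (big_nth 0) sz_c big_mkord.
have c_dom' : \sum_(j | j != i) `|c`_j| <= `|c`_i|.
  move: c_dom; rewrite sum_c (bigD1 i) //= => c_dom.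
  rewrite -abszE -(big_morph Posz PoszD (erefl _)) lez_nat.
  by move: c_dom; rewrite mul2n -addnn leq_add2l.
have nz_ci : c`_i != 0 by have := leq_trans c_gt0 c_dom; rewrite muln_gt0 absz_gt0.
have eq_us := dominated_relation us_root c0 c_dom'.
have ci0 j : j != i -> c`_j = 0.
  move=> ne_ji; apply/eqP/idPn => nz_cj; have := eq_us j ne_ji.
  have nz_cc : (c`_i * c`_j)%:~R != 0 :> algC by rewrite intr_eq0 mulf_neq0.
  (* Each |c| is a sign times c, so the common factor c_i c_j cancels and only signs are left. *)
  rewrite !normrEsign !rmorphM !rmorph_sign /= => eq_ij.
  have {}eq_ij : (-1) ^+ (c`_i < 0)%R * us j = - ((-1) ^+ (c`_j < 0)%R * us i).
    apply: (mulfI nz_cc); apply/eqP; rewrite -subr_eq0.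
    by move/eqP: eq_ij; rewrite -subr_eq0 => /eqP<-; apply/eqP; rewrite /= rmorphM /=; ring.
  have: us j = us i \/ us j = - us i.
    move: eq_ij; case: (_ < 0); case: (_ < 0); rewrite ?mulN1r ?mul1r.
    - by move/oppr_inj; right.
    - by move/oppr_inj; left.
    - by rewrite opprK; left.
    - by right.
  by case=> [/us_inj/eqP | /eqP]; rewrite ?(negbTE ne_ji) ?(negbTE (no_antipode _ _)).
have/eqP := c0; rewrite (bigD1 i) //= big1 => [|j /ci0->]; last by rewrite mul0r.
rewrite addr0 mulf_eq0 intr_eq0 (negbTE nz_ci) => /eqP us_i0.
by have := no_antipode i i; rewrite us_i0 oppr0 eqxx.
Qed.

Lemma refuted_sound n certs rows :
    refuted n certs rows -> {in rows, forall c, relation us c} ->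
    (forall i, (i < 8)%N -> exists2 t, t \in triples i & relation us (relation_row i t)) ->
    (n + size certs <= 8)%N ->
  False.
Proof.
move=> + + triples_rel; elim: certs n rows => // cos certs IHcerts n rows.
move=> /= /allP ref_n rows_rel le_n8.
have [|t /ref_n {ref_n} + t_rel] := triples_rel n; first by lia.
have rows'_rel : {in relation_row n t :: rows, forall c, relation us c}.
  by move=> c /predU1P[->|/rows_rel].
case: ifP => [/hasP[co _ /dominated_not_relation] | _ /IHcerts]; last first.
  by apply=> //; rewrite addSnnS.
by case; apply: relation_lincomb.
Qed.

End Search.

Lemma minCpoly_roots (alpha : algC) :
  {r | uniq r & minCpoly alpha = \prod_(x <- r) ('X - x%:P)}.
Proof.
have [r Dr] := closed_field_poly_normal (minCpoly alpha).
rewrite (monicP (minCpoly_monic _)) scale1r in Dr; exists r => //.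
have N := normal_closure_exists alpha.
rewrite -separable_prod_XsubC -Dr -{1}(nc_genE N) -map_emb_minPoly separable_map.
apply: (@pcharf0_separable _ _ 1%AS) => p.
by rewrite pchar_lalg pchar_num.
Qed.

Lemma root_degree8_neq0 alpha x :
  degree8 alpha -> root (minCpoly alpha) x -> x != 0.
Proof.
move=> deg8 rt_x; apply/eqP => x0; move: deg8; rewrite /degree8.
have /conjugate_aut[nu nu_a] := rt_x.
rewrite -(minCpoly_aut nu) nu_a x0.
have [p [Dp mon_p] p_min] := minCpolyP 0.
have: p %| 'X by rewrite -p_min map_polyX rootX.
by move/(dvdp_leq (negbT (polyX_eq0 _))); rewrite Dp size_map_poly size_polyX => + E; rewrite E.
Qed.

(** The sum over the Galois group takes one value t on all conjugates, so the relation gives t = 3 t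
    and t = 0. The sum of the roots is a rational c, whose Galois sum is both 0 and |G| c. *)
Lemma sum_conjugates_eq0 alpha r a1 a2 a3 a4 :
    minCpoly alpha = \prod_(x <- r) ('X - x%:P) ->
    {subset [:: a1; a2; a3; a4] <= r} -> a1 = a2 + a3 + a4 ->
  \sum_(x <- r) x = 0.
Proof.
move=> Dr r_a Da.
have N := normal_closure_exists alpha; pose tr (x : N) := \sum_(g : gal_of {:N}) g x.
have trD x y : tr (x + y) = tr x + tr y.
  by rewrite -big_split; apply: eq_bigr => g _; rewrite rmorphD.
have tr_conj (h : gal_of {:N}) x : tr (h x) = tr x.
  rewrite [RHS](reindex_inj (mulgI h)); apply: eq_bigr => g _.
  by rewrite galM ?memvf.
have r_gal x : x \in r -> exists h : gal_of {:N}, x = nc_emb N (h (nc_gen N)).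
  rewrite -root_prod_XsubC -Dr => rt_x.
  by apply/root_minCpoly_galP; rewrite nc_genE.
have tr0 : tr (nc_gen N) = 0.
  have [h1 Da1] : exists h : gal_of {:N}, a1 = nc_emb N (h (nc_gen N)).
    by apply/r_gal/r_a; rewrite !inE eqxx.
  have [h2 Da2] : exists h : gal_of {:N}, a2 = nc_emb N (h (nc_gen N)).
    by apply/r_gal/r_a; rewrite !inE eqxx ?orbT.
  have [h3 Da3] : exists h : gal_of {:N}, a3 = nc_emb N (h (nc_gen N)).
    by apply/r_gal/r_a; rewrite !inE eqxx ?orbT.
  have [h4 Da4] : exists h : gal_of {:N}, a4 = nc_emb N (h (nc_gen N)).
    by apply/r_gal/r_a; rewrite !inE eqxx ?orbT.
  move: Da; rewrite Da1 Da2 Da3 Da4 -!rmorphD => /fmorph_inj/(congr1 tr).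
  rewrite !trD !tr_conj => /eqP; rewrite -subr_eq0.
  rewrite (_ : _ - _ = - (2%:R : rat) *: tr (nc_gen N)).
    by rewrite scaler_eq0 oppr_eq0 => /eqP.
  by rewrite scaleNr scaler_nat; ring.
have [s Ds] : exists s : seq N, r = map (nc_emb N) s.
  have {}r_gal x : x \in r -> exists y, x = nc_emb N y by case/r_gal=> h ->; exists (h (nc_gen N)).
  elim: (r) r_gal => [|x t IHt] tP; first by exists [::].
  have [|s ->] := IHt; first by move=> y t_y; apply: tP; rewrite inE t_y orbT.
  by have [y ->] := tP x (mem_head _ _); exists (y :: s).
have Ds_min : minPoly 1 (nc_gen N) = \prod_(y <- s) ('X - y%:P).
  apply: (map_poly_inj (nc_emb N)).
  rewrite map_emb_minPoly nc_genE Dr Ds big_map rmorph_prod /=.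
  by apply: eq_bigr => y _; rewrite /= map_polyXsubC.
have [c Dc] : exists c : rat, \sum_(y <- s) y = c%:A.
  have [s0|nz_s] := eqVneq (size s) 0%N.
    by exists 0; rewrite (size0nil s0) big_nil scale0r.
  have := polyOverP (minPolyOver 1%AS (nc_gen N)) (size s).-1.
  rewrite Ds_min coefPn_prod_XsubC // => /vlineP[c Dc].
  by exists (- c); rewrite scaleNr -Dc opprK.
have tr_s : tr (\sum_(y <- s) y) = 0.
  transitivity (\sum_(y <- s) tr y).
    by rewrite /tr exchange_big; apply: eq_bigr => g _; rewrite rmorph_sum.
  apply: big1_seq => y /andP[_ s_y].
  have /r_gal[h /fmorph_inj->] : nc_emb N y \in r by rewrite Ds map_f.
  by rewrite tr_conj tr0.
rewrite Ds big_map -rmorph_sum /= Dc; move: tr_s; rewrite Dc /tr.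
rewrite (eq_bigr (fun=> c%:A)) => [|g _]; last exact: gal_rat.
rewrite sumr_const -scaler_nat scalerA => /eqP.
rewrite scaler_eq0 oner_eq0 orbF mulf_eq0 pnatr_eq0 => /orP[/eqP G0|/eqP->].
  by move/card0_eq/(_ 1%g): G0.
by rewrite scale0r rmorph0.
Qed.

Lemma sorted_triple (us : 'I_8 -> algC) (i j k l : 'I_8) :
    uniq [:: i; j; k; l] -> us i = us j + us k + us l ->
  exists2 t, t \in triples i & relation us (relation_row i t).
Proof.
have sorted_case (j' k' l' : 'I_8) : (j' < k')%N -> (k' < l')%N -> uniq [:: i; j'; k'; l'] ->
    us i = us j' + us k' + us l' ->
  exists2 t, t \in triples i & relation us (relation_row i t).
  move=> lt_jk lt_kl /= /andP[i_jkl _] Dui.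
  exists (val j', val k', val l'); last exact: relation_row_sum.
  rewrite mem_filter lt_jk lt_kl; apply/andP; split=> //.
  by apply: allpairs_f; [apply: allpairs_f|]; rewrite mem_iota ltn_ord.
rewrite /= !inE !negb_or => /and4P[/and3P[n_ij n_ik n_il] /andP[n_jk n_jl] n_kl _] Dui.
have pick (j' k' l' : 'I_8) : (j' < k')%N -> (k' < l')%N -> uniq [:: i; j'; k'; l'] ->
    us j' + us k' + us l' = us j + us k + us l ->
  exists2 t, t \in triples i & relation us (relation_row i t).
  by move=> lt1 lt2 u_t eq_t; apply: (sorted_case j' k' l') => //; rewrite eq_t.
have U (x y z : 'I_8) : (x != i) -> y != i -> z != i -> x != y -> y != z -> x != z ->
    uniq [:: i; x; y; z].
  move=> xi yi zi xy yz xz; rewrite /= !inE !negb_or.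
  by rewrite ![i == _]eq_sym xi yi zi xy xz yz.
have lt_total (x y : 'I_8) : x != y -> (x < y)%N || (y < x)%N by rewrite -neq_ltn.
have [ji ki li] : [/\ j != i, k != i & l != i] by rewrite ![_ == i]eq_sym.
have [kj lj lk] : [/\ k != j, l != j & l != k] by rewrite eq_sym n_jk eq_sym n_jl eq_sym.
case/orP: (lt_total _ _ n_jk) => lt_jk; case/orP: (lt_total _ _ n_kl) => lt_kl;
  case/orP: (lt_total _ _ n_jl) => lt_jl.
- by apply: (pick j k l) => //; apply: U.
- lia.
- by apply: (pick j l k) => //; [apply: U | ring].
- by apply: (pick l j k) => //; [apply: U | ring].
- by apply: (pick k j l) => //; [apply: U | ring].
- by apply: (pick k l j) => //; [apply: U | ring].
- lia.
- by apply: (pick l k j) => //; [apply: U | ring].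
Qed.

Lemma conjugate_opp alpha : degree8 alpha -> conjugate_relation alpha ->
  forall x, root (minCpoly alpha) x -> root (minCpoly alpha) (- x).
Proof.
move=> deg8 [a1 [a2 [a3 [a4 [uniq_a rt_a Da]]]]].
have [r uniq_r Dr] := minCpoly_roots alpha.
have rt_r x : root (minCpoly alpha) x = (x \in r) by rewrite Dr root_prod_XsubC.
(* The conjugates of the relation come first, which gives it the form assumed by
   [search_refuted]. *)
pose s := [:: a1; a2; a3; a4] ++ [seq x <- r | x \notin [:: a1; a2; a3; a4]].
have r_a : {subset [:: a1; a2; a3; a4] <= r}.
  by move=> x /(allP rt_a); rewrite -rt_r.
have mem_s : s =i r.
  move=> x; rewrite mem_cat mem_filter.
  by case: (boolP (x \in [:: _; _; _; _])) => //= /r_a.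
have uniq_s : uniq s.
  rewrite cat_uniq uniq_a filter_uniq // andbT; apply/hasPn => x.
  by rewrite mem_filter => /andP[].
have sz_s : size s = 8%N.
  have := deg8; rewrite /degree8 Dr size_prod_XsubC => [[<-]].
  by apply/perm_size/uniq_perm.
pose us (i : 'I_8) := s`_i.
have us_root i : root (minCpoly alpha) (us i).
  by rewrite rt_r -mem_s mem_nth // sz_s.
have us_inj : injective us.
  by move=> i j /eqP; rewrite nth_uniq ?sz_s // => /eqP/val_inj.
have us_surj x : root (minCpoly alpha) x -> exists i, x = us i.
  rewrite rt_r -mem_s => s_x; have lt_x : (index x s < 8)%N by rewrite -sz_s index_mem.
  by exists (Ordinal lt_x); rewrite /us /= nth_index.
(* One opposite pair suffices: an automorphism carrying [us i] to a given conjugate x carries [us j]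
   to - x. *)
suff [i [j us_ij]] : exists i j, us i = - us j.
  move=> x rt_x.
  have m_us : minCpoly (us i) = minCpoly alpha.
    by have /conjugate_aut[nu <-] := us_root i; rewrite minCpoly_aut.
  have [nu nu_i] : exists nu : {rmorphism algC -> algC}, nu (us i) = x.
    by apply: conjugate_aut; rewrite m_us.
  have <- : nu (us j) = - x by rewrite -nu_i us_ij rmorphN opprK.
  have -> : minCpoly alpha = minCpoly (nu (us j)); last exact: root_minCpoly.
  have /conjugate_aut[mu mu_j] := us_root j.
  by rewrite minCpoly_aut -mu_j minCpoly_aut.
have [/existsP[i /existsP[j /eqP]]|no_antip] := boolP [exists i, exists j, us i == - us j].
  by exists i, j.
have {}no_antip i j : us i != - us j.
  by apply: contra no_antip => us_ij; apply/existsP; exists i; apply/existsP; exists j.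
case: (refuted_sound us_root us_inj no_antip search_refuted) => [c||].
- rewrite !inE => /orP[/eqP->|/eqP->].
    exact: (@relation_row_sum us ord0 (@Ordinal 8 1 isT) (@Ordinal 8 2 isT)
              (@Ordinal 8 3 isT) Da).
  split=> //; transitivity (\sum_(x <- r) x); last exact: sum_conjugates_eq0 Dr r_a Da.
  rewrite (perm_big s); last by rewrite perm_sym; apply: uniq_perm.
  rewrite [RHS](big_nth 0) sz_s big_mkord; apply: eq_bigr => i _.
  by rewrite nth_nseq ltn_ord mul1r.
- move=> i lt_i8; pose i' := Ordinal lt_i8.
  have [nu nu_i] : exists nu : {rmorphism algC -> algC}, nu a1 = us i'.
    apply: conjugate_aut; have /andP[/conjugate_aut[mu <-] _] := rt_a.
    by rewrite minCpoly_aut.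
  have nu_a x : x \in [:: a1; a2; a3; a4] -> exists k, nu x = us k.
    move/(allP rt_a)/conjugate_aut => [mu Dx]; apply: us_surj.
    by rewrite -Dx -(minCpoly_aut mu) -(minCpoly_aut nu) root_minCpoly.
  have [|j Dj] := nu_a a2; first by rewrite !inE eqxx ?orbT.
  have [|k Dk] := nu_a a3; first by rewrite !inE eqxx ?orbT.
  have [|l Dl] := nu_a a4; first by rewrite !inE eqxx ?orbT.
  apply: (@sorted_triple us i' j k l); last by rewrite -nu_i -Dj -Dk -Dl Da !rmorphD.
  rewrite -(map_inj_uniq us_inj) /= -nu_i -Dj -Dk -Dl.
  by move: uniq_a; rewrite -(map_inj_uniq (fmorph_inj nu)).
by [].
Qed.

(** * Even octics and their roots *)

Notation o0 := (@Ordinal 4 0 isT).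
Notation o1 := (@Ordinal 4 1 isT).
Notation o2 := (@Ordinal 4 2 isT).
Notation o3 := (@Ordinal 4 3 isT).

Lemma ord4_ind (P : 'I_4 -> Prop) : P o0 -> P o1 -> P o2 -> P o3 -> forall i, P i.
Proof.
move=> P0 P1 P2 P3 [[|[|[|[|i]]]] lt_i] //; [move: P0|move: P1|move: P2|move: P3];
  by rewrite (bool_irrelevance lt_i isT).
Qed.

Lemma big_ord4 (R : Type) (idx : R) (op : Monoid.law idx) (F : 'I_4 -> R) :
  \big[op/idx]_(i < 4) F i = op (op (op (F o0) (F o1)) (F o2)) (F o3).
Proof.
rewrite !big_ord_recl big_ord0 Monoid.mulm1 !Monoid.mulmA.
by congr (op (op (op (F _) (F _)) (F _)) (F _)); apply: val_inj.
Qed.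

Definition sigma2 (R : pzRingType) (w : 'I_4 -> R) :=
  w o0 * w o1 + w o0 * w o2 + w o0 * w o3 + w o1 * w o2 + w o1 * w o3 + w o2 * w o3.
Definition sigma3 (R : pzRingType) (w : 'I_4 -> R) :=
  w o0 * w o1 * w o2 + w o0 * w o1 * w o3 + w o0 * w o2 * w o3 + w o1 * w o2 * w o3.
Definition sigma4 (R : pzRingType) (w : 'I_4 -> R) := w o0 * w o1 * w o2 * w o3.

Section Polynomials.
Variable R : comNzRingType.
Implicit Type w : 'I_4 -> R.

Definition even_octic (p r d : R) : {poly R} :=
  ('X^4 + p *: 'X^2 + r%:P) ^+ 2 - d *: 'X^2.

Lemma last_root w : \sum_i w i = 0 -> w o3 = - (w o0 + w o1 + w o2).
Proof. by rewrite big_ord4 /= => /eqP; rewrite addrC addr_eq0 => /eqP. Qed.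

Lemma prod_square w : \sum_i w i = 0 ->
  \prod_i ('X^2 - (w i ^+ 2)%:P) = even_octic (sigma2 w) (sigma4 w) (sigma3 w ^+ 2).
Proof.
move/last_root => Dw3; rewrite big_ord4 /= /even_octic /sigma2 /sigma3 /sigma4 Dw3.
rewrite -!mul_polyC !(expr2, polyCM, polyCN, polyCD); ring.
Qed.

Definition signed_roots w := [seq w i | i <- enum 'I_4] ++ [seq - w i | i <- enum 'I_4].

Lemma mem_signed_roots w x :
  reflect (exists i, x = w i \/ x = - w i) (x \in signed_roots w).
Proof.
rewrite mem_cat; apply: (iffP orP) => [[] /mapP[i _ ->] | [i [->|->]]].
- by exists i; left.
- by exists i; right.
- by left; apply: map_f; rewrite mem_enum.
- by right; apply: (map_f (fun i => - w i)); rewrite mem_enum.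
Qed.

Lemma uniq_signed_roots w :
  reflect (injective w /\ forall i j, w i != - w j) (uniq (signed_roots w)).
Proof.
rewrite cat_uniq (map_comp -%R w) (map_inj_uniq oppr_inj) -map_comp /=.
apply: (iffP and3P) => [[/injectiveP w_inj /hasPn w_w _] | [w_inj w_opp]].
  split=> // i j; apply/eqP => E.
  have /w_w := map_f (-%R \o w) (mem_enum 'I_4 j).
  by rewrite /= -E map_f ?mem_enum.
split; try exact/injectiveP.
apply/hasPn => _ /mapP[j _ ->]; apply/mapP => -[i _ E].
by case/eqP: (w_opp i j); rewrite -E.
Qed.

Lemma prod_signed_roots w :
  \prod_i ('X^2 - (w i ^+ 2)%:P) = \prod_(x <- signed_roots w) ('X - x%:P).
Proof.
rewrite big_cat !big_map -!big_enum /= -big_split; apply: eq_bigr => i _ /=.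
by rewrite rmorphN rmorphXn /=; ring.
Qed.

(** Matching with the octic form gives a = 2 p and b = p^2 + 2 r, so r = (4 b - a^2) / 8; this is
    the origin of the constant term (a^2 - 4 b)^2 / 64. *)
Lemma coef_even_octic p r d : even_octic p r d =
  'X^8 + (2 * p) *: 'X^6 + (p ^+ 2 + 2 * r) *: 'X^4 + (2 * p * r - d) *: 'X^2
  + (r ^+ 2)%:P.
Proof.
rewrite /even_octic -!mul_polyC !(expr2, polyCM, polyCN, polyCD) ?polyC1; ring.
Qed.

End Polynomials.

Lemma prod_XsubC4 (R : comNzRingType) (w : 'I_4 -> R) : \prod_i ('X - (w i)%:P) =
  'X^4 - (\sum_i w i) *: 'X^3 + sigma2 w *: 'X^2 - sigma3 w *: 'X + (sigma4 w)%:P.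
Proof.
rewrite !big_ord4 /= /sigma2 /sigma3 /sigma4.
by rewrite -!mul_polyC !(expr2, polyCM, polyCN, polyCD); ring.
Qed.

Lemma quartic_roots (p q r : algC) :
  exists w : 'I_4 -> algC, [/\ \sum_i w i = 0, sigma2 w = p, sigma3 w = - q & sigma4 w = r].
Proof.
pose h : {poly algC} := 'X^4 + p *: 'X^2 + q *: 'X + r%:P.
have coefh k : h`_k = (k == 4)%N%:R + p * (k == 2)%N%:R + q * (k == 1)%N%:R + r * (k == 0)%N%:R.
  by rewrite /h !coefE; case: k => [|k]; rewrite ?mulr1 ?mulr0.
have sz_h : size h = 5%N.
  apply/eqP; rewrite eqn_leq; apply/andP; split.
    apply/leq_sizeP => [[|[|[|[|[|k]]]]]] // _.
    by rewrite coefh !mulr0 !addr0.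
  rewrite ltnNge; apply/negP => /leq_sizeP/(_ 4 (leqnn 4))/eqP.
  by rewrite coefh !mulr0 !addr0 oner_eq0.
have [s Ds] := closed_field_poly_normal h.
have lead_h : lead_coef h = 1 by rewrite lead_coefE sz_h coefh !mulr0 !addr0.
rewrite lead_h scale1r in Ds.
have sz_s : size s = 4%N by move: sz_h; rewrite Ds size_prod_XsubC => [[]].
pose w (i : 'I_4) := s`_i; exists w.
have Dh : h = \prod_i ('X - (w i)%:P).
  by rewrite Ds (big_nth 0) sz_s big_mkord.
rewrite prod_XsubC4 in Dh.
have E k := congr1 (fun f : {poly algC} => f`_k) Dh.
have := (E 0%N, E 1%N, E 2%N, E 3%N); rewrite /= !coefh !coefE /=.
rewrite !(mulr0, mulr1, addr0, add0r, subr0, sub0r).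
case=> [[[E0 E1] E2] /esym/eqP]; rewrite oppr_eq0 => /eqP E3.
by rewrite E0 E1 E2 E3 !(oppr0, add0r, opprK).
Qed.

Section RelationOctic.
Variable alpha : algC.
Hypothesis deg8 : degree8 alpha.

Lemma signed_roots_uniq (w : 'I_4 -> algC) :
  minCpoly alpha = \prod_i ('X^2 - (w i ^+ 2)%:P) -> uniq (signed_roots w).
Proof.
have [r uniq_r Dr] := minCpoly_roots alpha.
by rewrite prod_signed_roots -separable_prod_XsubC => <-; rewrite Dr separable_prod_XsubC.
Qed.

Lemma signed_roots_root (w : 'I_4 -> algC) x :
  minCpoly alpha = \prod_i ('X^2 - (w i ^+ 2)%:P) ->
  root (minCpoly alpha) x = (x \in signed_roots w).
Proof. by move->; rewrite prod_signed_roots root_prod_XsubC. Qed.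

Lemma roots_relation (w : 'I_4 -> algC) :
    minCpoly alpha = \prod_i ('X^2 - (w i ^+ 2)%:P) -> \sum_i w i = 0 ->
  conjugate_relation alpha.
Proof.
move=> Dm sum_w; exists (w o0), (- w o1), (- w o2), (- w o3).
have rt_w i : root (minCpoly alpha) (w i) /\ root (minCpoly alpha) (- w i).
  by rewrite !(signed_roots_root _ Dm); split; apply/mem_signed_roots; exists i; [left|right].
split; last first.
- by move: sum_w; rewrite big_ord4 /= -!addrA => /eqP; rewrite addr_eq0 !opprD => /eqP.
- by rewrite /= /Defs.conjugate (rt_w o0).1 (rt_w o1).2 (rt_w o2).2 (rt_w o3).2.
have /uniq_signed_roots[w_inj n_wNw] := signed_roots_uniq Dm.
by rewrite /= !inE !negb_or !n_wNw !eqr_opp !(inj_eq w_inj).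
Qed.

(** The relation 2 x - y - z = 0 is dominated at x, since 2 = 1 + 1. *)
Lemma conjugates_no_midpoint x y z :
    root (minCpoly alpha) x -> root (minCpoly alpha) y -> root (minCpoly alpha) z ->
  2 * x = y + z -> y = x.
Proof.
move=> rt_x rt_y rt_z Dx.
pose us (i : 'I_3) := [:: x; y; z]`_i; pose c (i : 'I_3) : int := [:: 2; -1; -1]`_i.
have us_rt i : root (minCpoly alpha) (us i) by case: i => [[|[|[|]]]].
have us0 : \sum_j (c j)%:~R * us j = 0.
  by rewrite !big_ord_recl big_ord0 /= /c /us /= rmorphN /= Dx; ring.
have c_dom : \sum_(j | j != ord0) `|c j| <= `|c ord0|.
  by rewrite big_mkcond !big_ord_recl big_ord0.
have /(_ (lift ord0 ord0) isT) := dominated_relation us_rt us0 c_dom.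
rewrite /c /us /= normrN1 normr_nat => /eqP; rewrite -addr_eq0 => /eqP E.
have : 2 * (x - y) = 0 by rewrite -E; ring.
by move/eqP; rewrite mulf_eq0 pnatr_eq0 /= subr_eq0 => /eqP.
Qed.

(** The eight signed values are conjugates by [conjugate_opp], and there are eight conjugates;
    everything rests on these values being distinct. *)
Lemma relation_roots : conjugate_relation alpha ->
  exists w : 'I_4 -> algC,
    minCpoly alpha = \prod_i ('X^2 - (w i ^+ 2)%:P) /\ \sum_i w i = 0.
Proof.
move=> rel; have opp_rt := conjugate_opp deg8 rel.
have [a1 [a2 [a3 [a4 [uniq_a rt_a Da]]]]] := rel.
pose w (i : 'I_4) := [:: a1; - a2; - a3; - a4]`_i.
have sum_w : \sum_i w i = 0 by rewrite big_ord4 /w /= Da; ring.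
exists w; split=> //; rewrite prod_signed_roots.
have [r uniq_r Dr] := minCpoly_roots alpha.
have rt_r x : root (minCpoly alpha) x = (x \in r) by rewrite Dr root_prod_XsubC.
have sz_r : size r = 8%N by have := deg8; rewrite /degree8 Dr size_prod_XsubC => [[]].
rewrite Dr; apply/perm_big; rewrite perm_sym.
have rt_w i : root (minCpoly alpha) (w i).
  have /and5P[r1 r2 r3 r4 _] := rt_a.
  by elim/ord4_ind: i; rewrite /w //=; apply: opp_rt.
have sub_w : {subset signed_roots w <= r}.
  move=> x; rewrite mem_cat -rt_r => /orP[] /mapP[i _ ->] //; exact: opp_rt.
have uniq_w : uniq (signed_roots w).
  pose a (i : 'I_4) := [:: a1; a2; a3; a4]`_i.
  have [a_rt u_a] : (forall i, root (minCpoly alpha) (a i)) /\ injective a.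
    split=> [i|i j /eqP]; first by apply: (allP rt_a); rewrite mem_nth.
    by rewrite nth_uniq // => /eqP/val_inj.
  have wE i : w i = if i == o0 then a i else - a i by elim/ord4_ind: i.
  have Da' : a o0 = a o1 + a o2 + a o3 by [].
  clearbody a.
  have neq_a i j : i != j -> a i != a j by rewrite (inj_eq u_a).
  (* If a_0 = - a_j, the relation becomes 2 a_0 = a_k + a_l. *)
  have no_opp0 j k l : o0 != k -> a o0 = a j + a k + a l -> a o0 != - a j.
    move=> n0k E; apply/eqP => E'; case/eqP: (neq_a _ _ n0k).
    apply/esym/(conjugates_no_midpoint (a_rt _) (a_rt _) (a_rt l)).
    by transitivity (a o0 + a o0); [ring | rewrite {1}E E'; ring].
  (* If a_i = - a_j, the relation collapses to a_0 = a_k. *)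
  have no_opp3 i j k : o0 != k -> a o0 = a i + a j + a k -> a i != - a j.
    move=> n0k E; apply/eqP => E'; case/eqP: (neq_a _ _ n0k).
    by rewrite E E'; ring.
  have no_oppC i j : a i != - a j -> a j != - a i by rewrite eq_sym eqr_oppLR.
  have no_opp_self i : a i != - a i.
    by rewrite -addr_eq0 -mulr2n mulrn_eq0 (negbTE (root_degree8_neq0 deg8 (a_rt i))).
  have no_opp i j : a i != - a j.
    have n01 : a o0 != - a o1 by apply: (@no_opp0 o1 o2 o3).
    have n02 : a o0 != - a o2 by apply: (@no_opp0 o2 o1 o3); rewrite // Da'; ring.
    have n03 : a o0 != - a o3 by apply: (@no_opp0 o3 o1 o2); rewrite // Da'; ring.
    have n12 : a o1 != - a o2 by apply: (@no_opp3 _ _ o3).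
    have n13 : a o1 != - a o3 by apply: (@no_opp3 _ _ o2); rewrite // Da'; ring.
    have n23 : a o2 != - a o3 by apply: (@no_opp3 _ _ o1); rewrite // Da'; ring.
    by elim/ord4_ind: i; elim/ord4_ind: j => //; apply: no_oppC.
  apply/uniq_signed_roots; split=> i j.
    rewrite !wE; case: ifP => Ei; case: ifP => Ej.
    - by move/u_a.
    - by move/eqP; rewrite (negbTE (no_opp _ _)).
    - by move/esym/eqP; rewrite (negbTE (no_opp _ _)).
    - by move/oppr_inj/u_a.
  rewrite !wE; case: ifP => Ei; case: ifP => Ej //; rewrite ?opprK.
  - by apply: neq_a; apply: contraFneq Ej => <-.
  - by rewrite eqr_opp; apply: neq_a; apply: contraFneq Ei => ->.
  - by rewrite eqr_oppLR.
have [|_ mem_w] := uniq_min_size uniq_w sub_w.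
  by rewrite sz_r size_cat !size_map -enumT size_enum_ord.
exact: uniq_perm.
Qed.

End RelationOctic.

Lemma minCpoly_irreducible (alpha : algC) (m : {poly rat}) :
  minCpoly alpha = pQtoC m -> irreducible_poly m.
Proof.
move=> Dm; have [q [Dq mon_q] q_min] := minCpolyP alpha.
have eq_qm : q = m by apply: (map_poly_inj (ratr : rat -> algC)); rewrite -Dq.
rewrite {q}eq_qm in Dq mon_q q_min; have nz_m := monic_neq0 mon_q.
split=> [|d nt_d /dvdpP[e De]].
  by rewrite -(size_map_poly (ratr : rat -> algC)) -Dq size_minCpoly.
have rt_m : root (pQtoC m) alpha by rewrite -Dq root_minCpoly.
have /norP[nz_e nz_d] : ~~ ((e == 0) || (d == 0)) by rewrite -mulf_eq0 -De.
move: rt_m; rewrite De rmorphM rootM /= !q_min => /orP[m_e | m_d]; last first.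
  by rewrite -De /eqp m_d De dvdp_mull.
case/negP: nt_d; have := dvdp_leq nz_e m_e; rewrite De size_mul //.
move: nz_d nz_e; rewrite -!size_poly_gt0 => d_gt0 e_gt0 le_de.
by rewrite -subn1 leq_subLR addnC leq_add2r in le_de; rewrite eqn_leq le_de.
Qed.

Lemma pQtoC_even (a b c d : rat) :
  pQtoC ('X^8 + a *: 'X^6 + b *: 'X^4 + c *: 'X^2 + d%:P) =
  'X^8 + ratr a *: 'X^6 + ratr b *: 'X^4 + ratr c *: 'X^2 + (ratr d)%:P.
Proof. by rewrite !rmorphD /= !map_polyZ !map_polyXn map_polyC. Qed.

Lemma pQtoC_octic (a b c : rat) : pQtoC (octic a b c) =
  'X^8 + ratr a *: 'X^6 + ratr b *: 'X^4 + ratr c *: 'X^2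
  + (1 / 64 * (ratr a ^+ 2 - 4 * ratr b) ^+ 2)%:P.
Proof.
have r64 : ratr (1 / 64) = 1 / 64 :> algC.
  by rewrite !mul1r fmorphV; congr (_^-1); apply: ratr_nat.
have dE k l : ratr (k * (a ^+ 2 - l * b) ^+ 2) =
    ratr k * (ratr a ^+ 2 - ratr l * ratr b) ^+ 2 :> algC.
  by rewrite rmorphM rmorphXn rmorphB rmorphXn rmorphM.
rewrite -r64 -[4 in RHS](ratr_nat _ 4) -dE.
by rewrite /octic pQtoC_even.
Qed.

Lemma octic_roots (a b c : algC) : exists w : 'I_4 -> algC,
  'X^8 + a *: 'X^6 + b *: 'X^4 + c *: 'X^2 + (1 / 64 * (a ^+ 2 - 4 * b) ^+ 2)%:P
    = \prod_i ('X^2 - (w i ^+ 2)%:P) /\ \sum_i w i = 0.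
Proof.
(* These solve a = 2 p and b = p^2 + 2 r; then d = 2 p r - c, and a complex square root of d serves
   as sigma_3. *)
pose p := a / 2; pose r := (b - p ^+ 2) / 2.
have [w [sum_w Dp Dq Dr]] := quartic_roots p (- sqrtC (2 * p * r - c)) r.
exists w; split=> //; rewrite (prod_square sum_w) coef_even_octic Dp Dq Dr opprK sqrtCK.
by congr (_ + _ *: _ + _ *: _ + _ *: _ + _%:P); rewrite /r /p; field.
Qed.

Lemma relation_octic (alpha : algC) : degree8 alpha ->
  (conjugate_relation alpha <->
   exists a b c : rat, irreducible_poly (octic a b c) /\
                       minCpoly alpha = pQtoC (octic a b c)).
Proof.
move=> deg8; split=> [rel | [a [b [c [_ Dm]]]]]; last first.
  have [w [Dw sum_w]] := octic_roots (ratr a) (ratr b) (ratr c).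
  by apply: (@roots_relation alpha w); rewrite // Dm pQtoC_octic.
have [w [Dm sum_w]] := relation_roots deg8 rel.
have [m [Dm' mon_m] _] := minCpolyP alpha.
have Dcoef k : ratr m`_k = (minCpoly alpha)`_k by rewrite Dm' coef_map.
suff Em : minCpoly alpha = pQtoC (octic m`_6 m`_4 m`_2).
  by exists m`_6, m`_4, m`_2; split=> //; apply: minCpoly_irreducible Em.
rewrite pQtoC_octic !Dcoef Dm (prod_square sum_w) coef_even_octic !coefE /=.
rewrite !(mulr0, mulr1, addr0, add0r).
by congr (_ + _%:P); field.
Qed.

(** * The signed permutation action *)

Notation signed_perm := ('Z_2 * {perm 'I_4})%type.

Lemma signZ2D (R : pzRingType) (a b : 'Z_2) :
  (-1) ^+ (a * b)%g = (-1) ^+ a * (-1) ^+ b :> R.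
Proof.
by rewrite -signr_odd /= odd_mod // -exprD signr_odd.
Qed.

Section SignedAction.
Variables (L : splittingFieldType rat) (w : 'I_4 -> L).
Hypothesis sum_w : \sum_i w i = 0.
Hypothesis w_inj : injective w.
Hypothesis w_opp : forall i j, w i != - w j.
Hypothesis w_stable : forall (g : gal_of {:L}) i, exists j, g (w i) = w j \/ g (w i) = - w j.
Implicit Types (g h : gal_of {:L}) (x : signed_perm).

Lemma w_neq0 i : w i != 0.
Proof. by apply: contraNneq (w_opp i i) => ->; rewrite oppr0. Qed.

(** A zero sum over one index contradicts w_i != 0, over two indices w_i != - w_j; larger sets are
    reduced to their complement, the total being 0. *)
Lemma subsum_w (D : {set 'I_4}) : \sum_(i in D) w i = 0 -> D = set0 \/ D = setT.
Proof.
have small (E : {set 'I_4}) : \sum_(i in E) w i = 0 -> (#|E| <= 2)%N -> E = set0.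
  move=> E0; rewrite leq_eqVlt ltnS leq_eqVlt ltnS leqn0 => /or3P[/cards2P|/cards1P|].
  - case=> i [j [ne_ij DE]]; move: E0; rewrite DE big_setU1 ?inE //= big_set1 => /eqP.
    by rewrite addr_eq0 (negbTE (w_opp _ _)).
  - by case=> i DE; move: E0; rewrite DE big_set1 => /eqP; rewrite (negbTE (w_neq0 _)).
  - by rewrite cards_eq0 => /eqP.
move=> D0; have [le2|gt2] := leqP #|D| 2; first by left; apply: small.
right; apply: setC_inj; rewrite setCT; apply: small.
  by move: sum_w; rewrite (bigID (mem D)) /= D0 add0r; under eq_bigl do rewrite -in_setC.
by have := cardsC D; rewrite card_ord; lia.
Qed.

(** Let D be the set of indices where g takes the sign +. Adding the image under g of the total sum
    to the total sum reindexed by f gives twice the sum of g (w i) over D. So D has zero sum, and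
    [subsum_w] makes the sign constant. *)
Lemma signed_perm_exists g :
  exists x, [forall i, g (w i) == (-1) ^+ x.1 * w (x.2 i)].
Proof.
have [f fP] : exists f : 'I_4 -> 'I_4, forall i, g (w i) = w (f i) \/ g (w i) = - w (f i).
  pose f i := odflt i [pick j | (g (w i) == w j) || (g (w i) == - w j)].
  exists f => i; rewrite /f; case: pickP => [j /orP[] /eqP | no_j]; [by left|by right|].
  by have [j gP] := w_stable g i; have := no_j j; case: gP => ->; rewrite eqxx ?orbT.
have f_inj : injective f.
  move=> i j eq_f; have : g (w i) = g (w j) \/ g (w i) = g (- w j).
    rewrite rmorphN /=; case: (fP i) => ->; case: (fP j) => ->; rewrite eq_f ?opprK; auto.
  by case=> /fmorph_inj => [/w_inj // | /eqP]; rewrite (negbTE (w_opp _ _)).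
pose D := [set i | g (w i) == w (f i)].
have D0 : \sum_(i in D) w i = 0.
  apply: (fmorph_inj g); rewrite rmorph0 rmorph_sum /=.
  have e1 : \sum_(i in D) g (w i) + \sum_(i in ~: D) g (w i) = 0.
    transitivity (g (\sum_i w i)); last by rewrite sum_w rmorph0.
    rewrite rmorph_sum [RHS](bigID (mem D)) /=; congr (_ + _).
    by apply: eq_bigl => i; rewrite in_setC.
  have e2 : \sum_(i in D) g (w i) - \sum_(i in ~: D) g (w i) = 0.
    transitivity (\sum_i w i); last exact: sum_w.
    rewrite [RHS](reindex_inj f_inj) [RHS](bigID (mem D)) /= -sumrN; congr (_ + _).
      by apply: eq_bigr => i; rewrite inE => /eqP.
    apply: eq_big => i; rewrite !inE // => /eqP n_fi.
    by case: (fP i) => // ->; rewrite opprK.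
  have : (2%:R : rat) *: (\sum_(i in D) g (w i)) = 0.
    rewrite scaler_nat mulr2n -{1}(addrK (\sum_(i in ~: D) g (w i)) (\sum_(i in D) _)).
    by rewrite e1 sub0r -[RHS]e2 addrC.
  by move/eqP; rewrite scaler_eq0 => /eqP.
have [DE|DE] := subsum_w D0.
  (* The group ['Z_2] is additive: [1%R] encodes the sign -1, and 0 the sign +1. *)
  exists (1%R, perm f_inj); apply/forallP => i /=; rewrite permE expr1 mulN1r; apply/eqP.
  by case: (fP i) => // E; have := in_set0 i; rewrite -DE inE E eqxx.
exists (0, perm f_inj); apply/forallP => i /=; rewrite permE mul1r.
by have := in_setT i; rewrite -DE inE.
Qed.

Definition signed_action g : signed_perm :=
  odflt 1%g [pick x : signed_perm | [forall i, g (w i) == (-1) ^+ x.1 * w (x.2 i)]].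

Lemma signed_actionP g i :
  g (w i) = (-1) ^+ (signed_action g).1 * w ((signed_action g).2 i).
Proof.
rewrite /signed_action; case: pickP => [x /forallP/(_ i)/eqP // | no_x].
by have [x xP] := signed_perm_exists g; have := no_x x; rewrite xP.
Qed.

Lemma signed_perm_uniq (x y : signed_perm) :
  (forall i, (-1) ^+ x.1 * w (x.2 i) = (-1) ^+ y.1 * w (y.2 i)) -> x = y.
Proof.
case: x y => [a s] [b t] /= E.
have ab : a = b.
  have := E o0; case: a b {E} => [[|[|]] // ?] [[|[|]] // ?];
    rewrite /= ?expr0 ?expr1 ?mul1r ?mulN1r.
  - by move=> _; apply: val_inj.
  - by move/eqP; rewrite (negbTE (w_opp _ _)).
  - by move/esym/eqP; rewrite (negbTE (w_opp _ _)).
  - by move=> _; apply: val_inj.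
rewrite ab in E *; congr (_, _); apply/permP => i; apply: w_inj.
by apply: (@mulfI L ((-1) ^+ b)); rewrite ?expf_neq0 ?oppr_eq0 ?oner_neq0.
Qed.

Lemma signed_actionM : {in 'Gal({:L} / 1)%g &, {morph signed_action : g h / (g * h)%g}}.
Proof.
move=> g h _ _; apply: signed_perm_uniq => i.
rewrite -signed_actionP galM ?memvf // !signed_actionP rmorphM rmorphXn rmorphN1 /=.
rewrite signed_actionP mulrA; congr (_ * _); last by rewrite permM.
exact: esym (signZ2D _ _ _).
Qed.

Canonical signed_action_morphism := Morphism signed_actionM.

Definition signed_image : {group signed_perm} := (signed_action @* 'Gal({:L} / 1))%G.

Lemma signed_imageP x :
  reflect (exists g, forall i, g (w i) = (-1) ^+ x.1 * w (x.2 i)) (x \in signed_image).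
Proof.
apply: (iffP morphimP) => [[g _ _ ->] | [g gP]]; first by exists g => i; apply: signed_actionP.
exists g; rewrite ?gal_total //; apply: signed_perm_uniq => i.
by rewrite -gP signed_actionP.
Qed.

End SignedAction.

(** * Transitive groups of signed permutations *)

Local Close Scope ring_scope.
Local Open Scope group_scope.

Lemma isog_setX (aT1 aT2 bT1 bT2 : finGroupType) (G1 : {group aT1}) (G2 : {group aT2})
    (H1 : {group bT1}) (H2 : {group bT2}) :
  G1 \isog H1 -> G2 \isog H2 -> setX G1 G2 \isog setX H1 H2.
Proof.
move=> iso1 iso2; apply: isog_dprod (setX_dprod G1 G2) (setX_dprod H1 H2) _ _.
  have h1 : setX G1 [1 aT2] \isog G1 by rewrite isog_sym isog_setX1.
  exact: isog_trans (isog_trans h1 iso1) (isog_setX1 _ _).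
have h2 : setX [1 aT1] G2 \isog G2 by rewrite isog_sym isog_set1X.
exact: isog_trans (isog_trans h2 iso2) (isog_set1X _ _).
Qed.

Lemma Sym_all (T : finType) (G : {group {perm T}}) : G \subset 'Sym_T.
Proof. exact: subsetT. Qed.

Lemma card_transitive4 (H : {group {perm 'I_4}}) :
  [transitive H, on setT | 'P] ->
  [\/ #|H| = 4, #|H| = 8, #|H| = 12 | #|H| = 24]%N.
Proof.
move=> trH; have dv4 : (4 %| #|H|)%N.
  by have := atrans_dvd trH; rewrite cardsT card_ord.
have dv24 : (#|H| %| 24)%N.
  by have := cardSg (Sym_all H); rewrite card_Sym card_ord.
have le24 := dvdn_leq (isT : 0 < 24)%N dv24.
case/dvdnP: dv4 dv24 le24 => k ->; do 7?[case: k => [|k]] => //= _ _; by [constructor|].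
Qed.

Lemma card_Alt4 : #|'Alt_('I_4)| = 12%N.
Proof. by apply: double_inj; rewrite -mul2n card_Alt card_ord. Qed.

(** H has index 2, so its intersection with Alt is normal in the primitive group S_4, hence trivial
    or transitive. If trivial, the product of H and Alt would have 144 elements; if transitive, its
    order is a multiple of 4, divides 12 and is at least 144 / 24 = 6, so it is 12. *)
Lemma Alt4_card12 (H : {group {perm 'I_4}}) :
  #|H| = 12%N -> H :=: 'Alt_('I_4).
Proof.
move=> oH; have oAlt := card_Alt4.
have nsH : H <| 'Sym_('I_4).
  apply: index2_normal; first exact: Sym_all.
  by rewrite -divgS ?Sym_all // oH card_Sym card_ord.
have tr2 : [transitive^2 'Sym_('I_4), on setT | 'P].
  have := Sym_trans 'I_4; rewrite card_ord => /ntransitive_weak; exact.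
have prim := ntransitive_primitive (leqnn 2) tr2.
have nsHA : H :&: 'Alt_('I_4) <| 'Sym_('I_4) by apply: normalI; rewrite ?Alt_normal.
have [fixHA|trHA] := prim_trans_norm prim nsHA.
  have HA1 : #|H :&: 'Alt_('I_4)| = 1%N.
    by apply/eqP; rewrite -trivg_card1 -subG1 (subset_trans fixHA (aperm_faithful _)).
  have := mul_cardG H 'Alt_('I_4); rewrite oH oAlt HA1 => E.
  have : (#|(H * 'Alt_('I_4)%G)%g| <= #|('Sym_('I_4))%g|)%N by apply/subset_leq_card/subsetT.
  by rewrite card_Sym card_ord; rewrite muln1 in E; rewrite -E.
have : (4 %| #|H :&: 'Alt_('I_4)|)%N.
  by have := atrans_dvd trHA; rewrite cardsT card_ord.
have := mul_cardG H 'Alt_('I_4); rewrite oH oAlt => E.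
have : (#|(H * 'Alt_('I_4)%G)%g| <= #|('Sym_('I_4))%g|)%N by apply/subset_leq_card/subsetT.
rewrite card_Sym card_ord => le24 dv4.
have {E le24} E : (12 * 12 <= 24 * #|H :&: 'Alt_('I_4)|)%N by rewrite E leq_mul2r le24 orbT.
have dv12 : (#|H :&: 'Alt_('I_4)| %| 12)%N by rewrite -oH cardSg ?subsetIl.
have oHA : #|H :&: 'Alt_('I_4)| = 12%N.
  have le12 := dvdn_leq (isT : 0 < 12)%N dv12.
  have [k Dk] := dvdnP dv4; move: dv12 le12 E; rewrite Dk.
  by case: k {Dk} => [|[|[|[|k]]]] //; lia.
by apply/eqP; rewrite eqEcard oAlt oH leqnn andbT; apply/setIidPl/eqP;
   rewrite eqEcard subsetIl oHA oH.
Qed.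

Definition rho4 : {perm 'I_4} := perm (@rev_ord_inj 4).
Definition tau4 : {perm 'I_4} := tperm o0 o2.
(** Generated by the involutions (0 3)(1 2) and (0 2), these are the symmetries of the square with
    diagonals {0, 2} and {1, 3}. *)
Definition dih4 : {group {perm 'I_4}} := <<[set rho4; tau4]>>%G.

Lemma dih4_isog : dih4 \isog 'D_8.
Proof.
have rhoE i : rho4 i = rev_ord i by rewrite permE.
have tauE i : tau4 i = if i == o0 then o2 else if i == o2 then o0 else i.
  by rewrite permE.
have rho2 : rho4 ^+ 2 = 1.
  by apply/permP => i; rewrite permM !rhoE rev_ordK perm1.
have tau2 : tau4 ^+ 2 = 1 by rewrite expgS expg1 tperm2.
have rt4 : (rho4 * tau4) ^+ 4 = 1.
  apply/permP => i; rewrite !expgS expg0 !permM !perm1 !tauE !rhoE.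
  by elim/ord4_ind: i; apply: val_inj.
have hom : dih4 \homg 'D_(4.*2).
  rewrite Grp'_dihedral //; apply/existsP; exists (rho4, tau4); rewrite /= !xpair_eqE.
  by rewrite joing_idl joing_idr rho2 tau2 rt4 !eqxx.
have dv8 : (#|dih4| %| 8)%N by have := card_homg hom; rewrite (@card_dihedral 4).
rewrite isogEcard hom /= (@card_dihedral 4) //.
(* Five distinct elements exclude every proper divisor of 8 as order. *)
pose s := [:: 1; rho4; tau4; rho4 * tau4; tau4 * rho4].
have s_dih : {subset s <= dih4}.
  have [rho_d tau_d] : rho4 \in dih4 /\ tau4 \in dih4.
    by rewrite !mem_gen ?inE ?eqxx ?orbT.
  move=> x; rewrite !inE => /or4P[||| /orP[]] /eqP-> //; rewrite ?group1 ?groupM //.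
have uniq_s : uniq s.
  apply: (@map_uniq _ _ (fun t : {perm 'I_4} => (val (t o0), val (t o1)))).
  by rewrite /= !permM !tauE !rhoE !perm1.
have : (size s <= #|dih4|)%N.
  by rewrite -(card_uniqP uniq_s); apply/subset_leq_card/subsetP.
case/dvdnP: dv8 => [[|[|k]]] // E le5; first by rewrite -[X in (_ <= X)%N]mul1n -E.
by have := leq_mul (isT : 1 < k.+2)%N le5; rewrite -E.
Qed.

(** Subgroups of order 8 are Sylow 2-subgroups of S_4, hence conjugate to [dih4]. *)
Lemma dihedral_transitive4 (H : {group {perm 'I_4}}) : #|H| = 8%N -> H \isog 'D_8.
Proof.
move=> oH; have o_dih : #|dih4| = 8%N by rewrite (card_isog dih4_isog) (@card_dihedral 4).
have syl (K : {group {perm 'I_4}}) : #|K| = 8%N -> 2.-Sylow('Sym_('I_4)) K.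
  by move=> oK; rewrite pHallE Sym_all oK card_Sym card_ord p_part.
have [x _ ->] := Sylow_trans (syl _ o_dih) (syl _ oH).
by rewrite isog_sym; apply: isog_trans (conj_isog _ _); rewrite isog_sym dih4_isog.
Qed.

Variant quartic_group (H : {group {perm 'I_4}}) : Prop :=
  | QuarticC4 of #|H| = 4%N & cyclic H
  | QuarticV4 of #|H| = 4%N & {in H, forall h, h * h = 1}
  | QuarticD4 of #|H| = 8%N
  | QuarticA4 of H :=: 'Alt_('I_4)
  | QuarticS4 of H :=: 'Sym_('I_4).

Lemma transitive4_cases (H : {group {perm 'I_4}}) :
  [transitive H, on setT | 'P] -> quartic_group H.
Proof.
move=> trH; case: (card_transitive4 trH) => oH.
- have [/forall_inP sq1 | /forall_inPn[h Hh nt_h2]] := boolP [forall h in H, h * h == 1].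
    by apply: QuarticV4 => // h /sq1/eqP.
  apply: QuarticC4 => //; apply/cyclicP; exists h; apply/eqP.
  rewrite eq_sym eqEcard cycle_subG Hh oH -orderE.
  have := order_dvdG Hh; rewrite oH.
  have : ~~ (#[h] %| 2) by rewrite order_dvdn expgS expg1.
  by case: #[h] => [|[|[|[|n]]]].
- exact: QuarticD4.
- exact/QuarticA4/Alt4_card12.
apply: QuarticS4; apply/eqP; rewrite eqEcard subsetT card_Sym card_ord oH.
by [].
Qed.

Lemma cyclic_Zp n : (1 < n)%N -> cyclic (Zp n).
Proof.
by move=> n_gt1; rewrite /Zp n_gt1; apply/cyclicP; exists (1%R : 'Z_n); apply: Zp_cycle.
Qed.

Lemma isog_C4 (H : {group {perm 'I_4}}) : #|H| = 4%N -> cyclic H -> H \isog Zp 4.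
Proof. by move=> oH cH; rewrite isog_cyclic_card // cyclic_Zp // card_Zp // oH. Qed.

Lemma abelem_Zp2 : 2.-abelem (Zp 2).
Proof. by apply: prime_abelem => //; rewrite card_Zp. Qed.

Lemma abelem_setX (gT rT : finGroupType) p (G : {group gT}) (H : {group rT}) :
  p.-abelem G -> p.-abelem H -> p.-abelem (setX G H).
Proof.
move=> pG pH; rewrite (dprod_abelem p (setX_dprod G H)); apply/andP; split.
  by rewrite -(isog_abelem (isog_setX1 _ _)).
by rewrite -(isog_abelem (isog_set1X _ _)).
Qed.

Lemma isog_V4 (H : {group {perm 'I_4}}) :
  #|H| = 4%N -> {in H, forall h, h * h = 1} -> H \isog setX (Zp 2) (Zp 2).
Proof.
move=> oH sq1; rewrite (@isog_abelem_card _ _ 2).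
  by rewrite abelem_setX ?abelem_Zp2 // cardsX card_Zp // oH.
apply/exponent2_abelem/exponentP => h Hh; rewrite expgS expg1; exact: sq1.
Qed.

Definition signed_transitive (A : {group signed_perm}) :=
  forall (a : 'Z_2) i j, exists2 x, x \in A & x.1 = a /\ x.2 i = j.

Section SignedGroups.
Variable A : {group signed_perm}.

Definition sndG : {group {perm 'I_4}} := (snd_morphism _ _ @* A)%G.

Lemma sndGP s : reflect (exists a : 'Z_2, (a, s) \in A) (s \in sndG).
Proof.
apply: (iffP morphimP) => [[[a t] _ A_x ->] | [a A_x]]; first by exists a.
by exists (a, s).
Qed.

Hypothesis A_trans : signed_transitive A.

Lemma sndG_trans : [transitive sndG, on setT | 'P].
Proof.
apply/imsetP; exists o0; rewrite // ; apply/esym/setP => j; rewrite in_setT.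
have [[a s] A_x [_ /= sj]] := A_trans 0%R o0 j.
by apply/orbitP; exists s => //; apply/sndGP; exists a.
Qed.

(** Here [1%R] is the nontrivial element of ['Z_2] and [1] the identity permutation: the pair is the
    global negation of the w_i. *)
Lemma signed_full : (1%R : 'Z_2, 1) \in A -> A :=: setX (Zp 2) sndG.
Proof.
move=> A_opp; apply/setP=> -[a s]; rewrite in_setX.
rewrite {1}/Zp /= inE andTb; apply/idP/sndGP => [A_x | [b A_x]]; first by exists a.
have [<- // | ne_ba] := eqVneq b a.
suff -> : (a, s) = (1%R : 'Z_2, 1) * (b, s) by rewrite groupM.
congr (_, _); last by rewrite mul1g.
by case: a b ne_ba {A_x} => [[|[|]] // ?] [[|[|]] // ?] // _; apply: val_inj.
Qed.

(** Without the global negation the projection to permutations has trivial kernel, and the sign is a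
    function of the permutation. *)
Lemma signed_graph : (1%R : 'Z_2, 1) \notin A -> A \isog sndG.
Proof.
move=> nA_opp; apply/isogP; exists (restrm_morphism (subsetT A) (snd_morphism _ _)).
  apply/subsetP => -[a s]; rewrite ker_restrm inE => /andP[A_x /morphpreP[_ /set1P /= s1]].
  move: A_x; rewrite s1; case: a => [[|[|]] // lt_a] A_x.
    by apply/set1P; congr (_, _); apply: val_inj.
  by case/negP: nA_opp; rewrite (_ : 1%R = Ordinal lt_a) //; apply: val_inj.
by rewrite morphim_restrm setIid.
Qed.

End SignedGroups.

(** The elements of sign +1 are transitive on the four indices, so their number is a multiple of 4;
    they have index 2 because the sign -1 occurs. *)
Lemma signed_card_dvd (A : {group signed_perm}) : signed_transitive A -> (8 %| #|A|)%N.
Proof.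
move=> A_trans; pose fst2 := fst_morphism 'Z_2 {perm 'I_4}.
have B_trans : [transitive sndG ('ker_A fst2)%G, on setT | 'P].
  apply/imsetP; exists o0; rewrite //; apply/esym/setP => j; rewrite in_setT.
  have [[a s] A_x [/= a0 sj]] := A_trans 0%R o0 j.
  apply/orbitP; exists s => //; apply/sndGP; exists a; rewrite inE A_x /=.
  by apply/kerP; rewrite ?inE.
have dv4 : (4 %| #|'ker_A fst2|)%N.
  have := atrans_dvd B_trans; rewrite cardsT card_ord => /dvdn_trans; apply.
  exact: dvdn_morphim.
rewrite -(Lagrange (subsetIl A ('ker fst2))) mulnC.
suff -> : #|A : 'ker_A fst2| = 2%N by rewrite (@dvdn_pmul2l 2 4).
rewrite indexgI; have := card_morphim fst2 A; rewrite setTI => <-.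
rewrite (_ : fst2 @* A = setT) ?cardsT ?card_ord //; apply/setP => a; rewrite in_setT.
have [x A_x [x1 _]] := A_trans a o0 o0.
by rewrite -x1; apply: (mem_morphim fst2).
Qed.

Section Classification.
Variable A : {group signed_perm}.
Hypothesis A_trans : signed_transitive A.
Let H := sndG A.

Lemma signed_full_isog (gT : finGroupType) (G : {group gT}) :
  (1%R : 'Z_2, 1) \in A -> H \isog G -> A \isog setX (Zp 2) G.
Proof. by move=> /signed_full-> isoG; apply: isog_setX; rewrite ?isog_refl. Qed.

(** This forces the global negation over C_4, V_4 and A_4, whose orders are not multiples of 8. *)
Lemma signed_graph_card : (1%R : 'Z_2, 1) \notin A -> (8 %| #|H|)%N.
Proof. by move/signed_graph/card_isog <-; apply: signed_card_dvd. Qed.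

Lemma signed_full_card4 : #|H| = 4%N -> (1%R : 'Z_2, 1) \in A.
Proof. by move=> oH; apply/idPn => /signed_graph_card; rewrite oH. Qed.

Lemma signed_isog_C2xC4 : #|H| = 4%N -> cyclic H -> A \isog gC2xC4.
Proof.
by move=> oH cH; apply: signed_full_isog; [exact: signed_full_card4 | exact: isog_C4].
Qed.

Lemma signed_isog_C2xC2xC2 :
  #|H| = 4%N -> {in H, forall h, h * h = 1} -> A \isog gC2xC2xC2.
Proof.
move=> oH sqH; apply: isog_trans (signed_full_isog (signed_full_card4 oH) (isog_V4 oH sqH)) _.
rewrite (@isog_abelem_card _ _ 2) ?abelem_setX ?abelem_Zp2 //=.
by rewrite !cardsX card_Zp.
Qed.

Lemma signed_isog_D4 : #|H| = 8%N -> (1%R : 'Z_2, 1) \notin A -> A \isog gD4.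
Proof.
by move=> oH /signed_graph isoA; apply: isog_trans isoA (dihedral_transitive4 oH).
Qed.

Lemma signed_isog_C2xD4 : #|H| = 8%N -> (1%R : 'Z_2, 1) \in A -> A \isog gC2xD4.
Proof.
by move=> oH fullA; apply: (@signed_full_isog _ [set: 'D_8]%G) => //; apply: dihedral_transitive4.
Qed.

Lemma signed_isog_C2xA4 : H :=: 'Alt_('I_4) -> A \isog gC2xA4.
Proof.
move=> HE; have fullA : (1%R : 'Z_2, 1) \in A.
  by apply/idPn => /signed_graph_card; rewrite HE card_Alt4.
by rewrite (signed_full fullA) -/H HE isog_refl.
Qed.

Lemma signed_isog_C2xS4 :
  H :=: 'Sym_('I_4) -> (1%R : 'Z_2, 1) \in A -> A \isog gC2xS4.
Proof. by move=> HE fullA; rewrite (signed_full fullA) -/H HE isog_refl. Qed.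

Lemma signed_isog_S4 :
  H :=: 'Sym_('I_4) -> (1%R : 'Z_2, 1) \notin A -> A \isog gS4.
Proof. by move=> HE /signed_graph; rewrite -/H HE. Qed.

Lemma signed_classification :
  [\/ A \isog gC2xC2xC2, A \isog gC2xC4, A \isog gD4 | A \isog gC2xD4] \/
  [\/ A \isog gS4, A \isog gC2xA4 | A \isog gC2xS4].
Proof.
have [fullA|graphA] := boolP ((1%R : 'Z_2, 1) \in A).
  case: (transitive4_cases (sndG_trans A_trans)) => [oH cH|oH sqH|oH|HE|HE].
  - by left; apply/Or42/signed_isog_C2xC4.
  - by left; apply/Or41/signed_isog_C2xC2xC2.
  - by left; apply/Or44/signed_isog_C2xD4.
  - by right; apply/Or32/signed_isog_C2xA4.
  - by right; apply/Or33/signed_isog_C2xS4.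
case: (transitive4_cases (sndG_trans A_trans)) => [oH _|oH _|oH|HE|HE].
- by rewrite signed_full_card4 in graphA.
- by rewrite signed_full_card4 in graphA.
- by left; apply/Or43/signed_isog_D4.
- by right; apply/Or32/signed_isog_C2xA4.
- by right; apply/Or31/signed_isog_S4.
Qed.

End Classification.

Local Close Scope group_scope.
Local Open Scope ring_scope.

(** * The Galois group as a group of signed permutations *)

Section SignedImage.
Variables (L : splittingFieldType rat) (w : 'I_4 -> L).
Hypothesis sum_w : \sum_i w i = 0.
Hypothesis w_inj : injective w.
Hypothesis w_opp : forall i j, w i != - w j.
Hypothesis w_stable : forall (g : gal_of {:L}) i, exists j, g (w i) = w j \/ g (w i) = - w j.

Let A := signed_image sum_w w_inj w_opp w_stable.

Lemma signed_image_trans :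
    (forall i j, exists g : gal_of {:L}, g (w i) = w j) ->
    (forall i j, exists g : gal_of {:L}, g (w i) = - w j) ->
  signed_transitive A.
Proof.
move=> tr tr_opp a i j.
have [g gP] : exists g : gal_of {:L}, g (w i) = (-1) ^+ a * w j.
  case: a => [[|[|]] // ?] /=; rewrite ?expr0 ?expr1 ?mul1r ?mulN1r; auto.
have gA : signed_action w g \in A by apply/signed_imageP; exists g; apply: signed_actionP.
exists (signed_action w g) => //; move: gP; rewrite signed_actionP //.
case: (signed_action w g) => [[[|[|]] // lt_b] s] /=;
  case: a => [[|[|]] // lt_a] /=; rewrite ?expr0 ?expr1 ?mul1r ?mulN1r.
- by move/w_inj; split=> //; apply: val_inj.
- by move/eqP; rewrite (negbTE (w_opp _ _)).
- by move/esym/eqP; rewrite (negbTE (w_opp _ _)).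
- by move/oppr_inj/w_inj; split=> //; apply: val_inj.
Qed.

Lemma gal_isog_signed_image :
    (forall g : gal_of {:L}, (forall i, g (w i) = w i) -> g = 1%g) ->
  'Gal({:L} / 1)%g \isog A.
Proof.
move=> faithful; apply/isogP.
exists (signed_action_morphism sum_w w_inj w_opp w_stable) => //.
apply/subsetP => g /morphpreP[_ /set1P /= g1]; apply/set1P/faithful => i.
by rewrite signed_actionP // g1 /= mul1r perm1.
Qed.

Variables (iota : {rmorphism L -> algC}) (v : 'I_4 -> algC).
Hypothesis iota_w : forall i, iota (w i) = v i.

(** The right-hand side mentions neither L nor w, so all normal closures of alpha yield the same
    group of signed permutations. *)
Lemma signed_image_aut x :
  x \in A <->
  exists nu : {rmorphism algC -> algC}, forall i, nu (v i) = (-1) ^+ x.1 * v (x.2 i).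
Proof.
have iota_sw i : iota ((-1) ^+ x.1 * w (x.2 i)) = (-1) ^+ x.1 * v (x.2 i).
  by rewrite rmorphM rmorph_sign iota_w.
split=> [/signed_imageP[g gP] | [nu nuP]].
  have [nu nuP] := gal_extend_aut iota g.
  by exists nu => i; rewrite -iota_w -nuP gP iota_sw.
have [g gP] := aut_restrict_gal iota nu.
by apply/signed_imageP; exists g => i; apply: (fmorph_inj iota); rewrite gP iota_w nuP iota_sw.
Qed.

End SignedImage.

Section NormalClosure.
Variables (alpha : algC) (v : 'I_4 -> algC).
Hypothesis min_v : minCpoly alpha = \prod_i ('X^2 - (v i ^+ 2)%:P).
Hypothesis sum_v : \sum_i v i = 0.

Lemma signed_conjugate i : root (minCpoly alpha) (v i) /\ root (minCpoly alpha) (- v i).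
Proof.
by rewrite min_v prod_signed_roots !root_prod_XsubC; split; apply/mem_signed_roots;
  exists i; [left | right].
Qed.

Variable N : normal_closure alpha.

Lemma nc_lift : exists w : 'I_4 -> N, forall i, nc_emb N (w i) = v i.
Proof.
suff: forall i, exists x : N, nc_emb N x = v i by move/fin_all_exists.
move=> i; have [+ _] := signed_conjugate i.
by rewrite -{1}(nc_genE N) => /root_minCpoly_galP[g ->]; exists (g (nc_gen N)).
Qed.

Variable w : 'I_4 -> N.
Hypothesis emb_w : forall i, nc_emb N (w i) = v i.

Lemma nc_sum : \sum_i w i = 0.
Proof.
apply: (fmorph_inj (nc_emb N)); rewrite rmorph_sum rmorph0.
by apply: etrans sum_v; apply: eq_bigr => i _; apply: emb_w.
Qed.

Lemma nc_uniq : injective w /\ forall i j, w i != - w j.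
Proof.
have /uniq_signed_roots[v_inj v_opp] := signed_roots_uniq min_v.
split=> [i j /(congr1 (nc_emb N)) | i j]; first by rewrite !emb_w => /v_inj.
by rewrite -(inj_eq (fmorph_inj (nc_emb N))) rmorphN /= !emb_w.
Qed.

Lemma nc_conj x y : root (minCpoly alpha) (nc_emb N x) ->
  root (minCpoly alpha) (nc_emb N y) <-> exists g : gal_of {:N}, y = g x.
Proof.
move=> rt_x; have <- : minCpoly (nc_emb N x) = minCpoly alpha.
  by have /conjugate_aut[nu <-] := rt_x; rewrite minCpoly_aut.
split=> [/root_minCpoly_galP[g /fmorph_inj ->] | [g ->]]; first by exists g.
by apply/root_minCpoly_galP; exists g.
Qed.

Lemma nc_stable (g : gal_of {:N}) i : exists j, g (w i) = w j \/ g (w i) = - w j.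
Proof.
have : root (minCpoly alpha) (nc_emb N (g (w i))).
  apply/(@nc_conj (w i)); last by exists g.
  by rewrite emb_w; case: (signed_conjugate i).
rewrite min_v prod_signed_roots root_prod_XsubC => /mem_signed_roots[j].
rewrite -emb_w -rmorphN /= => wj; exists j.
by case: wj => /fmorph_inj; [left | right].
Qed.

Lemma nc_trans i j :
  (exists g : gal_of {:N}, g (w i) = w j) /\ (exists g : gal_of {:N}, g (w i) = - w j).
Proof.
have [rt_i _] := signed_conjugate i; have [rt_j rt_Nj] := signed_conjugate j.
rewrite -!emb_w in rt_i rt_j rt_Nj; rewrite -rmorphN in rt_Nj.
have [+ _] := nc_conj (w j) rt_i => /(_ rt_j)[g1 Dg1].
have [+ _] := nc_conj (- w j) rt_i => /(_ rt_Nj)[g2 Dg2].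
by split; [exists g1 | exists g2].
Qed.

(** Minimality of the normal closure enters here: the kernel K of the action is a normal subgroup,
    so its fixed field is normal over Q; it contains alpha, hence is the whole field. *)
Lemma nc_faithful (g : gal_of {:N}) : (forall i, g (w i) = w i) -> g = 1%g.
Proof.
move=> g_w.
have [w_inj w_opp] := nc_uniq.
pose K := ('ker (signed_action_morphism nc_sum w_inj w_opp nc_stable))%G.
have K_w h i : h \in K -> h (w i) = w i.
  case/morphpreP => _ /set1P /= h1.
  by rewrite (signed_actionP nc_sum w_inj w_opp nc_stable) h1 /= mul1r perm1.
have Kg : g \in K.
  rewrite !inE gal_total /=; apply/eqP.
  apply: (signed_perm_uniq w_inj w_opp) => i.
  by rewrite -(signed_actionP nc_sum w_inj w_opp nc_stable) g_w /= mul1r perm1.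
have fullK : fixedField K = {:N}%VS.
  apply: nc_min.
    have rt : root (minCpoly alpha) (nc_emb N (nc_gen N)) by rewrite nc_genE root_minCpoly.
    move: rt; rewrite min_v prod_signed_roots root_prod_XsubC => /mem_signed_roots[i gen_i].
    apply/fixedFieldP; rewrite ?memvf // => h /K_w h_w.
    move: gen_i; rewrite -emb_w -rmorphN /=.
    by case=> /fmorph_inj->; rewrite ?rmorphN /= h_w.
  have nsK : (K <| 'Gal({:N} / 1))%g by apply: ker_normal.
  by have /and3P[] := normal_fixedField_galois (galois_rat N) nsK.
apply/eqP/gal_eqP => x _; rewrite gal_id.
have : x \in fixedField K by rewrite fullK memvf.
by move/mem_fixedFieldP => [_ ->].
Qed.

End NormalClosure.

Lemma nc_signed_image alpha (v : 'I_4 -> algC) :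
    minCpoly alpha = \prod_i ('X^2 - (v i ^+ 2)%:P) -> \sum_i v i = 0 ->
  exists (L : splittingFieldType rat) (iota : {rmorphism L -> algC}) (w : 'I_4 -> L)
         (A : {group signed_perm}),
    [/\ forall i, iota (w i) = v i, injective w,
        forall x, x \in A <->
          exists g : gal_of {:L}, forall i, g (w i) = (-1) ^+ x.1 * w (x.2 i),
        forall g : gal_of {:L}, exists2 x, x \in A &
          forall i, g (w i) = (-1) ^+ x.1 * w (x.2 i)
      & signed_transitive A /\ has_galois_group alpha A].
Proof.
move=> min_v sum_v.
have N0 := normal_closure_exists alpha; have [w0 emb_w0] := nc_lift min_v N0.
have [inj0 opp0] := nc_uniq min_v emb_w0.
pose A0 := signed_image (nc_sum sum_v emb_w0) inj0 opp0 (nc_stable min_v emb_w0).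
exists N0, (nc_emb N0), w0, A0; split=> //.
- by move=> x; split=> [/signed_imageP // | ?]; apply/signed_imageP.
- move=> g; have gP := signed_actionP (nc_sum sum_v emb_w0) inj0 opp0 (nc_stable min_v emb_w0) g.
  by exists (signed_action w0 g) => //; apply/signed_imageP; exists g.
split.
  by apply: signed_image_trans => i j; have [] := nc_trans min_v emb_w0 i j.
move=> N; have [w emb_w] := nc_lift min_v N; have [inj_w opp_w] := nc_uniq min_v emb_w.
pose A := signed_image (nc_sum sum_v emb_w) inj_w opp_w (nc_stable min_v emb_w).
have -> : A0 = A.
  apply/val_inj/setP => x.
  have [h1 h2] : (x \in A0 <-> x \in A).
    apply: iff_trans (signed_image_aut _ _ _ _ emb_w0 x) _.
    exact: iff_sym (signed_image_aut _ _ _ _ emb_w x).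
  exact/idP/idP.
by apply: gal_isog_signed_image => g; apply: (nc_faithful min_v sum_v emb_w).
Qed.

Lemma relation_galois_groups alpha :
    degree8 alpha -> conjugate_relation alpha ->
  has_galois_group alpha gC2xC2xC2 \/
  has_galois_group alpha gC2xC4 \/
  has_galois_group alpha gD4 \/
  has_galois_group alpha gC2xD4 \/
  has_galois_group alpha gS4 \/
  has_galois_group alpha gC2xA4 \/
  has_galois_group alpha gC2xS4.
Proof.
move=> deg8 rel; have [v [min_v sum_v]] := relation_roots deg8 rel.
have [L [iota [w [A [_ _ _ _ [A_trans galA]]]]]] := nc_signed_image min_v sum_v.
have [[]|[]] := signed_classification A_trans => isoA.
- by left => N; apply: isog_trans (galA N) isoA.
- by right; left => N; apply: isog_trans (galA N) isoA.
- by right; right; left => N; apply: isog_trans (galA N) isoA.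
- by right; right; right; left => N; apply: isog_trans (galA N) isoA.
- by right; right; right; right; left => N; apply: isog_trans (galA N) isoA.
- by right; right; right; right; right; left => N; apply: isog_trans (galA N) isoA.
- by right; right; right; right; right; right => N; apply: isog_trans (galA N) isoA.
Qed.

(** * Irreducibility of even octics *)

Section RationalElements.
Variable L : splittingFieldType rat.
Implicit Types (x y : L) (c : rat) (g : gal_of {:L}).

Lemma rat_elemP x : reflect (exists c, x = c%:A) (x \in 1%VS).
Proof. exact: vlineP. Qed.

Lemma gal_fixed1 x : (forall g, g x = x) -> x \in 1%VS.
Proof. by case/gal_fixed_rat=> c ->; apply/rat_elemP; exists c. Qed.

Lemma gal_fix1 g x : x \in 1%VS -> g x = x.
Proof. by case/rat_elemP=> c ->; apply: gal_rat. Qed.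

Lemma in_alg_inj c d : c%:A = d%:A :> L -> c = d.
Proof. exact: (fmorph_inj (in_alg L)). Qed.

Lemma rat_sqrt x c : x \in 1%VS -> x ^+ 2 = c%:A -> exists e, e ^+ 2 = c.
Proof.
case/rat_elemP=> e -> Dc; exists e; apply: in_alg_inj; rewrite -Dc.
by rewrite exprZn expr1n.
Qed.

End RationalElements.

Lemma sigma_perm (R : comNzRingType) (w : 'I_4 -> R) (s : {perm 'I_4}) :
  sigma3 (w \o s) = sigma3 w /\ sigma4 (w \o s) = sigma4 w.
Proof.
have E : \prod_i ('X - ((w \o s) i)%:P) = \prod_i ('X - (w i)%:P).
  by rewrite [RHS](reindex_inj (@perm_inj _ s)).
rewrite !prod_XsubC4 in E.
have E' k := congr1 (fun f : {poly R} => f`_k) E.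
have := (E' 0%N, E' 1%N); rewrite /= !coefE /= !(mulr0, mulr1, addr0, add0r, oppr0, sub0r).
by case=> -> /oppr_inj ->.
Qed.

Lemma sigma_sign (R : comNzRingType) (w : 'I_4 -> R) (b : bool) :
  sigma3 (fun i => (-1) ^+ b * w i) = (-1) ^+ b * sigma3 w /\
  sigma4 (fun i => (-1) ^+ b * w i) = sigma4 w.
Proof. by rewrite /sigma3 /sigma4; case: b => /=; rewrite ?expr0 ?expr1; split; ring. Qed.

Section Transitivity.
Variables (L : splittingFieldType rat) (w : 'I_4 -> L).
Hypothesis sum_w : \sum_i w i = 0.
Hypothesis w_inj : injective w.
Hypothesis w_opp : forall i j, w i != - w j.
Hypothesis w_stable : forall (g : gal_of {:L}) i, exists j, g (w i) = w j \/ g (w i) = - w j.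
Hypothesis sigma3_irr : sigma3 w \notin 1%VS.
Hypothesis sq_irr : forall i, w i ^+ 2 \notin 1%VS.
Hypothesis mul_irr : forall i j, i != j -> w i * w j \notin 1%VS.
Hypothesis add_irr : forall i j, i != j -> w i + w j \notin 1%VS.

Let x0 := w o0.
Let orb (b : bool) i := root (minPoly 1 x0) ((-1) ^+ b * w i).

Lemma gal_signed (g : gal_of {:L}) : exists (b : bool) (s : {perm 'I_4}),
  forall i, g (w i) = (-1) ^+ b * w (s i).
Proof.
have /= gP := signed_actionP sum_w w_inj w_opp w_stable g.
exists (odd (signed_action w g).1), (signed_action w g).2 => i.
by rewrite signr_odd gP.
Qed.

Lemma gal_sigma (g : gal_of {:L}) (b : bool) (s : {perm 'I_4}) :
    (forall i, g (w i) = (-1) ^+ b * w (s i)) ->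
  g (sigma3 w) = (-1) ^+ b * sigma3 w /\ g (sigma4 w) = sigma4 w.
Proof.
move=> gP; have [e3 e4] := sigma_sign (w \o s) b; have [p3 p4] := sigma_perm w s.
rewrite -{2}p3 -e3 -{2}p4 -e4 {e3 e4 p3 p4} /sigma3 /sigma4.
by rewrite !(rmorphD, rmorphM) /= !gP.
Qed.

Lemma orbit_gal (g : gal_of {:L}) (b c : bool) (s : {perm 'I_4}) i :
  (forall j, g (w j) = (-1) ^+ b * w (s j)) -> orb (c (+) b) (s i) = orb c i.
Proof.
move=> gP; rewrite /orb; have gE : g ((-1) ^+ c * w i) = (-1) ^+ (c (+) b) * w (s i).
  by rewrite rmorphM rmorph_sign /= gP mulrA signr_addb.
rewrite -gE; apply/root_minPoly_galP/root_minPoly_galP => [[h E] | [h ->]].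
  exists (h * g^-1)%g; rewrite galM ?memvf // -E -galM ?memvf // mulgV gal_id.
  by [].
by exists (h * g)%g; rewrite galM ?memvf.
Qed.

(** This counts which of w_i and - w_i are conjugate to w_0; the level sets [K n] are stable under
    the Galois permutations. *)
Let mult i := (orb false i + orb true i)%N.
Let K n := [set i | mult i == n].

Lemma mult_gal (g : gal_of {:L}) (b : bool) (s : {perm 'I_4}) i :
  (forall j, g (w j) = (-1) ^+ b * w (s j)) -> mult (s i) = mult i.
Proof.
move=> gP; rewrite /mult -(orbit_gal false i gP) -(orbit_gal true i gP) /=.
by case: b {gP}; rewrite // addnC.
Qed.

(** A stable singleton {i} would make w_i^2 rational and a stable pair {i, j} would make w_i w_j
    rational, the common sign squaring away. *)
Lemma card_K n : #|K n| != 1%N /\ #|K n| != 2%N.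
Proof.
have K_gal (g : gal_of {:L}) (b : bool) (s : {perm 'I_4}) i :
    (forall j, g (w j) = (-1) ^+ b * w (s j)) -> (s i \in K n) = (i \in K n).
  by move=> gP; rewrite !inE (mult_gal i gP).
split; apply/negP.
  case/cards1P => i DK; case/negP: (sq_irr i); apply: gal_fixed1 => g.
  have [b [s gP]] := gal_signed g.
  have /eqP si : s i == i by have := K_gal g b s i gP; rewrite DK !inE eqxx.
  by rewrite rmorphXn /= gP si exprMn sqrr_sign mul1r.
case/cards2P => i [j [ne_ij DK]]; case/negP: (mul_irr ne_ij); apply: gal_fixed1 => g.
have [b [s gP]] := gal_signed g.
have /set2P si : s i \in [set i; j] by rewrite -DK (K_gal g b) // DK !inE eqxx.
have /set2P sj : s j \in [set i; j] by rewrite -DK (K_gal g b) // DK !inE eqxx orbT.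
have ne_s : s i != s j by rewrite (inj_eq perm_inj).
rewrite rmorphM /= !gP mulrACA -expr2 sqrr_sign mul1r.
case: si sj ne_s => -> [] ->; rewrite ?eqxx // => _; exact: mulrC.
Qed.

(** By [card_K], [mult] is constant: a level set of size 3 would leave a singleton as another one.
    If the constant is 1, let D be the set of i with w_i conjugate to w_0; each automorphism
    preserves D, or complements it when its sign is -1. If |D| = 2, the sum over D is fixed;
    otherwise the sign -1 never occurs and sigma_3 is fixed. Both are excluded. *)
Lemma orbit_irr c i : orb c i.
Proof.
have orb00 : orb false o0 by rewrite /orb mul1r root_minPoly.
have K_full n : K n = set0 \/ K n = setT.
  have [n1 n2] := card_K n; have cK := cardsC (K n); rewrite card_ord in cK.
  have [K0|[j Kj]] := set_0Vmem (K n); first by left.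
  right; apply/eqP; rewrite eqEcard subsetT cardsT card_ord.
  have : #|~: K n| != 1%N.
    apply/negP=> /cards1P[k CK].
    have [+ _] := card_K (mult k); case/negP; apply/cards1P; exists k.
    apply/setP => l; rewrite !inE; apply/eqP/eqP => [El|->//].
    apply/set1P; rewrite -CK inE inE El.
    by have := set11 k; rewrite -{1}CK !inE.
  have : (0 < #|K n|)%N by apply/card_gt0P; exists j.
  by lia.
have : mult i = 2%N; last by rewrite /mult; case: c; do 2!case: (orb _ _).
have [mult1|nmult1] := eqVneq (mult o0) 1%N; last first.
  have mult0 : mult o0 = 2%N by move: nmult1; rewrite /mult orb00; case: (orb _ _).
  have [/setP/(_ o0)|/setP/(_ i)] := K_full 2%N; rewrite !inE ?mult0 // => /eqP.
  by [].
have {K_full} mult1' j : mult j = 1%N.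
  have [/setP/(_ o0)|/setP/(_ j)] := K_full 1%N; rewrite !inE ?mult1 // => /eqP.
  by [].
have orbT j : orb true j = ~~ orb false j.
  by have := mult1' j; rewrite /mult; do 2!case: (orb _ _).
pose D := [set j | orb false j].
have D_gal (g : gal_of {:L}) (b : bool) (s : {perm 'I_4}) j :
    (forall k, g (w k) = (-1) ^+ b * w (s k)) -> (s j \in D) = (j \in D) (+) b.
  move=> gP; rewrite !inE -(orbit_gal false j gP) /=; case: (b).
    by rewrite orbT addbT negbK.
  by rewrite addbF.
have [/eqP/cards2P[j [k [ne_jk DE]]] | nD2] := eqVneq #|D| 2%N.
  case/negP: (add_irr ne_jk); apply: gal_fixed1 => g.
  have [b [s gP]] := gal_signed g.
  pose S (E : {set 'I_4}) := \sum_(i in E) w i.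
  have -> : w j + w k = S D by rewrite /S DE big_setU1 ?inE // big_set1.
  have -> : g (S D) = (-1) ^+ b * S [set s i | i in D].
    rewrite /S rmorph_sum big_imset /=; last by move=> ? ? _ _; apply: perm_inj.
    by rewrite mulr_sumr; apply: eq_bigr => l _; apply: gP.
  have sDE : [set s l | l in D] = if b then ~: D else D.
    apply/setP => l; rewrite -[l](permKV s) mem_imset; last exact: perm_inj.
    have := D_gal g b s ((s^-1)%g l) gP; case: (b) => El; rewrite ?in_setC El.
      by rewrite addbT negbK.
    by rewrite addbF.
  rewrite sDE; case: (b); last by rewrite mul1r.
  have SC : S (~: D) + S D = 0.
    rewrite -[RHS]sum_w [RHS](bigID (mem D)) /= addrC; congr (_ + _).
    by apply: eq_bigl => l; rewrite in_setC.
  by rewrite expr1 mulN1r; apply/eqP; rewrite eqr_oppLR -addr_eq0 SC.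
case/negP: sigma3_irr; apply: gal_fixed1 => g; have [b [s gP]] := gal_signed g.
have [-> _] := gal_sigma gP; suff -> : b = false by rewrite mul1r.
apply/negbTE/negP => b1; case/negP: nD2; apply/eqP.
have : [set s j | j in D] = ~: D.
  apply/setP => j; rewrite -[j](permKV s) mem_imset ?in_setC; last exact: perm_inj.
  have -> := D_gal g b s ((s^-1)%g j) gP.
  by rewrite b1 addbT negbK.
move/(congr1 (fun E : {set 'I_4} => #|E|)); rewrite card_imset; last exact: perm_inj.
by move=> /= eqD; have := congr1 half (cardsC D); rewrite card_ord -eqD addnn doubleK. 
Qed.
 
End Transitivity.

Lemma number_field_of (v : 'I_4 -> algC) :
  exists (L : splittingFieldType rat) (iota : {rmorphism L -> algC}) (w : 'I_4 -> L),
    forall i, iota (w i) = v i.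
Proof.
have [z _ [ps Ds]] := algC_PET [seq v i | i <- enum 'I_4].
have N := normal_closure_exists z; exists N, (nc_emb N).
suff: forall i, exists x : N, nc_emb N x = v i by move/fin_all_exists.
move=> i; have : v i \in [seq (pQtoC f).[z] | f <- ps] by rewrite -Ds map_f ?mem_enum.
case/mapP => f _ ->; exists (map_poly (in_alg N) f).[nc_gen N].
by rewrite -horner_map /= map_emb_in_alg nc_genE.
Qed.

(** * Discriminant and resolvent cubic of the quartic *)

Definition vandermonde4 (R : pzRingType) (w : 'I_4 -> R) :=
  (w o0 - w o1) * (w o0 - w o2) * (w o0 - w o3)
  * (w o1 - w o2) * (w o1 - w o3) * (w o2 - w o3).

(* The discriminant of X^4 + p X^2 + q X + r, with d = q^2. *)
Definition disc4 (R : pzRingType) (p r d : R) :=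
  16 * p ^+ 4 * r - 4 * p ^+ 3 * d - 128 * p ^+ 2 * r ^+ 2 + 144 * p * r * d
  - 27 * d ^+ 2 + 256 * r ^+ 3.

(** The monic cubic with roots w_i w_j + w_k w_l; it involves the linear coefficient q only through
    d = q^2, so it is rational even when q is not. *)
Definition resolvent (R : pzRingType) (p r d y : R) :=
  y ^+ 3 - p * y ^+ 2 - 4 * r * y + 4 * p * r - d.

Section Identities.
Variable R : comPzRingType.
Variable w : 'I_4 -> R.
Hypothesis sum_w : \sum_i w i = 0.

Lemma vandermonde4_sqr :
  vandermonde4 w ^+ 2 = disc4 (sigma2 w) (sigma4 w) (sigma3 w ^+ 2).
Proof.
have w3 : w o3 = - (w o0 + w o1 + w o2).
  by move: sum_w; rewrite big_ord4 /= => /eqP; rewrite addrC addr_eq0 => /eqP.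
by rewrite /vandermonde4 /disc4 /sigma2 /sigma3 /sigma4 w3; ring.
Qed.

Lemma vandermonde4_eq0 i j : i != j -> w i = w j -> vandermonde4 w = 0.
Proof.
by rewrite /vandermonde4; elim/ord4_ind: i; elim/ord4_ind: j => // _ ->; ring.
Qed.

Lemma sigma4_pairs i j k l : uniq [:: i; j; k; l] -> (w i * w j) * (w k * w l) = sigma4 w.
Proof.
rewrite /sigma4.
by elim/ord4_ind: i; elim/ord4_ind: j; elim/ord4_ind: k; elim/ord4_ind: l => // _; ring.
Qed.

(** The second identity uses w_k + w_l = - (w_i + w_j). *)
Lemma pair_identities i j k l : uniq [:: i; j; k; l] ->
  let th := w i * w j + w k * w l in
  resolvent (sigma2 w) (sigma4 w) (sigma3 w ^+ 2) th = 0 /\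
  (w i + w j) ^+ 2 = th - sigma2 w.
Proof.
have w3 : w o3 = - (w o0 + w o1 + w o2).
  by move: sum_w; rewrite big_ord4 /= => /eqP; rewrite addrC addr_eq0 => /eqP.
rewrite /resolvent /sigma2 /sigma3 /sigma4.
by elim/ord4_ind: i; elim/ord4_ind: j; elim/ord4_ind: k; elim/ord4_ind: l => // _;
   rewrite /= w3; split; ring.
Qed.

Lemma horner_square x : \prod_i (x ^+ 2 - w i ^+ 2) =
  (x ^+ 4 + sigma2 w * x ^+ 2 + sigma4 w) ^+ 2 - sigma3 w ^+ 2 * x ^+ 2.
Proof.
have w3 : w o3 = - (w o0 + w o1 + w o2).
  by move: sum_w; rewrite big_ord4 /= => /eqP; rewrite addrC addr_eq0 => /eqP.
by rewrite big_ord4 /= /sigma2 /sigma3 /sigma4 w3; ring.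
Qed.

End Identities.

Lemma complement_pair (i j : 'I_4) : i != j -> exists k l, uniq [:: i; j; k; l].
Proof.
by elim/ord4_ind: i; elim/ord4_ind: j => // _;
  (do [exists o0, o1; by [] | exists o0, o2; by [] | exists o0, o3; by [] |
       exists o1, o2; by [] | exists o1, o3; by [] | exists o2, o3; by []]).
Qed.

Section Morphism.
Variables (R S : pzRingType) (f : {rmorphism R -> S}).

Lemma rmorph_disc4 p r d : f (disc4 p r d) = disc4 (f p) (f r) (f d).
Proof. by rewrite /disc4 !(rmorph_nat, rmorphB, rmorphD, rmorphM, rmorphXn). Qed.

Lemma rmorph_resolvent p r d y : f (resolvent p r d y) = resolvent (f p) (f r) (f d) (f y).
Proof. by rewrite /resolvent !(rmorph_nat, rmorphB, rmorphD, rmorphM, rmorphXn). Qed.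

End Morphism.

Lemma map_even_octic (R S : comNzRingType) (f : {rmorphism R -> S}) p r d :
  map_poly f (even_octic p r d) = even_octic (f p) (f r) (f d).
Proof.
by rewrite /even_octic rmorphB rmorphXn !rmorphD /= !map_polyZ !map_polyXn map_polyC.
Qed.

Section RationalParameters.
Variables (p r d : rat) (L : splittingFieldType rat) (w : 'I_4 -> L).
Hypothesis sum_w : \sum_i w i = 0.
Hypothesis s2w : sigma2 w = p%:A.
Hypothesis s3w : sigma3 w ^+ 2 = d%:A.
Hypothesis s4w : sigma4 w = r%:A.

Lemma in_algD (a b : rat) : (a + b)%:A = a%:A + b%:A :> L.
Proof. exact: scalerDl. Qed.
Lemma in_algN (a : rat) : (- a)%:A = - a%:A :> L.
Proof. exact: scaleNr. Qed.
Lemma in_algM (a b : rat) : (a * b)%:A = a%:A * b%:A :> L.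
Proof. exact: (rmorphM (in_alg L)). Qed.
Lemma in_algX (a : rat) n : (a ^+ n)%:A = a%:A ^+ n :> L.
Proof. exact: (rmorphXn (in_alg L)). Qed.
Lemma in_alg_nat n : (n%:R : rat)%:A = n%:R :> L.
Proof. exact: (rmorph_nat (in_alg L)). Qed.
Definition in_algE := (in_alg_nat, in_algN, in_algM, in_algX, in_algD).

Lemma pair_resolvent i j k l (c : rat) : uniq [:: i; j; k; l] ->
  w i * w j + w k * w l = c%:A -> resolvent p r d c = 0.
Proof.
move=> u_ijkl Dc; have [+ _] := pair_identities sum_w u_ijkl.
rewrite /= Dc s2w s3w s4w => E; apply: (@in_alg_inj L); rewrite scale0r -[RHS]E.
exact: (rmorph_resolvent (in_alg L)).
Qed.

Lemma vandermonde4_sqr_rat : vandermonde4 w ^+ 2 = (disc4 p r d)%:A.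
Proof.
rewrite (vandermonde4_sqr sum_w) s2w s3w s4w.
exact/esym/(rmorph_disc4 (in_alg L)).
Qed.

Lemma octic_eq x : x \in signed_roots w ->
  (x ^+ 4 + p%:A * x ^+ 2 + r%:A) ^+ 2 = d%:A * x ^+ 2.
Proof.
case/mem_signed_roots => i Dx; apply/eqP; rewrite -subr_eq0 -s2w -s3w -s4w.
rewrite -(horner_square sum_w) (bigD1 i) //= mulf_eq0 subr_eq0.
by case: Dx => ->; rewrite ?sqrrN eqxx.
Qed.

Lemma octic_root x :
  (x ^+ 4 + p%:A * x ^+ 2 + r%:A) ^+ 2 = d%:A * x ^+ 2 -> x \in signed_roots w.
Proof.
move/eqP; rewrite -subr_eq0 -s2w -s3w -s4w -(horner_square sum_w).
case/prodf_eq0 => i _; rewrite subr_eq0 eqf_sqr => Dx; apply/mem_signed_roots; exists i.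
by case/orP: Dx => /eqP; [left | right].
Qed.

Lemma parameters_stable (g : gal_of {:L}) i : exists j, g (w i) = w j \/ g (w i) = - w j.
Proof.
apply/mem_signed_roots/octic_root.
have /octic_eq E : w i \in signed_roots w by apply/mem_signed_roots; exists i; left.
have := congr1 g E; rewrite !(rmorphD, rmorphM, rmorphXn) /= !gal_rat.
by [].
Qed.

Hypothesis d_irr : forall c, c ^+ 2 != d.
Hypothesis sq_irr : forall c, (c ^+ 2 + p * c + r) ^+ 2 != d * c.
Hypothesis resolvent_irr : forall c, resolvent p r d c = 0 ->
  forall e, e ^+ 2 != c - p /\ e ^+ 2 != c ^+ 2 - 4 * r.
Hypothesis disc_neq0 : disc4 p r d != 0.

Lemma w_sq_irr i : w i ^+ 2 \notin 1%VS.
Proof.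
apply/rat_elemP => -[c Dc].
have /octic_eq E : w i \in signed_roots w by apply/mem_signed_roots; exists i; left.
have /eqP[] := sq_irr c; apply: (@in_alg_inj L); rewrite !in_algE -Dc -[RHS]E.
by ring.
Qed.

Lemma w_add_irr i j : i != j -> w i + w j \notin 1%VS.
Proof.
move=> ne_ij; apply/rat_elemP => -[e De]; have [k [l u_ijkl]] := complement_pair ne_ij.
have [_] := pair_identities sum_w u_ijkl; rewrite /= De s2w => Dth.
have Dc : w i * w j + w k * w l = (e ^+ 2 + p)%:A by rewrite !in_algE Dth; ring.
have [] := resolvent_irr (pair_resolvent u_ijkl Dc) e.
by rewrite addrK eqxx.
Qed.

Lemma w_mul_irr i j : i != j -> w i * w j \notin 1%VS.
Proof.
move=> ne_ij; apply/rat_elemP => -[y Dy]; have [k [l u_ijkl]] := complement_pair ne_ij.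
have nz_w m : w m != 0.
  by apply: contraNneq (w_sq_irr m) => ->; rewrite expr0n mem0v.
have nz_y : y != 0.
  by apply/eqP => y0; have /eqP := mulf_neq0 (nz_w i) (nz_w j); rewrite Dy y0 scale0r.
(* The complementary product is r / y, so c = y + r / y is a rational root of the resolvent with c^2
   - 4 r = (y - r / y)^2. *)
have Dz : w k * w l = (r / y)%:A.
  apply: (mulfI (mulf_neq0 (nz_w i) (nz_w j))); rewrite (sigma4_pairs w u_ijkl) s4w Dy.
  by rewrite -in_algM mulrC divfK.
have Dc : w i * w j + w k * w l = (y + r / y)%:A by rewrite Dy Dz in_algD.
have [_] := resolvent_irr (pair_resolvent u_ijkl Dc) (y - r / y).
by case/eqP; field.
Qed.

Lemma parameters_uniq : injective w /\ forall i j, w i != - w j.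
Proof.
split=> [i j /eqP Dw | i j].
  apply/eqP/negPn/negP => ne_ij; case/negP: disc_neq0; apply/eqP.
  apply: (@in_alg_inj L); rewrite -vandermonde4_sqr_rat.
  by rewrite (vandermonde4_eq0 ne_ij (eqP Dw)) expr0n scale0r.
apply/negP; rewrite -addr_eq0 => /eqP Dw; have [Dij|ne_ij] := eqVneq i j.
  case/negP: (w_sq_irr i); move: Dw; rewrite Dij -mulr2n -scaler_nat => /eqP.
  by rewrite scaler_eq0 => /= /eqP ->; rewrite expr0n mem0v.
by case/negP: (w_add_irr ne_ij); rewrite Dw mem0v.
Qed.

Lemma sigma3_irr : sigma3 w \notin 1%VS.
Proof.
by apply/negP => /rat_sqrt/(_ s3w)[e De]; case/eqP: (d_irr e).
Qed.

Lemma minPoly_octic : minPoly 1 (w o0) = \prod_i ('X^2 - (w i ^+ 2)%:P).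
Proof.
have [w_inj w_opp] := parameters_uniq.
have orb := orbit_irr sum_w w_inj w_opp parameters_stable sigma3_irr w_sq_irr w_mul_irr w_add_irr.
have uniq_w : uniq (signed_roots w) by apply/uniq_signed_roots.
apply/eqP; rewrite -eqp_monic ?monic_minPoly //; last first.
  by rewrite prod_signed_roots monic_prod_XsubC.
apply/andP; split.
  apply: minPoly_dvdp.
    rewrite (prod_square sum_w) s2w s3w s4w; apply/polyOverP => k.
    apply/rat_elemP; exists ((even_octic p r d)`_k).
    by rewrite -(map_even_octic (in_alg L)) coef_map.
  rewrite prod_signed_roots root_prod_XsubC; apply/mem_signed_roots.
  by exists o0; left.
rewrite prod_signed_roots; apply: uniq_roots_dvdp; last by rewrite uniq_rootsE.
apply/allP => x /mem_signed_roots[i [->|->]].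
  by have := orb false i; rewrite mul1r.
by have := orb true i; rewrite expr1 mulN1r.
Qed.

End RationalParameters.

(** The hypotheses are statements over [rat] that exclude rational values of sigma_3, w_i^2, w_i +
    w_j and w_i w_j. The last two go through c - p = (w_i + w_j)^2 and c^2 - 4 r = (w_i w_j - w_k
    w_l)^2, for c the root of the resolvent attached to the pairing. *)
Lemma even_octic_realized (p r d : rat) :
    (forall c, c ^+ 2 != d) ->
    (forall c, (c ^+ 2 + p * c + r) ^+ 2 != d * c) ->
    (forall c, resolvent p r d c = 0 ->
       forall e, e ^+ 2 != c - p /\ e ^+ 2 != c ^+ 2 - 4 * r) ->
    disc4 p r d != 0 ->
  exists v : 'I_4 -> algC,
    [/\ minCpoly (v o0) = \prod_i ('X^2 - (v i ^+ 2)%:P),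
        minCpoly (v o0) = pQtoC (even_octic p r d)
      & [/\ \sum_i v i = 0, sigma2 v = ratr p, sigma3 v ^+ 2 = ratr d & sigma4 v = ratr r]].
Proof.
move=> d_irr sq_irr res_irr nz_disc.
have [v [sum_v s2v s3v s4v]] := quartic_roots (ratr p) (sqrtC (ratr d)) (ratr r).
have {}s3v : sigma3 v ^+ 2 = ratr d by rewrite s3v sqrrN sqrtCK.
have [L [iota [w iota_w]]] := number_field_of v.
have iota_inj := fmorph_inj iota.
have sum_w : \sum_i w i = 0.
  by apply: iota_inj; rewrite rmorph_sum rmorph0; apply: etrans sum_v; apply: eq_bigr.
have s2w : sigma2 w = p%:A.
  by apply: iota_inj; rewrite emb_rat -s2v /sigma2 !(rmorphD, rmorphM) /= !iota_w.
have s3w : sigma3 w ^+ 2 = d%:A.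
  by apply: iota_inj; rewrite emb_rat -s3v rmorphXn /sigma3 !(rmorphD, rmorphM) /= !iota_w.
have s4w : sigma4 w = r%:A.
  by apply: iota_inj; rewrite emb_rat -s4v /sigma4 !rmorphM /= !iota_w.
have Dm := minPoly_octic sum_w s2w s3w s4w d_irr sq_irr res_irr nz_disc.
exists v; have Dv : minCpoly (v o0) = \prod_i ('X^2 - (v i ^+ 2)%:P).
  rewrite -iota_w -map_emb_minPoly Dm rmorph_prod /=; apply: eq_bigr => i _.
  by rewrite rmorphB /= map_polyXn map_polyC /= rmorphXn /= iota_w.
split=> //; rewrite Dv (prod_square sum_v) s2v s3v s4v.
by rewrite -(map_even_octic (ratr : {rmorphism rat -> algC})).
Qed.

(** * Semi-invariants and the resulting group structure *)

Lemma vandermonde4_perm (R : comPzRingType) (w : 'I_4 -> R) (s : {perm 'I_4}) :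
  vandermonde4 (w \o s) = (-1) ^+ s * vandermonde4 w.
Proof.
have vE (u : 'I_4 -> R) : vandermonde4 u = \det (Vandermonde 4 (\row_j u j)).
  rewrite det_Vandermonde big_ord4 /= !(big_mkcond (fun j : 'I_4 => (_ < j)%N)).
  by rewrite !big_ord4 /= !mxE /vandermonde4; ring.
rewrite !vE (_ : Vandermonde 4 (\row_j (w \o s) j) = col_perm s (Vandermonde 4 (\row_j w j))).
  by rewrite col_permE det_mulmx det_perm odd_permV mulrC.
by apply/matrixP => i j; rewrite !mxE.
Qed.

(* Semi-invariant of the stabilizer of the pairing {01|23}: fixed by the
   4-cycles that respect it, negated by (01) and by (02)(13). *)
Definition cyclic4 (R : pzRingType) (w : 'I_4 -> R) :=
  (w o0 * w o1 - w o2 * w o3) * (w o0 - w o1) * (w o2 - w o3).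

Section SignedGaloisImage.
Variables (L : splittingFieldType rat) (w : 'I_4 -> L) (A : {group signed_perm}).
Hypothesis w_inj : injective w.
Hypothesis w_neq0 : forall i, w i != 0.
Hypothesis A_mem : forall x, x \in A <->
  exists g : gal_of {:L}, forall i, g (w i) = (-1) ^+ x.1 * w (x.2 i).
Hypothesis A_gal : forall g : gal_of {:L}, exists2 x, x \in A &
  forall i, g (w i) = (-1) ^+ x.1 * w (x.2 i).

Lemma gal_sigma3 (g : gal_of {:L}) (x : signed_perm) :
  (forall i, g (w i) = (-1) ^+ x.1 * w (x.2 i)) -> g (sigma3 w) = (-1) ^+ x.1 * sigma3 w.
Proof.
move=> gP; have [p3 _] := sigma_perm w x.2.
rewrite -signr_odd -{2}p3 -(sigma_sign _ _).1 /sigma3 !(rmorphD, rmorphM) /= !gP.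
by rewrite signr_odd.
Qed.

Lemma gal_vandermonde4 (g : gal_of {:L}) (x : signed_perm) :
    (forall i, g (w i) = (-1) ^+ x.1 * w (x.2 i)) ->
  g (vandermonde4 w) = (-1) ^+ x.2 * vandermonde4 w.
Proof.
move=> gP; rewrite -vandermonde4_perm /vandermonde4 !(rmorphM, rmorphB) /= !gP.
(* The Vandermonde product has even degree 6, so the common sign disappears. *)
have sg1 : ((-1) ^+ x.1) ^+ 6 = 1 :> L by rewrite exprAC -[X in X ^+ _]signr_odd expr1n.
set e := (-1) ^+ x.1 in sg1 *.
by rewrite -[RHS]mul1r -sg1; ring.
Qed.

Lemma gal_cyclic4 (g : gal_of {:L}) (x : signed_perm) :
    (forall i, g (w i) = (-1) ^+ x.1 * w (x.2 i)) ->
  g (cyclic4 w) = cyclic4 (w \o x.2).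
Proof.
move=> gP; rewrite /cyclic4 !(rmorphM, rmorphB) /= !gP.
have sg1 : ((-1) ^+ x.1) ^+ 4 = 1 :> L by rewrite exprAC -[X in X ^+ _]signr_odd expr1n.
set e := (-1) ^+ x.1 in sg1 *.
by rewrite -[RHS]mul1r -sg1; ring.
Qed.

(** The images of w_i w_j and w_k w_l have the same sum (rational, hence fixed) and the same product
    sigma_4 as the originals, so they are the same two numbers. *)
Lemma gal_pair (x : signed_perm) i j k l : x \in A -> uniq [:: i; j; k; l] ->
    w i * w j + w k * w l \in 1%VS ->
  (x.2 i \in [:: i; j]) = (x.2 j \in [:: i; j]).
Proof.
case/A_mem => g gP u_ijkl /(@gal_fix1 _ g).
have sg1 : ((-1) ^+ x.1) ^+ 2 = 1 :> L by rewrite sqrr_sign.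
have gM m n : g (w m * w n) = w (x.2 m) * w (x.2 n).
  by rewrite rmorphM /= !gP mulrACA -expr2 sg1 mul1r.
rewrite rmorphD /= !gM => eq_th.
have eq_pr : (w (x.2 i) * w (x.2 j)) * (w (x.2 k) * w (x.2 l)) = (w i * w j) * (w k * w l).
  rewrite (sigma4_pairs w u_ijkl).
  have u_s : uniq [:: x.2 i; x.2 j; x.2 k; x.2 l].
    by rewrite -(map_inj_uniq (@perm_inj _ x.2)) in u_ijkl.
  exact: sigma4_pairs.
have {eq_th eq_pr} : w (x.2 i) * w (x.2 j) = w i * w j \/ w (x.2 i) * w (x.2 j) = w k * w l.
  move: eq_th eq_pr; set y := w (x.2 i) * _; set z := w (x.2 k) * _ => eq_th eq_pr.
  have : (y - w i * w j) * (y - w k * w l) = 0.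
    have -> : (y - w i * w j) * (y - w k * w l) =
      y * (y + z) - y * (w i * w j + w k * w l) + (w i * w j * (w k * w l) - y * z) by ring.
    by rewrite eq_th eq_pr !subrr addr0.
  by move/eqP; rewrite mulf_eq0 !subr_eq0 => /orP[] /eqP; [left | right].
have memC m : m \notin [:: i; j] -> m \in [:: k; l].
  move=> m_ij; apply/idPn => m_kl; have u5 : uniq [:: m; i; j; k; l].
    have m_ijkl : m \notin [:: i; j] ++ [:: k; l] by rewrite mem_cat negb_or m_ij.
    by rewrite cons_uniq u_ijkl andbT.
  by have := max_card [in [:: m; i; j; k; l]]; rewrite (card_uniqP u5) card_ord.
(* A mixed product shares exactly one factor with each of [w i * w j] and [w k * w l], so it equals
   neither. *)
have no_mix a b : a \in [:: i; j] -> b \in [:: k; l] ->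
    w a * w b != w i * w j /\ w a * w b != w k * w l.
  move: u_ijkl; rewrite /= !inE !negb_or => /and4P[/and3P[nij nik nil] /andP[njk njl] nkl _].
  have w_eq m n t : m != n -> w t * w m != w t * w n.
    by rewrite (inj_eq (mulfI (w_neq0 t))) (inj_eq w_inj).
  have [nji nki nli] : [/\ j != i, k != i & l != i] by rewrite !(eq_sym _ i).
  have [nkj nlj nlk] : [/\ k != j, l != j & l != k] by split; rewrite eq_sym.
  case/orP=> /eqP-> /orP[]/eqP->; split.
  - exact: w_eq.
  - by rewrite mulrC w_eq.
  - exact: w_eq.
  - by rewrite mulrC [w k * w l]mulrC w_eq.
  - by rewrite [w i * w j]mulrC w_eq.
  - by rewrite mulrC w_eq.
  - by rewrite [w i * w j]mulrC w_eq.
  - by rewrite mulrC [w k * w l]mulrC w_eq.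
have [ai|/memC ai] := boolP (x.2 i \in [:: i; j]);
  have [aj|/memC aj] := boolP (x.2 j \in [:: i; j]) => //.
  by have [n1 n2] := no_mix _ _ ai aj; case=> /eqP; rewrite ?(negbTE n1) ?(negbTE n2).
rewrite mulrC; have [n1 n2] := no_mix _ _ aj ai.
by case=> /eqP; rewrite ?(negbTE n1) ?(negbTE n2).
Qed.

End SignedGaloisImage.

(** * The stabilizer of the pairing {01|23} and its characters *)

Definition pairs01 (s : {perm 'I_4}) := (s o0 \in [:: o0; o1]) = (s o1 \in [:: o0; o1]).

Definition values4 (s : {perm 'I_4}) : seq nat :=
  [:: val (s o0); val (s o1); val (s o2); val (s o3)].

(** On the stabilizer of {01|23} the block exchange (0 2)(1 3) is even, so the parity is counted
    inside the blocks. Adding the exchange bit gives [cyc01], whose kernel there is cyclic of order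
    4. *)
Definition inv01 (s : {perm 'I_4}) := (s o1 < s o0)%N (+) (s o3 < s o2)%N.
Definition cyc01 s := inv01 s (+) (1 < s o0)%N.

Lemma pairs01_values s : pairs01 s -> values4 s \in
  [:: [:: 0; 1; 2; 3]; [:: 1; 0; 2; 3]; [:: 0; 1; 3; 2]; [:: 1; 0; 3; 2];
      [:: 2; 3; 0; 1]; [:: 3; 2; 0; 1]; [:: 2; 3; 1; 0]; [:: 3; 2; 1; 0]]%N.
Proof.
have : uniq (map s [:: o0; o1; o2; o3]) by rewrite (map_inj_uniq perm_inj).
rewrite /pairs01 /values4 /=.
move: (s o0) (s o1) (s o2) (s o3) => a b c d.
by elim/ord4_ind: a; elim/ord4_ind: b => //; elim/ord4_ind: c => //; elim/ord4_ind: d.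
Qed.

Lemma values4P (s : {perm 'I_4}) a b c d : values4 s = [:: val a; val b; val c; val d] ->
  [/\ s o0 = a, s o1 = b, s o2 = c & s o3 = d].
Proof. by case=> /val_inj-> /val_inj-> /val_inj-> /val_inj->. Qed.

Lemma pairs01_ind (P : {perm 'I_4} -> Prop) :
    (forall s : {perm 'I_4}, s o0 = o0 -> s o1 = o1 -> s o2 = o2 -> s o3 = o3 -> P s) ->
    (forall s : {perm 'I_4}, s o0 = o1 -> s o1 = o0 -> s o2 = o2 -> s o3 = o3 -> P s) ->
    (forall s : {perm 'I_4}, s o0 = o0 -> s o1 = o1 -> s o2 = o3 -> s o3 = o2 -> P s) ->
    (forall s : {perm 'I_4}, s o0 = o1 -> s o1 = o0 -> s o2 = o3 -> s o3 = o2 -> P s) ->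
    (forall s : {perm 'I_4}, s o0 = o2 -> s o1 = o3 -> s o2 = o0 -> s o3 = o1 -> P s) ->
    (forall s : {perm 'I_4}, s o0 = o3 -> s o1 = o2 -> s o2 = o0 -> s o3 = o1 -> P s) ->
    (forall s : {perm 'I_4}, s o0 = o2 -> s o1 = o3 -> s o2 = o1 -> s o3 = o0 -> P s) ->
    (forall s : {perm 'I_4}, s o0 = o3 -> s o1 = o2 -> s o2 = o1 -> s o3 = o0 -> P s) ->
  forall s : {perm 'I_4}, pairs01 s -> P s.
Proof.
move=> P1 P2 P3 P4 P5 P6 P7 P8 s /pairs01_values; rewrite !inE.
case/or4P => [||| /or4P[| | | /orP[]]] /eqP.
- by case/(@values4P _ o0 o1 o2 o3); apply: P1.
- by case/(@values4P _ o1 o0 o2 o3); apply: P2.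
- by case/(@values4P _ o0 o1 o3 o2); apply: P3.
- by case/(@values4P _ o1 o0 o3 o2); apply: P4.
- by case/(@values4P _ o2 o3 o0 o1); apply: P5.
- by case/(@values4P _ o3 o2 o0 o1); apply: P6.
- by case/(@values4P _ o2 o3 o1 o0); apply: P7.
- by case/(@values4P _ o3 o2 o1 o0); apply: P8.
Qed.

Lemma cyclic4_perm (R : comPzRingType) (w : 'I_4 -> R) (s : {perm 'I_4}) :
  pairs01 s -> cyclic4 (w \o s) = (-1) ^+ cyc01 s * cyclic4 w.
Proof.
by move: s; apply: pairs01_ind => s s0 s1 s2 s3;
   rewrite /cyclic4 /cyc01 /inv01 /= s0 s1 s2 s3 /=; ring.
Qed.

Lemma odd_pairs01 s : pairs01 s -> odd_perm s = inv01 s.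
Proof.
(* The parity is read off the Vandermonde product at 0, 1, 2, 3, which is nonzero and computable. *)
pose w (i : 'I_4) : int := i.
have signV (b : bool) : vandermonde4 (w \o s) = (-1) ^+ b * vandermonde4 w -> odd_perm s = b.
  rewrite vandermonde4_perm => /eqP; rewrite -subr_eq0 -mulrBl mulf_eq0 => /orP[|//].
  by case: (odd_perm s); case: b.
move=> s_pairs; apply: signV; move: s s_pairs.
by apply: pairs01_ind => s s0 s1 s2 s3; rewrite /vandermonde4 /inv01 /w /= s0 s1 s2 s3.
Qed.

Definition cycle3 : {perm 'I_4} := (tperm o1 o2 * tperm o1 o3)%g.

Lemma cycle3_pairs01 : cycle3 \in ('Alt_('I_4))%g /\ ~ pairs01 cycle3.
Proof.
rewrite Alt_even odd_permM !odd_tperm; split=> //.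
by rewrite /pairs01 /cycle3 !permM !permE /=.
Qed.

Section Characters.
Variables (L : splittingFieldType rat) (w : 'I_4 -> L) (A : {group signed_perm}).
Hypothesis w_inj : injective w.
Hypothesis w_neq0 : forall i, w i != 0.
Hypothesis A_mem : forall x, x \in A <->
  exists g : gal_of {:L}, forall i, g (w i) = (-1) ^+ x.1 * w (x.2 i).
Hypothesis A_gal : forall g : gal_of {:L}, exists2 x, x \in A &
  forall i, g (w i) = (-1) ^+ x.1 * w (x.2 i).
Hypothesis A_trans : signed_transitive A.
Let H := sndG A.

(** Rational means fixed by every automorphism, and a nonzero y is not fixed by one that negates it.
    Deciding whether y^2 is a rational square thus decides whether chi is trivial on A. *)
Lemma char_rational (y : L) (chi : signed_perm -> bool) : y != 0 ->
    (forall (g : gal_of {:L}) x, x \in A -> (forall i, g (w i) = (-1) ^+ x.1 * w (x.2 i)) ->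
       g y = (-1) ^+ chi x * y) ->
  y \in 1%VS <-> {in A, forall x, ~~ chi x}.
Proof.
move=> nz_y y_chi; split=> [y_rat x A_x | chi0].
  have /A_mem[g gP] := A_x; have := y_chi g x A_x gP; rewrite gal_fix1 //.
  case: (chi x) => //; rewrite expr1 mulN1r => /eqP; rewrite -addr_eq0 -mulr2n -scaler_nat.
  by rewrite scaler_eq0 (negbTE nz_y).
apply: gal_fixed1 => g; have [x A_x gP] := A_gal g.
by rewrite (y_chi g x) // (negbTE (chi0 x A_x)) mul1r.
Qed.

Lemma vandermonde4_neq0 : vandermonde4 w != 0.
Proof. by rewrite /vandermonde4 !mulf_neq0 // subr_eq0 (inj_eq w_inj). Qed.

Lemma vandermonde4_char :
  vandermonde4 w \in 1%VS <-> {in A, forall x : signed_perm, ~~ odd_perm x.2}.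
Proof.
apply: (char_rational (chi := fun x : signed_perm => odd_perm x.2)); first exact: vandermonde4_neq0.
by move=> g x _; apply: gal_vandermonde4.
Qed.

Hypothesis sigma3_neq0 : sigma3 w != 0.

Lemma sigma3_vandermonde4_char :
  sigma3 w * vandermonde4 w \in 1%VS <->
  {in A, forall x : signed_perm, ~~ (odd x.1 (+) odd_perm x.2)}.
Proof.
apply: (char_rational (chi := fun x : signed_perm => odd x.1 (+) odd_perm x.2)).
  by rewrite mulf_neq0 ?vandermonde4_neq0.
move=> g x _ gP; rewrite rmorphM /= (gal_sigma3 gP) (gal_vandermonde4 gP).
by rewrite signr_addb -(signr_odd _ x.1) mulrACA.
Qed.

Hypothesis A_pairs : {in A, forall x : signed_perm, pairs01 x.2}.
Hypothesis cyclic4_neq0 : cyclic4 w != 0.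

Lemma cyclic4_char :
  cyclic4 w \in 1%VS <-> {in A, forall x : signed_perm, ~~ cyc01 x.2}.
Proof.
apply: (char_rational (chi := fun x : signed_perm => cyc01 x.2)) => // g x A_x gP.
by rewrite (gal_cyclic4 gP) cyclic4_perm //; apply: A_pairs.
Qed.

Lemma sigma3_cyclic4_char :
  sigma3 w * cyclic4 w \in 1%VS <->
  {in A, forall x : signed_perm, ~~ (odd x.1 (+) cyc01 x.2)}.
Proof.
apply: (char_rational (chi := fun x : signed_perm => odd x.1 (+) cyc01 x.2)).
  by rewrite mulf_neq0.
move=> g x A_x gP; rewrite rmorphM /= (gal_sigma3 gP) (gal_cyclic4 gP).
rewrite cyclic4_perm; last exact: A_pairs.
by rewrite signr_addb -(signr_odd _ x.1) mulrACA.
Qed.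

End Characters.

Local Close Scope ring_scope.
Local Open Scope group_scope.

(** * Recognizing the group from pairings and characters *)

Definition pairing4 : {perm 'I_4} := tperm o0 o2 * tperm o1 o3.

Lemma dih4_pairing : dih4 \subset 'C[pairing4].
Proof.
rewrite gen_subG; apply/subsetP => s /set2P[] ->;
  apply/cent1P/permP => i; rewrite /pairing4 !permM !permE /=;
  by elim/ord4_ind: i; apply/val_inj.
Qed.

(** H lies in a Sylow 2-subgroup, a conjugate of [dih4], which centralizes (0 2)(1 3). *)
Lemma small_pairing (H : {group {perm 'I_4}}) : (#|H| = 4 \/ #|H| = 8)%N ->
  exists u : {perm 'I_4}, H \subset 'C[pairing4 ^ u].
Proof.
move=> oH; have H2 : 2.-group H.
  by rewrite /pgroup; case: oH => ->.
have [P sylP sHP] := Sylow_superset (Sym_all H) H2.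
have o_dih : #|dih4| = 8%N by rewrite (card_isog dih4_isog) (@card_dihedral 4).
have syl_dih : 2.-Sylow('Sym_('I_4)) dih4.
  by rewrite pHallE Sym_all o_dih card_Sym card_ord p_part.
have [u _ DP] := Sylow_trans syl_dih sylP.
exists u; apply: subset_trans sHP _.
by rewrite cent1J DP conjSg dih4_pairing.
Qed.

Lemma mulgC_Z2 (a b : 'Z_2) : a * b = b * a.
Proof. exact: (@addrC 'Z_2). Qed.

Section Cases.
Variable A : {group signed_perm}.
Hypothesis A_trans : signed_transitive A.
Let H := sndG A.

Lemma pairs01_not_Alt : {in A, forall x : signed_perm, pairs01 x.2} ->
  H :<>: 'Alt_('I_4) /\ H :<>: 'Sym_('I_4).
Proof.
have [cA n_c] := cycle3_pairs01.
move=> A_pairs; have n_cH : cycle3 \notin H.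
  by apply/negP => /sndGP[a A_c]; case: n_c; apply: (A_pairs _ A_c).
by split=> HE; case/negP: n_cH; rewrite HE // inE.
Qed.

Lemma regular_card4 : {in H, forall s : {perm 'I_4}, s o0 = o0 -> s = 1} -> #|H| = 4%N.
Proof.
move=> H_reg; have := card_orbit_stab 'P H o0.
rewrite (atransP (sndG_trans A_trans)) ?inE // cardsT card_ord => <-.
suff -> : 'C_H[o0 | 'P] = 1 by rewrite cards1.
apply/trivgP/subsetP => s /setIP[Hs /astab1P s0].
by rewrite (H_reg s).
Qed.

(** When all three pairings are respected, a permutation fixing 0 fixes every j, because {0, j} is a
    block, and one sending 0 to j sends j back to 0. *)
Lemma case_C2xC2xC2 :
    {in A, forall (x : signed_perm) j, j != o0 ->
       (x.2 o0 \in [:: o0; j]) = (x.2 j \in [:: o0; j])} ->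
  A \isog gC2xC2xC2.
Proof.
move=> A_pairs.
have H_pairs s j : s \in H -> j != o0 -> (s o0 \in [:: o0; j]) = (s j \in [:: o0; j]).
  by case/sndGP => a A_s nz_j; apply: (A_pairs _ A_s).
have H_reg : {in H, forall s : {perm 'I_4}, s o0 = o0 -> s = 1}.
  move=> s Hs s0; apply/permP => j; rewrite perm1; have [->|nz_j] := eqVneq j o0; first by [].
  have := H_pairs s j Hs nz_j; rewrite s0 !inE eqxx /= => /esym/orP[]/eqP //.
  by rewrite -{1}s0 => /perm_inj Dj; rewrite Dj eqxx in nz_j.
have oH := regular_card4 H_reg; apply: signed_isog_C2xC2xC2 => // s Hs.
apply: H_reg; rewrite ?groupM // permM; have [s0|nz_s0] := eqVneq (s o0) o0.
  by rewrite !s0.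
have := H_pairs s (s o0) Hs nz_s0; rewrite !inE eqxx orbT => /esym/orP[]/eqP //.
by move/perm_inj => E; rewrite E eqxx in nz_s0.
Qed.

(** H lies in the cyclic kernel of [cyc01], so it acts regularly. V_4 is excluded because the
    element sending 0 to 2 has a square sending 0 to 1. *)
Lemma case_C2xC4 :
    {in A, forall x : signed_perm, pairs01 x.2} ->
    {in A, forall x : signed_perm, ~~ cyc01 x.2} ->
  A \isog gC2xC4.
Proof.
move=> A_pairs A_cyc.
have H_pairs s : s \in H -> pairs01 s by case/sndGP => a A_s; apply: (A_pairs _ A_s).
have H_cyc s : s \in H -> ~~ cyc01 s by case/sndGP => a A_s; apply: (A_cyc _ A_s).
have H_reg : {in H, forall s : {perm 'I_4}, s o0 = o0 -> s = 1}.
  move=> s Hs s0; apply/permP => j; rewrite perm1.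
  have [s_p s_c] := (H_pairs s Hs, H_cyc s Hs); move: s s_p s_c s0 {Hs}.
  by apply: pairs01_ind => s s0 s1 s2 s3; rewrite /cyc01 /inv01 s0 s1 s2 s3 // => _ _;
    elim/ord4_ind: j.
have oH := regular_card4 H_reg; have [n_Alt n_Sym] := pairs01_not_Alt A_pairs.
have [[a s] A_s [_ /= s0]] := A_trans 0%R o0 o2.
have Hs : s \in H by apply/sndGP; exists a.
case: (transitive4_cases (sndG_trans A_trans)) => // [_ cH|_ sqH|]; last by rewrite oH.
  exact: signed_isog_C2xC4.
have : (s * s) o0 = o0 by rewrite sqH ?perm1.
have [s_p s_c] := (H_pairs s Hs, H_cyc s Hs).
rewrite permM; move: s s_p s_c s0 {Hs A_s}.
by apply: pairs01_ind => s s0 s1 s2 s3; rewrite /cyc01 /inv01 s0 s1 s2 s3.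
Qed.

(** The global negation has sign -1 and an even permutation, so triviality of this character keeps
    it out of A. *)
Lemma case_D4 :
    {in A, forall x : signed_perm, pairs01 x.2} ->
    {in A, forall x : signed_perm, ~~ (odd x.1 (+) odd_perm x.2)} ->
  A \isog gD4.
Proof.
move=> A_pairs A_sgn; have [n_Alt n_Sym] := pairs01_not_Alt A_pairs.
have graphA : (1%R : 'Z_2, 1) \notin A.
  by apply/negP => /A_sgn; rewrite odd_perm1.
case: (transitive4_cases (sndG_trans A_trans)) => // [oH _|oH _|oH].
- by rewrite signed_full_card4 in graphA.
- by rewrite signed_full_card4 in graphA.
exact: signed_isog_D4.
Qed.

Lemma case_S4 : H :=: 'Alt_('I_4) \/ H :=: 'Sym_('I_4) ->
    {in A, forall x : signed_perm, ~~ (odd x.1 (+) odd_perm x.2)} ->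
  A \isog gS4.
Proof.
move=> HE A_sgn.
have graphA : (1%R : 'Z_2, 1) \notin A.
  by apply/negP => /A_sgn; rewrite odd_perm1.
case: HE => HE; last exact: signed_isog_S4.
by have := signed_graph_card A_trans graphA; rewrite HE card_Alt4.
Qed.

Lemma case_C2xA4 : H :=: 'Alt_('I_4) \/ H :=: 'Sym_('I_4) ->
    {in A, forall x : signed_perm, ~~ odd_perm x.2} ->
  A \isog gC2xA4.
Proof.
move=> HE A_even; apply: signed_isog_C2xA4 => //; case: HE => // HE.
have /sndGP[a /A_even] : tperm o0 o1 \in H by rewrite HE inE.
by rewrite odd_tperm.
Qed.

(** Without the global negation the sign would be a character of S_4. Transpositions being
    conjugate, it would be trivial, against transitivity on signs, or the parity, against the last
    hypothesis. *)
Lemma case_C2xS4 : H :=: 'Alt_('I_4) \/ H :=: 'Sym_('I_4) ->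
    (exists2 x : signed_perm, x \in A & odd_perm x.2) ->
    (exists2 x : signed_perm, x \in A & odd x.1 (+) odd_perm x.2) ->
  A \isog gC2xS4.
Proof.
move=> HE [[a s] A_s /= odd_s] [[b t] A_t /= sgn_t].
have {}HE : H :=: 'Sym_('I_4).
  case: HE => // HE; have : s \in H by apply/sndGP; exists a.
  by rewrite HE Alt_even odd_s.
apply: signed_isog_C2xS4 => //; apply/idPn => graphA.
have A_inj c c' u : (c, u) \in A -> (c', u) \in A -> c = c'.
  move=> A_c A_c'; have := groupM A_c (groupVr A_c').
  rewrite (_ : _ * _ = (c * c'^-1, 1)); last by congr (_, _); rewrite mulgV.
  move: c c' {A_c A_c'} => [[|[|]] // lt_c] [[|[|]] // lt_c'] A_cc.
  - by apply: val_inj.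
  - by case/negP: graphA; rewrite (_ : 1%R = Ordinal lt_c * (Ordinal lt_c')^-1) //; apply: val_inj.
  - by case/negP: graphA; rewrite (_ : 1%R = Ordinal lt_c * (Ordinal lt_c')^-1) //; apply: val_inj.
  - by apply: val_inj.
have [c0 A_c0] : exists c0, (c0, tperm o0 o1) \in A by apply/sndGP; rewrite -/H HE inE.
have A_tperm i j : i != j -> (c0, tperm i j) \in A.
  (* This u sends 0 to i and 1 to j, so it conjugates (0 1) to (i j). *)
  move=> ne_ij; pose v := tperm o0 i; pose u := v * tperm (v o1) j.
  have u0 : u o0 = i.
    by rewrite permM tpermL tpermD // 1?eq_sym // -(tpermL o0 i) (inj_eq perm_inj).
  have u1 : u o1 = j by rewrite permM tpermL.
  have [b' A_u] : exists b', (b', u) \in A by apply/sndGP; rewrite -/H HE inE.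
  have := memJ_norm (c0, tperm o0 o1) (subsetP (normG A) _ A_u); rewrite A_c0.
  rewrite (_ : _ ^ _ = (c0 ^ b', tperm o0 o1 ^ u)) // tpermJ u0 u1.
  by rewrite (_ : c0 ^ b' = c0) //; rewrite conjgE [X in _ * X]mulgC_Z2 mulKg.
have c0_sqr : c0 * c0 = 1 by case: (c0) => [[|[|]] // ?]; apply: val_inj.
have A_expr u : (c0 ^+ odd_perm u, u) \in A.
  have [ts -> ts_pair] := prod_tpermP u; elim: ts ts_pair => [|x ts IHts] /=.
    by rewrite big_nil odd_perm1 group1.
  case/andP=> ne_x /IHts A_ts; rewrite big_cons; set y := \prod_(_ <- _) _ in A_ts *.
  have := groupM (A_tperm _ _ ne_x) A_ts.
  rewrite (_ : _ * _ = (c0 * c0 ^+ odd_perm y, tperm x.1 x.2 * y)) //.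
  rewrite odd_permM odd_tperm ne_x; by case: (odd_perm y); rewrite /= ?expg0 ?expg1 ?mulg1 ?c0_sqr.
have [c0E|c0E] : c0 = 1 \/ c0 = 1%R.
  by case: (c0) => [[|[|]] // ?]; [left | right]; apply: val_inj.
  have [[c z] A_z [/= c1 _]] := A_trans 1%R o0 o0.
  by have := A_inj _ _ _ A_z (A_expr z); rewrite c1 c0E expg1n.
move: sgn_t; rewrite (A_inj _ _ _ A_t (A_expr t)) c0E.
by case: (odd_perm t).
Qed.

Lemma signed_regular i : #|A| = 8%N ->
  {in A &, forall x y : signed_perm, x.1 = y.1 -> x.2 i = y.2 i -> x = y}.
Proof.
move=> oA; pose f (x : signed_perm) := (x.1, x.2 i).
have f_inj : {in A &, injective f}.
  apply/imset_injP; rewrite oA (_ : f @: A = setT) ?cardsT ?card_prod ?card_ord //.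
  apply/setP => -[a j]; rewrite in_setT; have [x A_x [x1 x2]] := A_trans a i j.
  by apply/imsetP; exists x; rewrite // /f x1 x2.
by move=> x y A_x A_y eq1 eq2; apply: f_inj => //; congr (_, _).
Qed.

(* In the regular case A is generated by psi = (1; 0 -> 0), phi = (0; 0 -> 1)
   and rho = (0; 0 -> 2); psi and rho have two possible values each, and each
   combination kills one of the four characters. *)
Lemma case_C2xD4 :
    {in A, forall x : signed_perm, pairs01 x.2} ->
    (exists2 x : signed_perm, x \in A & odd_perm x.2) ->
    (exists2 x : signed_perm, x \in A & cyc01 x.2) ->
    (exists2 x : signed_perm, x \in A & odd x.1 (+) odd_perm x.2) ->
    (exists2 x : signed_perm, x \in A & odd x.1 (+) cyc01 x.2) ->
  A \isog gC2xD4.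
Proof.
move=> A_pairs ex_odd ex_cyc ex_sodd ex_scyc.
have [n_Alt n_Sym] := pairs01_not_Alt A_pairs.
have [oA|nA8] := eqVneq #|A| 8%N; last first.
  case: (transitive4_cases (sndG_trans A_trans)) => // [oH _|oH _|oH].
  - have fullA := signed_full_card4 A_trans oH.
    by move: nA8; rewrite (signed_full fullA) cardsX card_Zp // oH.
  - have fullA := signed_full_card4 A_trans oH.
    by move: nA8; rewrite (signed_full fullA) cardsX card_Zp // oH.
  apply: signed_isog_C2xD4 => //; apply/idPn => graphA.
  by move: nA8; rewrite (card_isog (signed_graph graphA)) oH.
have reg := signed_regular (i := _) oA.
have [[a1 psi] A_psi [/= a1E psi0]] := A_trans 1%R o0 o0.
have [[a2 phi] A_phi [/= a2E phi0]] := A_trans 0%R o0 o1.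
have [[a3 rho] A_rho [/= a3E rho0]] := A_trans 0%R o0 o2.
have odd_val (x : signed_perm) : x \in A -> odd_perm x.2 = inv01 x.2.
  by move=> A_x; apply/odd_pairs01/A_pairs.
have phiE : [/\ phi o1 = o0, phi o2 = o3 & phi o3 = o2].
  (* By regularity, an element of sign +1 fixing an index is trivial; this leaves phi = (0 1)(2
     3). *)
  have n_phi : phi o2 <> o2.
    move=> phi2; have /(congr1 snd) /= phi1 :=
      reg o2 _ _ A_phi (group1 A) a2E (etrans phi2 (esym (perm1 _))).
    by move: phi0; rewrite phi1 perm1.
  have := A_pairs _ A_phi; move: phi0 n_phi => /=; move: (phi); clear.
  by move=> s s0 n2 sP; move: s sP s0 n2; apply: pairs01_ind => s -> -> -> ->.
have psiE : psi o1 = o1 /\ (psi o2 = o2 /\ psi o3 = o3 \/ psi o2 = o3 /\ psi o3 = o2).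
  have := A_pairs _ A_psi; move: psi0 => /=; move: (psi); clear.
  by move=> s s0 sP; move: s sP s0; apply: pairs01_ind => s -> -> -> -> //; auto.
have rhoE : rho o1 = o3 /\ (rho o2 = o0 /\ rho o3 = o1 \/ rho o2 = o1 /\ rho o3 = o0).
  have := A_pairs _ A_rho; move: rho0 => /=; move: (rho); clear.
  by move=> s s0 sP; move: s sP s0; apply: pairs01_ind => s -> -> -> -> //; auto.
have [phi1 phi2 phi3] := phiE; have [psi1 psi23] := psiE; have [rho1 rho23] := rhoE.
have A_list (x : signed_perm) : x \in A -> exists2 e : bool, odd x.1 = e &
    [\/ x.2 = psi ^+ e, x.2 = psi ^+ e * phi, x.2 = psi ^+ e * rho
      | x.2 = psi ^+ e * (rho * phi)].
  move=> A_x; pose e := odd x.1; pose ae : 'Z_2 := e%:R%R; exists e => //.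
  have A_psie : (ae, psi ^+ e) \in A.
    by rewrite /ae; case: (e); rewrite ?expg1 ?expg0 -?a1E //; apply: group1.
  have A_mul z : (0%R : 'Z_2, z) \in A -> (ae, psi ^+ e * z) \in A.
    move=> A_z; have := groupM A_psie A_z.
    by rewrite (_ : _ * _ = (ae, psi ^+ e * z)) //; congr (_, _); apply: addr0.
  have x1E : x.1 = ae.
    by rewrite /ae /e; case: (x.1) => [[|[|]] // ?]; apply: val_inj.
  have psie0 : (psi ^+ e) o0 = o0 by case: (e); rewrite ?expg1 ?expg0 ?perm1.
  rewrite a2E in A_phi; rewrite a3E in A_rho.
  have A_rp : (0%R : 'Z_2, rho * phi) \in A.
    have := groupM A_rho A_phi; rewrite (_ : _ * _ = (0%R : 'Z_2, rho * phi)) //.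
    by congr (_, _); apply: addr0.
  have eq_x z : (0%R : 'Z_2, z) \in A -> x.2 o0 = z o0 -> x.2 = psi ^+ e * z.
    by move=> A_z x0; rewrite (reg o0 _ _ A_x (A_mul z A_z) x1E) //= permM psie0.
  have [x0|x0|x0|x0] : [\/ x.2 o0 = o0, x.2 o0 = o1, x.2 o0 = o2 | x.2 o0 = o3].
    by elim/ord4_ind: (x.2 o0); auto using or4.
  - by apply: Or41; rewrite (eq_x 1) ?mulg1 ?perm1 //; apply: group1.
  - by apply: Or42; apply: eq_x; rewrite // phi0.
  - by apply: Or43; apply: eq_x; rewrite // rho0.
  by apply: Or44; apply: eq_x; rewrite // permM rho0 phi2.
have valE := (psi0, psi1, phi0, phi1, phi2, phi3, rho0, rho1).
(* For psi trivial, the permutations form V_4 or C_4 according to rho; for psi = (2 3), the sign is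
   the parity or [cyc01] of the permutation. *)
case: psi23 => -[psi2 psi3]; case: rho23 => -[rho2 rho3].
- case: ex_odd => x A_x; rewrite odd_val //; have [e _] := A_list x A_x.
  by rewrite /inv01; case=> ->; rewrite ?permM; case: e;
     rewrite ?expg1 ?expg0 ?perm1 ?psi2 ?psi3 ?valE ?rho2 ?rho3 ?valE.
- case: ex_cyc => x A_x; have [e _] := A_list x A_x.
  by rewrite /cyc01 /inv01; case=> ->; rewrite ?permM; case: e;
     rewrite ?expg1 ?expg0 ?perm1 ?psi2 ?psi3 ?valE ?rho2 ?rho3 ?valE.
- case: ex_sodd => x A_x; rewrite odd_val //; have [e ->] := A_list x A_x.
  by rewrite /inv01; case=> ->; rewrite ?permM; case: e;
     rewrite ?expg1 ?expg0 ?perm1 ?psi2 ?psi3 ?valE ?rho2 ?rho3 ?valE.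
case: ex_scyc => x A_x; have [e ->] := A_list x A_x.
by rewrite /cyc01 /inv01; case=> ->; rewrite ?permM; case: e;
   rewrite ?expg1 ?expg0 ?perm1 ?psi2 ?psi3 ?valE ?rho2 ?rho3 ?valE.
Qed.

End Cases.

Local Close Scope group_scope.
Local Open Scope ring_scope.

(** * The seven polynomials *)

(* The binary form with coefficients [cs] (constant term first). *)
Fixpoint binary_form (R : pzRingType) (cs : seq int) (m n : R) : R :=
  if cs is c :: cs' then c%:~R * n ^+ size cs' + m * binary_form cs' m n else 0.

(* Reducing each power keeps the unary arithmetic small. *)
Definition expn_modn (l n k : nat) : nat := iter k (fun y => n * y %% l)%N 1%N.

Lemma expn_modnE l n k : expn_modn l n k = n ^ k %[mod l].
Proof. by elim: k => //= k IHk; rewrite modn_mod -modnMmr IHk modnMmr expnS. Qed.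

Fixpoint binary_form_modn (l : nat) (cs : seq int) (m n : nat) : nat :=
  if cs is c :: cs' then
    ((absz (c %% l)%Z * expn_modn l n (size cs') + m * binary_form_modn l cs' m n) %% l)%N
  else 0%N.

Definition anisotropic_mod (l : nat) (cs : seq int) : bool :=
  all (fun m => all (fun n => if (m == 0%N) && (n == 0%N) then true
    else binary_form_modn l cs m n != 0%N) (iota 0 l)) (iota 0 l).

(** The form has degree [size cs] minus 1; the extra factor n on the left avoids a predecessor. *)
Lemma binary_form_scale (R : comPzRingType) cs (x n : R) :
  binary_form cs (n * x) n * n = n ^+ size cs * binary_form cs x 1.
Proof.
elim: cs => [|c cs IHcs] /=; first by rewrite mul0r mulr0.
set B := binary_form cs (n * x) n in IHcs *.
have -> : (c%:~R * n ^+ size cs + n * x * B) * n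
    = c%:~R * n ^+ size cs * n + n * x * (B * n) by ring.
by rewrite IHcs expr1n exprS; ring.
Qed.

Lemma binary_form_modz (l m n : int) cs :
  (binary_form cs (m %% l)%Z (n %% l)%Z = binary_form cs m n %[mod l])%Z.
Proof.
elim: cs => //= c cs IHcs; rewrite !intz -[LHS]modzDm -[RHS]modzDm.
congr ((_ + _) %% _)%Z; first by rewrite -[LHS]modzMmr modzXm modzMmr.
by rewrite modzMml -[LHS]modzMmr IHcs modzMmr.
Qed.

Lemma binary_form_modnE (l m n : nat) cs : (0 < l)%N ->
  (binary_form cs m%:Z n%:Z %% l)%Z = binary_form_modn l cs m n :> int.
Proof.
move=> l_gt0; elim: cs => [|c cs IHcs] /=; first by rewrite mod0z.
rewrite -modnDml -modnMmr expn_modnE modnMmr modnDml.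
rewrite -modz_nat PoszD !PoszM -rmorphXn /= -IHcs gez0_abs; last first.
  by rewrite modz_ge0 // eqz_nat -lt0n.
by rewrite !intz -[LHS]modzDm -[RHS]modzDm modzMml modzMmr.
Qed.

Lemma rmorph_binary_form (R S : pzRingType) (f : {rmorphism R -> S}) cs m n :
  f (binary_form cs m n) = binary_form cs (f m) (f n).
Proof.
elim: cs => [|c cs IHcs] /=; first by rewrite rmorph0.
by rewrite rmorphD !rmorphM rmorphXn rmorph_int IHcs.
Qed.

(** For a rational root, numerator and denominator give a zero of the form modulo l; anisotropy
    makes l divide both, against coprimality. *)
Lemma anisotropic_mod_neq0 l cs (x : rat) :
  (1 < l)%N -> (0 < size cs)%N -> anisotropic_mod l cs -> binary_form cs x 1 != 0.
Proof.
move=> l_gt1 cs_gt0 ani; apply/eqP => x0.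
have nz_d : (denq x)%:~R != 0 :> rat by rewrite intr_eq0 denq_neq0.
have F0 : binary_form cs (numq x) (denq x) = 0.
  apply: (@intr_inj rat); rewrite (rmorph_binary_form (intmul (1 : rat))).
  apply: (mulIf nz_d); rewrite rmorph0 mul0r /=.
  have -> : (numq x)%:~R = (denq x)%:~R * x :> rat.
    by rewrite mulrC -[X in _ = X * _](divq_num_den x) divfK.
  by rewrite binary_form_scale x0 mulr0.
pose m := absz (numq x %% l)%Z; pose n := absz (denq x %% l)%Z.
have l_neq0 : (l : int) != 0 by rewrite eqz_nat; case: (l) l_gt1.
have Dm : (numq x %% l)%Z = m :> int by rewrite gez0_abs // modz_ge0.
have Dn : (denq x %% l)%Z = n :> int by rewrite gez0_abs // modz_ge0.
have lt_l (k : int) : (absz (k %% l)%Z < l)%N.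
  by rewrite -ltz_nat gez0_abs ?modz_ge0 // ltz_pmod // ltz_nat; apply: ltnW.
have /allP/(_ m) := ani; rewrite mem_iota lt_l => /(_ isT)/allP/(_ n).
rewrite mem_iota lt_l => /(_ isT).
case: ifP => [/andP[/eqP m0 /eqP n0] _ | _ /eqP[]]; last first.
  have := binary_form_modnE m n cs (ltnW l_gt1).
  by rewrite -Dm -Dn binary_form_modz F0 mod0z => -[<-].
have l_num : (l %| numq x)%Z by apply/dvdz_mod0P; rewrite Dm m0.
have l_den : (l %| denq x)%Z by apply/dvdz_mod0P; rewrite Dn n0.
have : (l %| gcdn `|numq x| `|denq x|)%N by rewrite dvdn_gcd; apply/andP.
by rewrite (eqP (coprime_num_den x)) dvdn1; case: (l) l_gt1 => [|[]].
Qed.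

Lemma quadratic_no_root l (a b c : int) (x : rat) :
    (1 < l)%N -> anisotropic_mod l [:: a; b; c] ->
  a%:~R + b%:~R * x + c%:~R * x ^+ 2 <> 0.
Proof.
move=> l_gt1 ani E; have /eqP := @anisotropic_mod_neq0 l [:: a; b; c] x l_gt1 isT ani; apply.
by rewrite /= !expr1n -[RHS]E; ring.
Qed.

Lemma cubic_no_root l (a b c d : int) (x : rat) :
    (1 < l)%N -> anisotropic_mod l [:: a; b; c; d] ->
  a%:~R + b%:~R * x + c%:~R * x ^+ 2 + d%:~R * x ^+ 3 <> 0.
Proof.
move=> l_gt1 ani E; have /eqP := @anisotropic_mod_neq0 l [:: a; b; c; d] x l_gt1 isT ani; apply.
by rewrite /= !expr1n -[RHS]E; ring.
Qed.

Lemma quartic_no_root l (a b c d e : int) (x : rat) :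
    (1 < l)%N -> anisotropic_mod l [:: a; b; c; d; e] ->
  a%:~R + b%:~R * x + c%:~R * x ^+ 2 + d%:~R * x ^+ 3 + e%:~R * x ^+ 4 <> 0.
Proof.
move=> l_gt1 ani E; have /eqP := @anisotropic_mod_neq0 l [:: a; b; c; d; e] x l_gt1 isT ani; apply.
by rewrite /= !expr1n -[RHS]E; ring.
Qed.

Lemma sigma2_perm (R : comNzRingType) (w : 'I_4 -> R) (s : {perm 'I_4}) :
  sigma2 (w \o s) = sigma2 w.
Proof.
have E : \prod_i ('X - ((w \o s) i)%:P) = \prod_i ('X - (w i)%:P).
  by rewrite [RHS](reindex_inj (@perm_inj _ s)).
rewrite !prod_XsubC4 in E.
have := congr1 (fun f : {poly R} => f`_2) E.
by rewrite /= !coefE /= !(mulr0, mulr1, addr0, add0r, oppr0, sub0r).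
Qed.

(** * From rational parameters to the Galois group *)

Record galois_data (p r d : rat) (L : splittingFieldType rat) (w : 'I_4 -> L)
    (A : {group signed_perm}) : Prop := GaloisData {
  gd_sum : \sum_i w i = 0;
  gd_s2 : sigma2 w = p%:A;
  gd_s3 : sigma3 w ^+ 2 = d%:A;
  gd_s4 : sigma4 w = r%:A;
  gd_inj : injective w;
  gd_neq0 : forall i, w i != 0;
  gd_mem : forall x, x \in A <->
    exists g : gal_of {:L}, forall i, g (w i) = (-1) ^+ x.1 * w (x.2 i);
  gd_gal : forall g : gal_of {:L}, exists2 x, x \in A &
    forall i, g (w i) = (-1) ^+ x.1 * w (x.2 i);
  gd_trans : signed_transitive A
}.

Section Realize.
Variables (p r d : rat).
Hypothesis d_irr : forall c, c ^+ 2 != d.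
Hypothesis sq_irr : forall c, (c ^+ 2 + p * c + r) ^+ 2 != d * c.
Hypothesis resolvent_irr : forall c, resolvent p r d c = 0 ->
  forall e, e ^+ 2 != c - p /\ e ^+ 2 != c ^+ 2 - 4 * r.
Hypothesis disc_neq0 : disc4 p r d != 0.

Lemma data_sigma3_neq0 L w A : @galois_data p r d L w A -> sigma3 w != 0.
Proof.
move=> gd; have nz_d : d != 0 by have := d_irr 0; rewrite expr0n eq_sym.
apply: contraNneq nz_d => s0; apply/eqP/(@in_alg_inj L).
by rewrite -(gd_s3 gd) s0 expr0n scale0r.
Qed.

(** The permutation u renumbers the roots, so that a pairing with a rational value can be brought to
    {01|23}; p, r and d are symmetric and do not change. *)
Lemma octic_data_exists : exists (alpha : algC) (v : 'I_4 -> algC),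
  [/\ [/\ degree8 alpha, conjugate_relation alpha & minCpoly alpha = pQtoC (even_octic p r d)],
      sigma2 v = ratr p, sigma3 v ^+ 2 = ratr d, sigma4 v = ratr r &
      \sum_i v i = 0 /\ forall u : {perm 'I_4},
        exists (L : splittingFieldType rat) (iota : {rmorphism L -> algC}) w A,
        [/\ @galois_data p r d L w A, has_galois_group alpha A
          & forall i, iota (w i) = v (u i)]].
Proof.
have [v [min_v Dm [sum_v s2v s3v s4v]]] :=
  even_octic_realized d_irr sq_irr resolvent_irr disc_neq0.
exists (v o0), v.
have deg8 : degree8 (v o0).
  rewrite /degree8 min_v prod_signed_roots size_prod_XsubC.
  by rewrite size_cat !size_map -enumT size_enum_ord.
split=> //; first by split=> //; apply: roots_relation min_v sum_v.
split=> // u.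
have min_vu : minCpoly (v o0) = \prod_i ('X^2 - ((v \o u) i ^+ 2)%:P).
  by rewrite min_v (reindex_inj (@perm_inj _ u)).
have sum_vu : \sum_i (v \o u) i = 0.
  by rewrite -[RHS]sum_v [RHS](reindex_inj (@perm_inj _ u)).
have [L [iota [w [A [iota_w w_inj A_mem A_gal [A_trans galA]]]]]] :=
  nc_signed_image min_vu sum_vu.
exists L, iota, w, A; split=> //.
have iota_inj := fmorph_inj iota.
split=> //.
- by apply: iota_inj; rewrite rmorph_sum rmorph0; apply: etrans sum_vu; apply: eq_bigr.
- apply: iota_inj; rewrite emb_rat -s2v -(sigma2_perm v u).
  by rewrite /sigma2 !(rmorphD, rmorphM) /= !iota_w.
- apply: iota_inj; rewrite emb_rat -s3v -(sigma_perm v u).1.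
  by rewrite rmorphXn /sigma3 !(rmorphD, rmorphM) /= !iota_w.
- apply: iota_inj; rewrite emb_rat -s4v -(sigma_perm v u).2.
  by rewrite /sigma4 !rmorphM /= !iota_w.
move=> i; rewrite -(inj_eq iota_inj) rmorph0 iota_w.
by apply: (@root_degree8_neq0 (v o0)) => //; case: (signed_conjugate min_vu i).
Qed.

Variables (gT : finGroupType) (G : {group gT}).

Lemma realizes_octic :
    (forall L w A, @galois_data p r d L w A -> A \isog G) ->
  realizes (even_octic p r d) G.
Proof.
move=> isoG; have [alpha [v [[deg8 rel Dm] _ _ _ [_ data]]]] := octic_data_exists.
have [L [iota [w [A [gd galA _]]]]] := data 1%g.
by exists alpha; split=> // N; apply: isog_trans (galA N) (isoG _ _ _ gd).
Qed.

Lemma realizes_octic_pair c : resolvent p r d c = 0 ->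
    (forall L w A, @galois_data p r d L w A ->
       w o0 * w o1 + w o2 * w o3 = c%:A -> A \isog G) ->
  realizes (even_octic p r d) G.
Proof.
move=> c0 isoG; have [alpha [v [[deg8 rel Dm] s2v s3v s4v [sum_v data]]]] := octic_data_exists.
have [u Du] : exists u : {perm 'I_4},
    v (u o0) * v (u o1) + v (u o2) * v (u o3) = ratr c.
  (* This product is the resolvent cubic at c, so one of the three pairings takes the value c. *)
  have : (ratr c - (v o0 * v o1 + v o2 * v o3)) * (ratr c - (v o0 * v o2 + v o1 * v o3))
         * (ratr c - (v o0 * v o3 + v o1 * v o2)) = 0 :> algC.
    transitivity (resolvent (sigma2 v) (sigma4 v) (sigma3 v ^+ 2) (ratr c)).
      by rewrite /resolvent /sigma2 /sigma3 /sigma4 (last_root sum_v); ring.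
    by rewrite s2v s3v s4v -rmorph_resolvent c0 rmorph0.
  move/eqP; rewrite !mulf_eq0 !subr_eq0 -orbA => /or3P[] /eqP->.
  - by exists 1%g; rewrite !perm1.
  - exists (tperm o1 o2); rewrite tpermL tpermR !tpermD //.
  exists (tperm o1 o3); rewrite tpermL tpermR !tpermD // [v o2 * _]mulrC //.
have [L [iota [w [A [gd galA iota_w]]]]] := data u.
exists alpha; split=> // N; apply: isog_trans (galA N) (isoG _ _ _ gd _).
by apply: (fmorph_inj iota); rewrite emb_rat -Du rmorphD !rmorphM /= !iota_w.
Qed.

End Realize.

Lemma square_rational (L : splittingFieldType rat) (x : L) (e : rat) :
  x ^+ 2 = (e ^+ 2)%:A -> x \in 1%VS.
Proof.
rewrite in_algX => /eqP; rewrite eqf_sqr => /orP[] /eqP->; apply/rat_elemP.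
  by exists e.
by exists (- e); rewrite in_algN.
Qed.

Lemma square_irrational (L : splittingFieldType rat) (x : L) (c : rat) :
  (forall e, e ^+ 2 != c) -> x ^+ 2 = c%:A -> x \notin 1%VS.
Proof. by move=> c_irr Dx; apply/negP => /rat_sqrt/(_ Dx)[e /eqP]; apply/negP. Qed.

(** For c = w_0 w_1 + w_2 w_3 the first factor is (w_0 w_1 - w_2 w_3)^2. The second is (w_0 - w_1)^2
    (w_2 - w_3)^2, expanded with (w_0 + w_1)^2 = (w_2 + w_3)^2 = c - p. *)
Definition cyclic4_disc (R : pzRingType) (p r c : R) :=
  (c ^+ 2 - 4 * r) * ((c - p) ^+ 2 - 4 * (c - p) * c + 16 * r).

Lemma rmorph_cyclic4_disc (R S : pzRingType) (f : {rmorphism R -> S}) p r c :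
  f (cyclic4_disc p r c) = cyclic4_disc (f p) (f r) (f c).
Proof. by rewrite /cyclic4_disc !(rmorph_nat, rmorphB, rmorphD, rmorphM, rmorphXn). Qed.

Section Data.
Variables (p r d : rat) (L : splittingFieldType rat) (w : 'I_4 -> L) (A : {group signed_perm}).
Hypothesis gd : galois_data p r d w A.

Lemma data_pair i j k l : uniq [:: i; j; k; l] -> w i * w j + w k * w l \in 1%VS ->
  {in A, forall x : signed_perm, (x.2 i \in [:: i; j]) = (x.2 j \in [:: i; j])}.
Proof.
move=> u_ijkl th x A_x.
exact: gal_pair (gd_inj gd) (gd_neq0 gd) (gd_mem gd) _ _ _ _ _ A_x u_ijkl th.
Qed.

Lemma data_pairs01 c : w o0 * w o1 + w o2 * w o3 = c%:A ->
  {in A, forall x : signed_perm, pairs01 x.2}.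
Proof. by move=> Dc; apply: (@data_pair o0 o1 o2 o3) => //; apply/rat_elemP; exists c. Qed.

Lemma sigma3_vandermonde4_sqr :
  (sigma3 w * vandermonde4 w) ^+ 2 = (d * disc4 p r d)%:A.
Proof.
rewrite exprMn (gd_s3 gd) in_algM.
by rewrite (vandermonde4_sqr_rat (gd_sum gd) (gd_s2 gd) (gd_s3 gd) (gd_s4 gd)).
Qed.

Lemma cyclic4_sqr c : w o0 * w o1 + w o2 * w o3 = c%:A ->
  cyclic4 w ^+ 2 = (cyclic4_disc p r c)%:A.
Proof.
move=> Dc; transitivity (cyclic4_disc (sigma2 w) (sigma4 w) (w o0 * w o1 + w o2 * w o3)).
  by rewrite /cyclic4 /cyclic4_disc /sigma2 /sigma4 (last_root (gd_sum gd)); ring.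
rewrite (gd_s2 gd) (gd_s4 gd) Dc; exact/esym/(rmorph_cyclic4_disc (in_alg L)).
Qed.

Lemma sigma3_cyclic4_sqr c : w o0 * w o1 + w o2 * w o3 = c%:A ->
  (sigma3 w * cyclic4 w) ^+ 2 = (d * cyclic4_disc p r c)%:A.
Proof. by move/cyclic4_sqr => Dt; rewrite exprMn (gd_s3 gd) Dt in_algM. Qed.

(** If |H| is 4 or 8, H commutes with a pairing involution f, so the sum of the w_i w_(f i) is fixed
    by the Galois group. This sum is twice a root of the resolvent, which would then be rational. *)
Lemma no_pair_Alt_Sym : (forall c, resolvent p r d c != 0) ->
  sndG A :=: ('Alt_('I_4))%g \/ sndG A :=: ('Sym_('I_4))%g.
Proof.
move=> res_irr.
suff no_small : ~ (#|sndG A| = 4 \/ #|sndG A| = 8)%N.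
  case: (transitive4_cases (sndG_trans (gd_trans gd))) => [oH|oH|oH||]; auto;
    by case: no_small; auto.
case/small_pairing => u /subsetP H_u; pose f := (pairing4 ^ u)%g.
have f_u i : f (u i) = u (pairing4 i) by rewrite /f permJ.
pose th := w (u o0) * w (u o2) + w (u o1) * w (u o3).
have Dth : \sum_i w i * w (f i) = 2%:R * th.
  rewrite (reindex_inj (@perm_inj _ u)) big_ord4 /= !f_u.
  have [-> -> -> ->] : [/\ pairing4 o0 = o2, pairing4 o1 = o3, pairing4 o2 = o0
                         & pairing4 o3 = o1].
    by rewrite /pairing4 !permM !permE.
  by rewrite /th; ring.
have : th \in 1%VS.
  apply: gal_fixed1 => g; apply: (@mulfI _ (2%:R : L)).
    by rewrite -(in_alg_nat L) scaler_eq0 oner_eq0 orbF pnatr_eq0.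
  rewrite -{1}(rmorph_nat g) -rmorphM -Dth rmorph_sum /=.
  have [[a s] A_x gP] := gd_gal gd g.
  have s_f i : s (f i) = f (s i).
    have /H_u/cent1P : s \in sndG A by apply/sndGP; exists a.
    by move/(congr1 (fun t : {perm 'I_4} => t i)); rewrite !permM.
  rewrite [RHS](reindex_inj (@perm_inj _ s)); apply: eq_bigr => i _.
  by rewrite rmorphM /= !gP /= mulrACA -expr2 sqrr_sign mul1r s_f.
case/rat_elemP => c Dc.
have u_u : uniq [:: u o0; u o2; u o1; u o3].
  by rewrite -[X in uniq X]/(map u [:: o0; o2; o1; o3]) map_inj_uniq //; apply: perm_inj.
have := pair_resolvent (gd_sum gd) (gd_s2 gd) (gd_s3 gd) (gd_s4 gd) u_u Dc.
by move/eqP; rewrite (negbTE (res_irr c)).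
Qed.

End Data.

(** In all seven cases p = a / 2, r = (b - p^2) / 2 and d = 2 p r - c. Equations are excluded by
    sign or, with denominators cleared, modulo the first argument of the [no_root] lemmas. Here the
    resolvent has three rational roots, so every pairing is respected. *)
Lemma realized_C2xC2xC2 :
  realizes ('X^8 + 6 *: 'X^6 + 8 *: 'X^4 + 3 *: 'X^2 + (1 / 4)%:P) gC2xC2xC2.
Proof.
have -> : 'X^8 + 6 *: 'X^6 + 8 *: 'X^4 + 3 *: 'X^2 + (1 / 4)%:P
    = even_octic 3 (- (1 / 2)) (- 6) :> {poly rat}.
  by rewrite coef_even_octic; congr (_ + _ *: _ + _ *: _ + _ *: _ + _%:P); lra.
have resE c : resolvent 3 (- (1 / 2)) (- 6) c = c * (c - 1) * (c - 2) :> rat.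
  by rewrite /resolvent; field.
apply: realizes_octic.
- by move=> c; apply/eqP => E; have := sqr_ge0 c; lra.
- by move=> c; apply/eqP => E; apply: (@quartic_no_root 3 1 12 32 24 4 c isT isT); lra.
- move=> c; rewrite resE => /eqP; rewrite !mulf_eq0 !subr_eq0 -orbA.
  case/or3P => /eqP-> e; split; apply/eqP => E.
  + by have := sqr_ge0 e; lra.
  + by apply: (@quadratic_no_root 3 (-2) 0 1 e isT isT); lra.
  + by have := sqr_ge0 e; lra.
  + by apply: (@quadratic_no_root 5 (-3) 0 1 e isT isT); lra.
  + by have := sqr_ge0 e; lra.
  + by apply: (@quadratic_no_root 7 (-6) 0 1 e isT isT); lra.
- have -> : disc4 3 (- (1 / 2)) (- 6) = 4 :> rat by rewrite /disc4; lra.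
  by rewrite pnatr_eq0.
move=> L w A gd; apply: case_C2xC2xC2 (gd_trans gd) _ => x A_x j; rewrite eq_sym => nz_j.
have [k [l u_jkl]] := complement_pair nz_j; apply: (data_pair gd u_jkl) A_x.
have [+ _] := pair_identities (gd_sum gd) u_jkl.
rewrite /= (gd_s2 gd) (gd_s3 gd) (gd_s4 gd); set th := _ + _.
have E3 : (3 : rat)%:A = 3 :> L by apply: in_alg_nat.
have E6 : (- 6 : rat)%:A = - 6 :> L by rewrite in_algN; congr (- _); apply: in_alg_nat.
(* The resolvent involves r = -1/2 only through 2 r = -1, which leaves integer coefficients for
   [ring]. *)
have E2 : 2 * (- (1 / 2) : rat)%:A = - 1 :> L.
  rewrite -(in_alg_nat L 2) -in_algM (_ : 2 * - (1 / 2) = -1) //.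
  by rewrite in_algN scale1r.
rewrite E3 E6 (_ : resolvent _ _ _ _ = th ^+ 3 - 3 * th ^+ 2
  - 2 * (2 * (- (1 / 2) : rat)%:A) * th + 6 * (2 * (- (1 / 2) : rat)%:A) + 6); last first.
  by rewrite /resolvent; ring.
rewrite E2 => E0; have /eqP : th * (th - 1) * (th - 2) = 0 by rewrite -[RHS]E0; ring.
rewrite !mulf_eq0 !subr_eq0 -orbA => /or3P[] /eqP->; first exact: mem0v.
  by apply/rat_elemP; exists 1; rewrite scale1r.
by apply/rat_elemP; exists 2; rewrite (in_alg_nat L 2).
Qed.

Lemma realized_C2xC4 :
  realizes ('X^8 + 7 *: 'X^4 + 8 *: 'X^2 + (49 / 4)%:P) gC2xC4.
Proof.
have -> : 'X^8 + 7 *: 'X^4 + 8 *: 'X^2 + (49 / 4)%:P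
    = even_octic 0 (7 / 2) (- 8) :> {poly rat}.
  rewrite coef_even_octic mulr0 scale0r addr0.
  by congr (_ + _ *: _ + _ *: _ + _%:P); lra.
have resE c : resolvent 0 (7 / 2) (- 8) c = (c + 4) * (c ^+ 2 - 4 * c + 2) :> rat.
  by rewrite /resolvent; field.
apply: (@realizes_octic_pair _ _ _ _ _ _ _ _ _ (- 4)).
- by move=> c; apply/eqP => E; have := sqr_ge0 c; lra.
- by move=> c; apply/eqP => E; apply: (@quartic_no_root 3 49 32 28 0 4 c isT isT); lra.
- move=> c; rewrite resE => /eqP; rewrite mulf_eq0 addr_eq0 => /orP[/eqP-> e|/eqP E0].
    split; apply/eqP => E; first by have := sqr_ge0 e; lra.
    by apply: (@quadratic_no_root 3 (-2) 0 1 e isT isT); lra.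
  by exfalso; apply: (@quadratic_no_root 3 2 (-4) 1 c isT isT); lra.
- have -> : disc4 0 (7 / 2) (- 8) = 9248 :> rat by rewrite /disc4; lra.
  by rewrite pnatr_eq0.
- by rewrite resE; lra.
move=> L w A gd Dc; apply: (case_C2xC4 (gd_trans gd) (data_pairs01 gd Dc)).
have Dt := cyclic4_sqr gd Dc.
have Et : cyclic4_disc 0 (7 / 2) (- 4) = 4 ^+ 2 :> rat by rewrite /cyclic4_disc; lra.
rewrite Et in Dt.
have nz_t : cyclic4 w != 0.
  by rewrite -sqrf_eq0 Dt scaler_eq0 oner_eq0 orbF.
apply/(cyclic4_char (gd_mem gd) (gd_gal gd) (data_pairs01 gd Dc) nz_t).
exact: square_rational Dt.
Qed.

Lemma irrational_char (L : splittingFieldType rat) (y : L) (A : {group signed_perm})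
    (chi : signed_perm -> bool) :
    y \notin 1%VS -> (y \in 1%VS <-> {in A, forall x, ~~ chi x}) ->
  exists2 x, x \in A & chi x.
Proof.
move=> y_irr [_ chi_y]; have [/exists_inP // | /exists_inPn chi0] := boolP [exists x in A, chi x].
by rewrite chi_y in y_irr.
Qed.

Section Vandermonde.
Variables (p r d : rat) (L : splittingFieldType rat) (w : 'I_4 -> L) (A : {group signed_perm}).
Hypothesis gd : galois_data p r d w A.

Lemma data_vandermonde4_sqr : vandermonde4 w ^+ 2 = (disc4 p r d)%:A.
Proof. exact: vandermonde4_sqr_rat (gd_sum gd) (gd_s2 gd) (gd_s3 gd) (gd_s4 gd). Qed.

Lemma data_even : vandermonde4 w \in 1%VS <->
  {in A, forall x : signed_perm, ~~ odd_perm x.2}.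
Proof. exact: vandermonde4_char (gd_inj gd) (gd_mem gd) (gd_gal gd). Qed.

Lemma data_sign_parity : sigma3 w != 0 ->
  sigma3 w * vandermonde4 w \in 1%VS <->
  {in A, forall x : signed_perm, ~~ (odd x.1 (+) odd_perm x.2)}.
Proof. exact: sigma3_vandermonde4_char (gd_inj gd) (gd_mem gd) (gd_gal gd). Qed.

End Vandermonde.

Lemma realized_D4 : realizes ('X^8 + 'X^4 + 4 *: 'X^2 + (1 / 4)%:P) gD4.
Proof.
have -> : 'X^8 + 'X^4 + 4 *: 'X^2 + (1 / 4)%:P
    = even_octic 0 (1 / 2) (- 4) :> {poly rat}.
  rewrite coef_even_octic mulr0 scale0r addr0 -['X^4 in LHS]scale1r.
  by congr (_ + _ *: _ + _ *: _ + _%:P); lra.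
have resE c : resolvent 0 (1 / 2) (- 4) c = (c + 2) * (c ^+ 2 - 2 * c + 2) :> rat.
  by rewrite /resolvent; field.
have d_irr (c : rat) : c ^+ 2 != - 4 by apply/eqP => E; have := sqr_ge0 c; lra.
(* [clear] because [lra] diverges when reading the other rational constants. *)
have discE : disc4 0 (1 / 2) (- 4) = - 4 * 10 ^+ 2 :> rat by rewrite /disc4; clear; lra.
apply: (@realizes_octic_pair _ _ _ d_irr _ _ _ _ [set: 'D_8]%G (- 2)).
- by move=> c; apply/eqP => E; apply: (@quartic_no_root 3 1 16 4 0 4 c isT isT); clear -E; lra.
- move=> c; rewrite resE => /eqP; rewrite mulf_eq0 addr_eq0 => /orP[/eqP-> e|/eqP E0].
    split; apply/eqP => E; first by have := sqr_ge0 e; clear -E; lra.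
    by apply: (@quadratic_no_root 3 (-2) 0 1 e isT isT); clear -E; lra.
  by exfalso; apply: (@quadratic_no_root 3 2 (-2) 1 c isT isT); clear -E0; lra.
- by rewrite discE mulf_eq0 sqrf_eq0 oppr_eq0 !pnatr_eq0.
- by rewrite resE; clear; lra.
move=> L w A gd Dc; apply: (case_D4 (gd_trans gd) (data_pairs01 gd Dc)).
apply/(data_sign_parity gd); first exact: (data_sigma3_neq0 d_irr gd).
apply: (@square_rational L _ (- 4 * 10)); rewrite (sigma3_vandermonde4_sqr gd) discE.
by rewrite mulrA -expr2 -exprMn.
Qed.

(** The squares of the Vandermonde product, of [cyclic4] and of their multiples by sigma_3 are 432,
    -24, -1728 and 96. None is a rational square, so all four characters are nontrivial. *)
Lemma realized_C2xD4 : realizes ('X^8 + 3 *: 'X^4 + 4 *: 'X^2 + (9 / 4)%:P) gC2xD4.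
Proof.
have -> : 'X^8 + 3 *: 'X^4 + 4 *: 'X^2 + (9 / 4)%:P
    = even_octic 0 (3 / 2) (- 4) :> {poly rat}.
  rewrite coef_even_octic mulr0 scale0r addr0.
  by congr (_ + _ *: _ + _ *: _ + _%:P); lra.
have resE c : resolvent 0 (3 / 2) (- 4) c = (c - 2) * (c ^+ 2 + 2 * c - 2) :> rat.
  by rewrite /resolvent; field.
have d_irr (c : rat) : c ^+ 2 != - 4 by apply/eqP => E; have := sqr_ge0 c; lra.
have discE : disc4 0 (3 / 2) (- 4) = 432 :> rat by rewrite /disc4; clear; lra.
have cycE : cyclic4_disc 0 (3 / 2) 2 = - 24 :> rat by rewrite /cyclic4_disc; clear; lra.
apply: (@realizes_octic_pair _ _ _ d_irr _ _ _ _ (setX_group (Zp_group 2) [set: 'D_8]%G) 2).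
- by move=> c; apply/eqP => E; apply: (@quartic_no_root 5 9 16 12 0 4 c isT isT); clear -E; lra.
- move=> c; rewrite resE => /eqP; rewrite mulf_eq0 subr_eq0 => /orP[/eqP-> e|/eqP E0].
    split; apply/eqP => E; last by have := sqr_ge0 e; clear -E; lra.
    by apply: (@quadratic_no_root 3 (-2) 0 1 e isT isT); clear -E; lra.
  by exfalso; apply: (@quadratic_no_root 5 (-2) 2 1 c isT isT); clear -E0; lra.
- by rewrite discE pnatr_eq0.
- by rewrite resE; clear; lra.
move=> L w A gd Dc.
have A_pairs := data_pairs01 gd Dc; have nz_q := data_sigma3_neq0 d_irr gd.
have V2 := data_vandermonde4_sqr gd; rewrite discE in V2.
have t2 := cyclic4_sqr gd Dc; rewrite cycE in t2.
have qV2 := sigma3_vandermonde4_sqr gd; rewrite discE in qV2.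
have qt2 := sigma3_cyclic4_sqr gd Dc; rewrite cycE in qt2.
have nz_t : cyclic4 w != 0.
  by rewrite -sqrf_eq0 t2 scaler_eq0 oner_eq0 orbF oppr_eq0 pnatr_eq0.
apply: (case_C2xD4 (gd_trans gd) A_pairs).
- apply: irrational_char (data_even gd); apply: square_irrational V2 => e.
  by apply/eqP => E; apply: (@quadratic_no_root 5 (-432) 0 1 e isT isT); clear -E; lra.
- apply: irrational_char (cyclic4_char (gd_mem gd) (gd_gal gd) A_pairs nz_t).
  by apply: square_irrational t2 => e; apply/eqP => E; have := sqr_ge0 e; clear -E; lra.
- apply: irrational_char (data_sign_parity gd nz_q); apply: square_irrational qV2 => e.
  by apply/eqP => E; have := sqr_ge0 e; clear -E; lra.
apply: irrational_char
  (sigma3_cyclic4_char (gd_mem gd) (gd_gal gd) nz_q A_pairs nz_t).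
apply: square_irrational qt2 => e; apply/eqP => E.
by apply: (@quadratic_no_root 7 (-96) 0 1 e isT isT); clear -E; lra.
Qed.

(** The resolvent has no root modulo 7, and d times the discriminant is 120^2, so sign and parity
    agree. *)
Lemma realized_S4 : realizes ('X^8 + 4 *: 'X^6 + 4 *: 'X^2 + 4%:P) gS4.
Proof.
have -> : 'X^8 + 4 *: 'X^6 + 4 *: 'X^2 + 4%:P = even_octic 2 (- 2) (- 12) :> {poly rat}.
  rewrite coef_even_octic (_ : 2 ^+ 2 + 2 * - 2 = 0 :> rat) ?scale0r ?addr0; last by lra.
  by congr (_ + _ *: _ + _ *: _ + _%:P); lra.
have resE c : resolvent 2 (- 2) (- 12) c != 0 :> rat.
  apply/eqP => E; apply: (@cubic_no_root 7 (-4) 8 (-2) 1 c isT isT).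
  by rewrite -[RHS]E /resolvent; ring.
have d_irr (c : rat) : c ^+ 2 != - 12 by apply/eqP => E; have := sqr_ge0 c; lra.
have discE : disc4 2 (- 2) (- 12) = - 12 * 10 ^+ 2 :> rat by rewrite /disc4; clear; lra.
apply: (@realizes_octic _ _ _ d_irr).
- by move=> c; apply/eqP => E; apply: (@quartic_no_root 11 4 4 0 4 1 c isT isT); clear -E; lra.
- by move=> c /eqP; rewrite (negbTE (resE c)).
- by rewrite discE mulf_eq0 sqrf_eq0 oppr_eq0 !pnatr_eq0.
move=> L w A gd; apply: (case_S4 (gd_trans gd) (no_pair_Alt_Sym gd resE)).
apply/(data_sign_parity gd); first exact: (data_sigma3_neq0 d_irr gd).
apply: (@square_rational L _ (- 12 * 10)); rewrite (sigma3_vandermonde4_sqr gd) discE.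
by rewrite mulrA -expr2 -exprMn.
Qed.

Lemma realized_C2xA4 : realizes ('X^8 + 6 *: 'X^4 + 8 *: 'X^2 + 9%:P) gC2xA4.
Proof.
have -> : 'X^8 + 6 *: 'X^4 + 8 *: 'X^2 + 9%:P = even_octic 0 3 (- 8) :> {poly rat}.
  rewrite coef_even_octic mulr0 scale0r addr0.
  by congr (_ + _ *: _ + _ *: _ + _%:P); lra.
have resE c : resolvent 0 3 (- 8) c != 0 :> rat.
  apply/eqP => E; apply: (@cubic_no_root 5 8 (-12) 0 1 c isT isT).
  by rewrite -[RHS]E /resolvent; ring.
have d_irr (c : rat) : c ^+ 2 != - 8 by apply/eqP => E; have := sqr_ge0 c; lra.
have discE : disc4 0 3 (- 8) = 72 ^+ 2 :> rat by rewrite /disc4; clear; lra.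
apply: (@realizes_octic _ _ _ d_irr).
- by move=> c; apply/eqP => E; apply: (@quartic_no_root 17 9 8 6 0 1 c isT isT); clear -E; lra.
- by move=> c /eqP; rewrite (negbTE (resE c)).
- by rewrite discE expf_neq0 ?pnatr_eq0.
move=> L w A gd; apply: (case_C2xA4 (gd_trans gd) (no_pair_Alt_Sym gd resE)).
apply/(data_even gd); apply: (@square_rational L _ 72).
by rewrite (data_vandermonde4_sqr gd) discE.
Qed.

(** Neither the discriminant -76 nor its product 152 with d is a rational square. *)
Lemma realized_C2xS4 : realizes ('X^8 + 'X^4 + 2 *: 'X^2 + (1 / 4)%:P) gC2xS4.
Proof.
have -> : 'X^8 + 'X^4 + 2 *: 'X^2 + (1 / 4)%:P
    = even_octic 0 (1 / 2) (- 2) :> {poly rat}.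
  rewrite coef_even_octic mulr0 scale0r addr0 -['X^4 in LHS]scale1r.
  by congr (_ + _ *: _ + _ *: _ + _%:P); lra.
have resE c : resolvent 0 (1 / 2) (- 2) c != 0 :> rat.
  apply/eqP => E; apply: (@cubic_no_root 5 2 (-2) 0 1 c isT isT).
  by rewrite -[RHS]E /resolvent; field.
have d_irr (c : rat) : c ^+ 2 != - 2 by apply/eqP => E; have := sqr_ge0 c; lra.
have discE : disc4 0 (1 / 2) (- 2) = - 76 :> rat by rewrite /disc4; clear; lra.
apply: (@realizes_octic _ _ _ d_irr).
- by move=> c; apply/eqP => E; apply: (@quartic_no_root 3 1 8 4 0 4 c isT isT); clear -E; lra.
- by move=> c /eqP; rewrite (negbTE (resE c)).
- by rewrite discE oppr_eq0 pnatr_eq0.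
move=> L w A gd; have nz_q := data_sigma3_neq0 d_irr gd.
have V2 := data_vandermonde4_sqr gd; rewrite discE in V2.
have qV2 := sigma3_vandermonde4_sqr gd; rewrite discE in qV2.
apply: (case_C2xS4 (gd_trans gd) (no_pair_Alt_Sym gd resE)).
- apply: irrational_char (data_even gd); apply: square_irrational V2 => e.
  by apply/eqP => E; have := sqr_ge0 e; clear -E; lra.
apply: irrational_char (data_sign_parity gd nz_q); apply: square_irrational qV2 => e.
by apply/eqP => E; apply: (@quadratic_no_root 3 (-152) 0 1 e isT isT); clear -E; lra.
Qed.

Theorem theorem2 :
  (forall alpha : algC, degree8 alpha ->
     (conjugate_relation alpha <->
      exists a b c : rat, irreducible_poly (octic a b c) /\
                          minCpoly alpha = pQtoC (octic a b c)))
  /\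
  (forall alpha : algC, degree8 alpha -> conjugate_relation alpha ->
     has_galois_group alpha gC2xC2xC2 \/
     has_galois_group alpha gC2xC4 \/
     has_galois_group alpha gD4 \/
     has_galois_group alpha gC2xD4 \/
     has_galois_group alpha gS4 \/
     has_galois_group alpha gC2xA4 \/
     has_galois_group alpha gC2xS4)
  /\
  (realizes ('X^8 + 6 *: 'X^6 + 8 *: 'X^4 + 3 *: 'X^2 + (1 / 4)%:P) gC2xC2xC2 /\
   realizes ('X^8 + 7 *: 'X^4 + 8 *: 'X^2 + (49 / 4)%:P) gC2xC4 /\
   realizes ('X^8 + 'X^4 + 4 *: 'X^2 + (1 / 4)%:P) gD4 /\
   realizes ('X^8 + 3 *: 'X^4 + 4 *: 'X^2 + (9 / 4)%:P) gC2xD4 /\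
   realizes ('X^8 + 4 *: 'X^6 + 4 *: 'X^2 + 4%:P) gS4 /\
   realizes ('X^8 + 6 *: 'X^4 + 8 *: 'X^2 + 9%:P) gC2xA4 /\
   realizes ('X^8 + 'X^4 + 2 *: 'X^2 + (1 / 4)%:P) gC2xS4).
Proof.
split; first by move=> alpha deg8; apply: relation_octic.
split; first exact: relation_galois_groups.
do ![split]; [exact: realized_C2xC2xC2 | exact: realized_C2xC4 | exact: realized_D4
  | exact: realized_C2xD4 | exact: realized_S4 | exact: realized_C2xA4
  | exact: realized_C2xS4].
Qed.
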